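(* The projection $S_{23}$ consists precisely of the points $(d_2,d_3)\in\mathbb{R}^2$ such that $d_2\ge0$, $d_3\ge0$ (and $d_3\le 1$) and $d_2\le\frac32\big(g_R^{-1}(d_3)-d_3\big)$.
   Context: For a finite graph $G$ and a $k$-vertex graph $H$, $d(H,G)$ is the probability that a uniformly random $k$-element subset of $V(G)$ induces a subgraph isomorphic to $H$. For $k\in\{0,1,2,3\}$ let $H_k$ be the 3-vertex graph with exactly $k$ edges. Let $S\subseteq\mathbb{R}^4$ be the set of all $(d_0,d_1,d_2,d_3)$ such that for every $\varepsilon>0$ and every $n\in\mathbb{N}$ there is a graph $G$ with at least $n$ vertices satisfying $|d(H_k,G)-d_k|\le\varepsilon$ for $k=0,1,2,3$. For $i<j$, $S_{ij}=\{(d_i,d_j):(d_0,d_1,d_2,d_3)\in S\}$. The function $g_R:[0,1]\to[0,1]$ (Razborov's minimum triangle density function) is defined by $g_R(d)=0$ for $d\in[0,1/2]$, $g_R(1)=1$, and for $d\in(1/2,1)$: let $k$ be the smallest integer with $d\le 1-1/k$, let $z$ be the unique real in $(0,1/k]$ with $d=\frac{(1-z)(kz+k-2)}{k-1}$, and set $g_R(d)=\frac{(1-z)^2(k-2)(2zk+k-3)}{(k-1)^2}$. (This is the triangle density of a complete $k$-partite graph with one part of relative size $z$ and $k-1$ equal parts.) The restriction of $g_R$ to $[1/2,1]$ is a continuous increasing bijection onto $[0,1]$, and $g_R^{-1}:[0,1]\to[1/2,1]$ denotes its inverse. *)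

(* Defs.v *)
From Stdlib Require Import Reals Lra List Arith ClassicalEpsilon.
Import ListNotations.
Open Scope R_scope.

(* A finite simple graph on vertex set {0,...,nv-1}. *)
Record graph := Graph {
  nv : nat;
  adj : nat -> nat -> bool;
  adj_sym : forall i j, adj i j = adj j i;
  adj_irr : forall i, adj i i = false
}.

Definition triples (N : nat) : list (nat * nat * nat) :=
  flat_map (fun k => flat_map (fun j => map (fun i => (i, j, k)) (seq 0 j))
                              (seq 0 k)) (seq 0 N).

Definition edges3 (G : graph) (i j k : nat) : nat :=
  (Nat.b2n (adj G i j) + Nat.b2n (adj G i k) + Nat.b2n (adj G j k))%nat.

(* Number of 3-subsets inducing a copy of H_m (3-vertex graph with m edges). *)
Definition ind_count (G : graph) (m : nat) : nat :=
  length (filter (fun t => match t with (i, j, k) => Nat.eqb (edges3 G i j k) m end)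
                 (triples (nv G))).

Definition dens (G : graph) (m : nat) : R :=
  INR (ind_count G m) / INR (length (triples (nv G))).

Definition in_S (d0 d1 d2 d3 : R) : Prop :=
  forall eps : R, eps > 0 -> forall n : nat,
    exists G : graph, (n <= nv G)%nat /\
      Rabs (dens G 0 - d0) <= eps /\ Rabs (dens G 1 - d1) <= eps /\
      Rabs (dens G 2 - d2) <= eps /\ Rabs (dens G 3 - d3) <= eps.

Definition in_S23 (d2 d3 : R) : Prop :=
  exists d0 d1 : R, in_S d0 d1 d2 d3.

(* Razborov's function g_R, following the definition literally. *)
Definition gR_k (d : R) : nat :=
  epsilon (inhabits 0%nat)
    (fun k => (1 <= k)%nat /\ d <= 1 - 1 / INR k /\
              forall j : nat, (1 <= j)%nat -> d <= 1 - 1 / INR j -> (k <= j)%nat).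

Definition gR_z (d : R) : R :=
  let k := INR (gR_k d) in
  epsilon (inhabits 0)
    (fun z => 0 < z <= 1 / k /\ d = (1 - z) * (k * z + k - 2) / (k - 1)).

Definition gR (d : R) : R :=
  if Rle_dec d (1/2) then 0
  else if Req_EM_T d 1 then 1
  else let k := INR (gR_k d) in let z := gR_z d in
       (1 - z) ^ 2 * (k - 2) * (2 * z * k + k - 3) / (k - 1) ^ 2.

Definition gR_inv (y : R) : R :=
  epsilon (inhabits 0) (fun d => 1/2 <= d <= 1 /\ gR d = y).

(* Main.v *)
(* Write [e], [T], [S] for the homomorphism densities of the edge, the triangle and the
   two-edge path. In the limit [D := 2 d2 / 3 + d3] equals [2 S - T], so the claim is
   [2 S - T <= g_R^-1 (T)]. With [P2 := 1 - 2 S + T] and [P3 := 1 - 3 S + 2 T], which are the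
   power sums of the part sizes for complete multipartite graphs, this reads
   [P3 >= phi M P2] for every [M >= 3], where [phi M] is the [M]-th scallop of the curve.

   Take weighted graphs on [n] vertices with weights [x] and edge weights [W] in [0,1] and
   minimise [P3 - phi M P2], with smallest support. To second order this maximises
   [p S - q T]. First-order conditions in [W] and [x], together with the fact that the
   Hessian in [x] has at most one positive direction among weight shifts, force all edges
   to be present: shifting weight along a non-edge [uv] is a positive direction (a form of
   Zykov symmetrisation, as [S] is convex and [T] linear there). Two such shifts with
   nonnegative inner product must change [T] in the same sense; this excludes paths of
   non-edges on four and then on three vertices, and an isolated non-edge joins twins.
   For a complete graph the stationarity conditions leave at most one weight smaller than
   the common value of the others, and the bound is the sharp inequality between the
   second and third central moments.

   Conversely, adding isolated vertices to the extremal multipartite graphs while moving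
   along the curve keeps [d3] fixed and sweeps all smaller values of [d2]. *)
Require Import Defs.
From Stdlib Require Import Reals Lra Lia Psatz Arith ZArith List Bool.
From Stdlib Require Import Classical ClassicalEpsilon FunctionalExtensionality.
From Coquelicot Require Coquelicot.
Import ListNotations.
Open Scope R_scope.

(** At [p = 1 / M] the second derivative of [phi M] is infinite, so near an optimum there is only a
    tangent bound with error [|dP2| ^ (3/2)]. This is harmless at first order, and at second order
    along moves that leave [P2] and [P3] stationary. Those weight shifts form a subspace of
    codimension at most one: hence the one positive direction, and hence the rule on the signs of
    two shifts.

    Every scallop inequality is proved for all weighted graphs, not only above its own arc, so the
    corners of [g_R] never enter. At fixed [T], [P3] has slope 3/2 in [P2] and [phi M] slope at most
    1, which turns the one scallop through [g_R^-1 (T)] into the bound.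

    The constant [kap M] is the sharp one for moments: [M] reals with sum 0 and sum of squares [V]
    have sum of cubes at least [- kap M * V ^ (3/2)], with equality for [M - 1] equal values and one
    smaller.

    With [n] fixed, compactness yields a minimiser, and fractional edge weights give each pair a
    first-order condition. A finite graph enters with uniform weights and no error; terms of order
    [1 / n] appear only on passing to induced densities. *)

Fixpoint sum (n : nat) (f : nat -> R) : R :=
  match n with O => 0 | S k => sum k f + f k end.

Lemma sum_ext n f g : (forall i, (i < n)%nat -> f i = g i) -> sum n f = sum n g.
Proof.
  induction n as [|n IH]; simpl; intros H; [reflexivity|].
  rewrite IH by (intros; apply H; lia). now rewrite H by lia.
Qed.

Lemma sum_plus n f g : sum n (fun i => f i + g i) = sum n f + sum n g.
Proof. induction n as [|n IH]; simpl; [ring|rewrite IH; ring]. Qed.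

Lemma sum_scal n c f : sum n (fun i => c * f i) = c * sum n f.
Proof. induction n as [|n IH]; simpl; [ring|rewrite IH; ring]. Qed.

Lemma sum_scal_r n c f : sum n (fun i => f i * c) = sum n f * c.
Proof. induction n as [|n IH]; simpl; [ring|rewrite IH; ring]. Qed.

Lemma sum_minus n f g : sum n (fun i => f i - g i) = sum n f - sum n g.
Proof. induction n as [|n IH]; simpl; [ring|rewrite IH; ring]. Qed.

Lemma sum_const n c : sum n (fun _ => c) = INR n * c.
Proof. induction n as [|n IH]; [simpl; ring|]. cbn [sum]. rewrite IH, S_INR. ring. Qed.

Lemma sum_0 n f : (forall i, (i < n)%nat -> f i = 0) -> sum n f = 0.
Proof. intros H. rewrite (sum_ext n f (fun _ => 0)) by assumption. rewrite sum_const. ring. Qed.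

Lemma sum_le n f g : (forall i, (i < n)%nat -> f i <= g i) -> sum n f <= sum n g.
Proof.
  induction n as [|n IH]; simpl; intros H; [lra|].
  assert (sum n f <= sum n g) by (apply IH; intros; apply H; lia).
  assert (f n <= g n) by (apply H; lia). lra.
Qed.

Lemma sum_nonneg n f : (forall i, (i < n)%nat -> 0 <= f i) -> 0 <= sum n f.
Proof.
  intros H. replace 0 with (sum n (fun _ => 0)) by (rewrite sum_const; ring).
  now apply sum_le.
Qed.

Lemma sum_ge_term n f u :
  (forall i, (i < n)%nat -> 0 <= f i) -> (u < n)%nat -> f u <= sum n f.
Proof.
  induction n as [|n IH]; simpl; intros H Hu; [lia|].
  destruct (Nat.eq_dec u n) as [->|Hn].
  - assert (0 <= sum n f) by (apply sum_nonneg; intros; apply H; lia). lra.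
  - assert (f u <= sum n f) by (apply IH; [intros; apply H; lia|lia]).
    assert (0 <= f n) by (apply H; lia). lra.
Qed.

Lemma sum_pos_ex n f : 0 < sum n f -> exists i, (i < n)%nat /\ 0 < f i.
Proof.
  intros H. apply NNPP. intros C.
  assert (sum n f <= 0); [|lra].
  replace 0 with (sum n (fun _ => 0)) by (rewrite sum_const; ring).
  apply sum_le. intros i Hi. apply Rnot_lt_le. intros Hf. apply C. now exists i.
Qed.

Lemma sum_swap n m f :
  sum n (fun i => sum m (fun j => f i j)) = sum m (fun j => sum n (fun i => f i j)).
Proof.
  induction n as [|n IH]; simpl.
  - now rewrite sum_0.
  - now rewrite IH, sum_plus.
Qed.

Definition unit_at (u i : nat) : R := if Nat.eqb i u then 1 else 0.

Lemma unit_at_same u : unit_at u u = 1.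
Proof. unfold unit_at. now rewrite Nat.eqb_refl. Qed.

Lemma unit_at_other u i : i <> u -> unit_at u i = 0.
Proof. intros H. unfold unit_at. now apply Nat.eqb_neq in H as ->. Qed.

Lemma sum_unit_at n u f : (u < n)%nat -> sum n (fun i => unit_at u i * f i) = f u.
Proof.
  induction n as [|n IH]; simpl; intros H; [lia|].
  destruct (Nat.eq_dec u n) as [->|Hn].
  - rewrite unit_at_same, sum_0; [ring|].
    intros i Hi. rewrite unit_at_other by lia. ring.
  - rewrite IH, unit_at_other by lia. ring.
Qed.

Definition diff_at (u v i : nat) : R := unit_at u i - unit_at v i.

Lemma sum_diff_at n u v f : (u < n)%nat -> (v < n)%nat ->
  sum n (fun i => diff_at u v i * f i) = f u - f v.
Proof.
  intros Hu Hv. unfold diff_at.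
  rewrite (sum_ext n _ (fun i => unit_at u i * f i - unit_at v i * f i)) by (intros; ring).
  now rewrite sum_minus, !sum_unit_at.
Qed.

(** * Weighted graphs *)

Definition deg n (W : nat -> nat -> R) (x : nat -> R) i := sum n (fun k => x k * W i k).
Definition codeg n (W : nat -> nat -> R) (x : nat -> R) i j :=
  sum n (fun k => x k * (W i k * W j k)).
(* Homomorphism densities of the path with two edges and of the triangle. *)
Definition paths n W x := sum n (fun i => x i * deg n W x i ^ 2).
Definition tri_at n W x i := sum n (fun j => x j * (W i j * codeg n W x i j)).
Definition tris n W x := sum n (fun i => x i * tri_at n W x i).

Record wgraph (n : nat) (W : nat -> nat -> R) (x : nat -> R) : Prop := {
  wg_nonneg : forall i, 0 <= x i;
  wg_out : forall i, (n <= i)%nat -> x i = 0;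
  wg_sum : sum n x = 1;
  wg_range : forall i j, 0 <= W i j <= 1;
  wg_sym : forall i j, W i j = W j i;
  wg_irr : forall i, W i i = 0
}.

Lemma deg_lin n W x y e i :
  deg n W (fun k => x k + e * y k) i = deg n W x i + e * deg n W y i.
Proof.
  unfold deg. rewrite <- sum_scal, <- sum_plus. apply sum_ext. intros. ring.
Qed.

Lemma codeg_sym n W x i j : codeg n W x i j = codeg n W x j i.
Proof. unfold codeg. apply sum_ext. intros. ring. Qed.

(** Polarisation of [tris]. For symmetric [W] it is symmetric in its three weight arguments, so the
    coefficients of [tris] along a line are its mixed values. *)
Definition tri3 n (W : nat -> nat -> R) x y z :=
  sum n (fun i => x i * sum n (fun j => y j * (W i j * codeg n W z i j))).

Lemma tris_tri3 n W x : tris n W x = tri3 n W x x x.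
Proof. reflexivity. Qed.

Lemma tri3_swap12 n W x y z : (forall i j, W i j = W j i) ->
  tri3 n W x y z = tri3 n W y x z.
Proof.
  intros Hs. unfold tri3.
  rewrite (sum_ext n _ (fun i => sum n (fun j => x i * y j * (W i j * codeg n W z i j)))).
  2:{ intros. rewrite <- sum_scal. apply sum_ext. intros. ring. }
  rewrite sum_swap. apply sum_ext. intros i _. rewrite <- sum_scal.
  apply sum_ext. intros j _. rewrite (Hs j i), (codeg_sym n W z j i). ring.
Qed.

Lemma tri3_swap23 n W x y z : (forall i j, W i j = W j i) ->
  tri3 n W x y z = tri3 n W x z y.
Proof.
  intros Hs. unfold tri3. apply sum_ext. intros i _. f_equal.
  unfold codeg.
  rewrite (sum_ext n _ (fun j => sum n (fun k => y j * (W i j * (z k * (W i k * W j k)))))).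
  2:{ intros. rewrite <- !sum_scal. apply sum_ext. intros. ring. }
  rewrite sum_swap. apply sum_ext. intros k _. rewrite <- !sum_scal.
  apply sum_ext. intros j _. rewrite (Hs j k). ring.
Qed.

Lemma tri3_lin1 n W x x' e y z :
  tri3 n W (fun k => x k + e * x' k) y z = tri3 n W x y z + e * tri3 n W x' y z.
Proof.
  unfold tri3. rewrite <- sum_scal, <- sum_plus. apply sum_ext. intros. ring.
Qed.

Lemma tri3_lin2 n W x y y' e z :  (forall i j, W i j = W j i) ->
  tri3 n W x (fun k => y k + e * y' k) z = tri3 n W x y z + e * tri3 n W x y' z.
Proof.
  intros Hs. rewrite tri3_swap12, tri3_lin1 by assumption.
  now rewrite (tri3_swap12 n W y), (tri3_swap12 n W y').
Qed.

Lemma tri3_lin3 n W x y z z' e :  (forall i j, W i j = W j i) ->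
  tri3 n W x y (fun k => z k + e * z' k) = tri3 n W x y z + e * tri3 n W x y z'.
Proof.
  intros Hs. rewrite tri3_swap23, tri3_lin2 by assumption.
  now rewrite (tri3_swap23 n W x z), (tri3_swap23 n W x z').
Qed.

Lemma tris_expand n W x y e : (forall i j, W i j = W j i) ->
  tris n W (fun k => x k + e * y k) =
  tris n W x + e * (3 * tri3 n W y x x) + e ^ 2 * (3 * tri3 n W y y x)
  + e ^ 3 * tri3 n W y y y.
Proof.
  intros Hs. rewrite !tris_tri3, tri3_lin1, !tri3_lin2, !tri3_lin3 by assumption.
  rewrite (tri3_swap12 n W x y x), (tri3_swap23 n W x x y), (tri3_swap12 n W x y x),
    (tri3_swap12 n W x y y), (tri3_swap23 n W y x y) by assumption. ring.
Qed.

(** Coefficient of [e] in [paths] along [x + e y], with [y] paired with the gradient; [path2] is the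
    coefficient of [e ^ 2], as a form with explicit kernel from which [hess] can be read off
    entrywise. *)
Definition path1 n W x y :=
  sum n (fun i => y i * (deg n W x i ^ 2 + 2 * deg n W (fun k => x k * deg n W x k) i)).

Definition path2 n W x y :=
  sum n (fun i => y i * sum n (fun j => y j *
    (codeg n W x i j + W i j * (deg n W x i + deg n W x j)))).

Lemma deg_adjoint n W f y : (forall i j, W i j = W j i) ->
  sum n (fun i => f i * deg n W y i) = sum n (fun i => y i * deg n W f i).
Proof.
  intros Hs. unfold deg.
  rewrite (sum_ext n _ (fun i => sum n (fun k => f i * (y k * W i k)))).
  2:{ intros. now rewrite <- sum_scal. }
  rewrite sum_swap. apply sum_ext. intros i _. rewrite <- sum_scal.
  apply sum_ext. intros j _. rewrite (Hs i j). ring.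
Qed.

Lemma codeg_form n W x y :
  sum n (fun i => y i * sum n (fun j => y j * codeg n W x i j)) =
  sum n (fun k => x k * sum n (fun i => y i * W i k) ^ 2).
Proof.
  unfold codeg.
  rewrite (sum_ext n _ (fun i => sum n (fun k => x k * (y i * W i k * sum n (fun j => y j * W j k))))).
  2:{ intros i _.
      rewrite (sum_ext n _ (fun j => sum n (fun k => y j * (x k * (W i k * W j k))))).
      2:{ intros. now rewrite <- sum_scal. }
      rewrite sum_swap, <- sum_scal. apply sum_ext. intros k _.
      rewrite <- !sum_scal. apply sum_ext. intros. ring. }
  rewrite sum_swap. apply sum_ext. intros k _. rewrite sum_scal. f_equal.
  rewrite sum_scal_r. ring.
Qed.

Lemma paths_expand n W x y e : (forall i j, W i j = W j i) ->
  paths n W (fun k => x k + e * y k) =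
  paths n W x + e * path1 n W x y + e ^ 2 * path2 n W x y
  + e ^ 3 * sum n (fun i => y i * deg n W y i ^ 2).
Proof.
  intros Hs. unfold paths.
  rewrite (sum_ext n _ (fun i => x i * deg n W x i ^ 2
    + e * (y i * deg n W x i ^ 2 + 2 * (x i * deg n W x i * deg n W y i))
    + e ^ 2 * (x i * deg n W y i ^ 2 + 2 * (y i * deg n W x i * deg n W y i))
    + e ^ 3 * (y i * deg n W y i ^ 2))).
  2:{ intros. rewrite deg_lin. ring. }
  rewrite !sum_plus, !sum_scal, !sum_plus, !sum_scal.
  assert (H1 : path1 n W x y = sum n (fun i => y i * deg n W x i ^ 2)
     + 2 * sum n (fun i => x i * deg n W x i * deg n W y i)).
  { unfold path1. rewrite (deg_adjoint n W (fun i => x i * deg n W x i) y Hs).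
    rewrite <- sum_scal, <- sum_plus. apply sum_ext. intros. ring. }
  assert (H2 : path2 n W x y = sum n (fun i => x i * deg n W y i ^ 2)
     + 2 * sum n (fun i => y i * deg n W x i * deg n W y i)).
  { unfold path2.
    rewrite (sum_ext n _ (fun i => y i * sum n (fun j => y j * codeg n W x i j)
       + (y i * deg n W x i * deg n W y i
       + y i * deg n W (fun j => y j * deg n W x j) i))).
    2:{ intros i _.
        assert (H : sum n (fun j => y j * (codeg n W x i j
                     + W i j * (deg n W x i + deg n W x j))) =
          sum n (fun j => y j * codeg n W x i j)
          + (deg n W x i * deg n W y i + deg n W (fun j => y j * deg n W x j) i)).
        { set (D := deg n W x). unfold deg. rewrite <- sum_scal, <- !sum_plus.
          apply sum_ext. intros. ring. }
        rewrite H. ring. }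
    rewrite !sum_plus, codeg_form.
    rewrite <- (deg_adjoint n W (fun j => y j * deg n W x j) y Hs).
    rewrite (sum_ext n (fun k => x k * sum n (fun i => y i * W i k) ^ 2)
      (fun i => x i * deg n W y i ^ 2)).
    2:{ intros k _. do 2 f_equal. apply sum_ext. intros. now rewrite (Hs i k). }
    ring. }
  rewrite H1, H2. ring.
Qed.

(* [phi M] expresses [sum x_i^3] through [p = sum x_i^2] for [M - 1] equal weights and one
   smaller weight; [V] is the sum of the squared deviations from [1/M]. For [V < 0] the
   square root is [0] and [phi M] continues as its tangent, so it is [C^1]. *)
Definition kap (M : R) : R := (M - 2) / sqrt (M * (M - 1)).

Definition phi (M p : R) : R :=
  let V := p - 1 / M in 1 / M ^ 2 + 3 / M * V - kap M * (V * sqrt V).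

Definition omega (M p : R) : R := 3 / M - 3 / 2 * kap M * sqrt (p - 1 / M).

(** * Tangent bounds for the scallop *)

Lemma kap_bounds M : 3 <= M -> 0 < kap M <= 1.
Proof.
  intros H. unfold kap.
  assert (H1 : M - 2 <= sqrt (M * (M - 1))).
  { apply Rsqr_incr_0_var; [|apply sqrt_pos].
    rewrite Rsqr_sqrt by nra. unfold Rsqr. nra. }
  split.
  - apply Rdiv_lt_0_compat; lra.
  - apply Rmult_le_reg_r with (sqrt (M * (M - 1))); [lra|].
    unfold Rdiv. rewrite Rmult_assoc, Rinv_l by lra. lra.
Qed.

(** For positive [V], [V0] with roots [g], [h] the excess over the tangent is [(g - h)^2 (g + h/2)],
    at most [|g - h| |V - V0|], and [|g - h| <= sqrt |V - V0|]. Nonpositive arguments, where [sqrt]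
    is 0, are treated apart. *)
Lemma pow32_le V V0 :
  V * sqrt V <= V0 * sqrt V0 + 3 / 2 * sqrt V0 * (V - V0)
                + Rabs (V - V0) * sqrt (Rabs (V - V0)).
Proof.
  assert (Hneg : forall t, t <= 0 -> sqrt t = 0) by (intros; now apply sqrt_neg_0).
  set (A := Rabs (V - V0)). assert (HA : 0 <= A) by apply Rabs_pos.
  set (a := sqrt A). assert (Ha : 0 <= a) by apply sqrt_pos.
  assert (Haa : a * a = A) by now apply sqrt_sqrt.
  destruct (Rle_dec V0 0) as [H0|H0].
  - rewrite (Hneg V0 H0). destruct (Rle_dec V 0) as [H|H].
    + rewrite (Hneg V H). nra.
    + assert (V <= A) by (unfold A; rewrite Rabs_right; lra).
      assert (sqrt V <= a) by (apply sqrt_le_1; lra).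
      assert (0 <= sqrt V) by apply sqrt_pos. nra.
  - set (h := sqrt V0). assert (Hh : 0 < h) by (apply sqrt_lt_R0; lra).
    assert (Hhh : h * h = V0) by (apply sqrt_sqrt; lra).
    destruct (Rle_dec V 0) as [H|H].
    + rewrite (Hneg V H).
      assert (HAe : A = V0 - V) by (unfold A; rewrite Rabs_left1; lra).
      assert (h <= a) by (apply sqrt_le_1; lra).
      replace (V - V0) with (- (a * a)) by lra. rewrite <- Hhh, <- Haa.
      (* Twice the required difference is this product plus [h ^ 3]. *)
      assert (0 <= (a - h) ^ 2 * (2 * a + h)) by (apply Rmult_le_pos; nra).
      nra.
    + set (g := sqrt V). assert (Hg : 0 <= g) by apply sqrt_pos.
      assert (Hgg : g * g = V) by (apply sqrt_sqrt; lra).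
      assert (Hd : Rabs (g - h) <= a).
      { apply Rsqr_incr_0_var; [|assumption]. unfold Rsqr. rewrite Haa.
        rewrite <- Rabs_mult. unfold A. replace (V - V0) with ((g - h) * (g + h)) by nra.
        rewrite !Rabs_mult. apply Rmult_le_compat_l; [apply Rabs_pos|].
        rewrite (Rabs_right (g + h)) by lra. apply Rabs_le. lra. }
      assert (HA2 : A = Rabs (g - h) * (g + h)).
      { unfold A. replace (V - V0) with ((g - h) * (g + h)) by nra.
        rewrite Rabs_mult, (Rabs_right (g + h)); lra. }
      set (e := Rabs (g - h)) in *. assert (He0 : 0 <= e) by apply Rabs_pos.
      assert (He : e * e = (g - h) * (g - h)).
      { unfold e. rewrite <- Rabs_mult. apply Rabs_right, Rle_ge, (Rle_0_sqr (g - h)). }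
      assert (H1 : e * e * (g + h) <= A * a).
      { rewrite HA2. replace (e * e * (g + h)) with (e * (g + h) * e) by ring.
        apply Rmult_le_compat_l; [nra|assumption]. }
      rewrite <- Hgg, <- Hhh.
      assert (H2 : e * e * (g + h / 2) <= e * e * (g + h)) by (apply Rmult_le_compat_l; nra).
      rewrite He in H1, H2. nra.
Qed.

(** [kap M <= 1] absorbs the constant in front of the error. A bound from below is the side that
    matters: minimality of [excess] bounds the increase of [phi] from above by that of [P3]. *)
Lemma phi_support M P P0 : 3 <= M ->
  phi M P0 + omega M P0 * (P - P0) - Rabs (P - P0) * sqrt (Rabs (P - P0)) <= phi M P.
Proof.
  intros HM. unfold phi, omega. destruct (kap_bounds M HM) as [K0 K1].
  assert (H := pow32_le (P - 1 / M) (P0 - 1 / M)).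
  replace (P - 1 / M - (P0 - 1 / M)) with (P - P0) in H by ring.
  assert (0 <= Rabs (P - P0) * sqrt (Rabs (P - P0))).
  { apply Rmult_le_pos; [apply Rabs_pos|apply sqrt_pos]. }
  set (X := Rabs (P - P0) * sqrt (Rabs (P - P0))) in *.
  set (Y := (P - 1 / M) * sqrt (P - 1 / M)) in *.
  set (Y0 := (P0 - 1 / M) * sqrt (P0 - 1 / M)) in *.
  set (s := sqrt (P0 - 1 / M)) in *.
  assert (kap M * Y <= kap M * (Y0 + 3 / 2 * s * (P - P0) + X)) by (apply Rmult_le_compat_l; lra).
  assert (kap M * X <= X) by nra. lra.
Qed.

(** Keeps [3 - 2 omega] and [2 - omega], the multipliers [p] and [q] of [paths] and [tris] at an
    optimum, at least 1. *)
Lemma omega_le_1 M P : 3 <= M -> omega M P <= 1.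
Proof.
  intros HM. unfold omega. destruct (kap_bounds M HM) as [K0 K1].
  assert (0 <= sqrt (P - 1 / M)) by apply sqrt_pos.
  assert (3 / M <= 1).
  { apply Rmult_le_reg_r with M; [lra|]. unfold Rdiv. rewrite Rmult_assoc, Rinv_l by lra. lra. }
  assert (0 <= kap M * sqrt (P - 1 / M)) by (apply Rmult_le_pos; lra). lra.
Qed.

(** * Paths and triangles as polynomials in the data of one pair *)

Definition replw (x : nat -> R) u v a b k :=
  x k + (a - x u) * unit_at u k + (b - x v) * unit_at v k.
(** [replw] prescribes both new weights, whereas [replW] adds [w] to the current entry. Both are
    corrections by [unit_at], so that sums expand linearly. *)
Definition replW (W : nat -> nat -> R) u v w i j :=
  W i j + w * (unit_at u i * unit_at v j + unit_at v i * unit_at u j).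

Lemma replw_l x u v a b : u <> v -> replw x u v a b u = a.
Proof. intros H. unfold replw. rewrite unit_at_same, unit_at_other by auto. ring. Qed.
Lemma replw_r x u v a b : u <> v -> replw x u v a b v = b.
Proof. intros H. unfold replw. rewrite unit_at_same, unit_at_other by auto. ring. Qed.
Lemma replw_other x u v a b k : k <> u -> k <> v -> replw x u v a b k = x k.
Proof. intros H H'. unfold replw. rewrite !unit_at_other by auto. ring. Qed.
Lemma replW_same W u v w : u <> v -> replW W u v w u v = W u v + w.
Proof. intros H. unfold replW. rewrite !unit_at_same, !unit_at_other by auto. ring. Qed.
Lemma replW_other W u v w i j : j <> u -> j <> v -> replW W u v w i j = W i j.
Proof. intros H H'. unfold replW. rewrite !(unit_at_other _ j) by auto. ring. Qed.

Lemma replW_sym W u v w : (forall i j, W i j = W j i) ->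
  forall i j, replW W u v w i j = replW W u v w j i.
Proof. intros Hs i j. unfold replW. rewrite (Hs i j). ring. Qed.

Lemma replW_irr W u v w : u <> v -> (forall i, W i i = 0) ->
  forall i, replW W u v w i i = 0.
Proof.
  intros Huv Hi i. unfold replW. rewrite Hi. unfold unit_at.
  destruct (Nat.eqb_spec i u), (Nat.eqb_spec i v); subst; try (now elim Huv); ring.
Qed.

Lemma sum_replw n x u v a b f : (u < n)%nat -> (v < n)%nat ->
  sum n (fun i => replw x u v a b i * f i) =
  sum n (fun i => x i * f i) + (a - x u) * f u + (b - x v) * f v.
Proof.
  intros Hu Hv. unfold replw.
  rewrite (sum_ext n _ (fun i => x i * f i + (a - x u) * (unit_at u i * f i)
     + (b - x v) * (unit_at v i * f i))) by (intros; ring).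
  rewrite !sum_plus, !sum_scal, !sum_unit_at by assumption. ring.
Qed.

(** Sums over the graph with [u] and [v] deleted that determine [paths] and [tris] as polynomials in
    the weights [a], [b] and the edge weight [w] of the pair: among them degrees ([pf_du]), squared
    row norms ([pf_qu]), the codegree ([pf_c]) and triangle degrees ([pf_bu]). *)
Record pairform := PairForm {
  pf_s0 : R; pf_su : R; pf_sv : R; pf_qu : R; pf_qv : R; pf_c : R; pf_du : R; pf_dv : R;
  pf_t0 : R; pf_bu : R; pf_bv : R }.

Definition pair_paths (f : pairform) a b w :=
  pf_s0 f + 2 * a * pf_su f + 2 * b * pf_sv f + a ^ 2 * pf_qu f + b ^ 2 * pf_qv f
  + 2 * a * b * pf_c f + a * (pf_du f + b * w) ^ 2 + b * (pf_dv f + a * w) ^ 2.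
Definition pair_tris (f : pairform) a b w :=
  pf_t0 f + 3 * a * pf_bu f + 3 * b * pf_bv f + 6 * a * b * w * pf_c f.

Definition pair_form n (W : nat -> nat -> R) (x : nat -> R) u v : pairform :=
  let z := replw x u v 0 0 in
  let D := deg n W z in
  PairForm (paths n W z) (sum n (fun i => z i * (D i * W u i)))
    (sum n (fun i => z i * (D i * W v i))) (sum n (fun i => z i * W u i ^ 2))
    (sum n (fun i => z i * W v i ^ 2)) (codeg n W z u v) (D u) (D v)
    (tris n W z) (tri_at n W z u) (tri_at n W z v).

Section PairForm.
Variables (n : nat) (W : nat -> nat -> R) (x : nat -> R) (u v : nat).
Hypothesis Hu : (u < n)%nat.
Hypothesis Hv : (v < n)%nat.
Hypothesis Huv : u <> v.
Hypothesis Hs : forall i j, W i j = W j i.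
Hypothesis Hi : forall i, W i i = 0.
Variables (a b w : R).
Let z := replw x u v 0 0.
Let x' := replw x u v a b.
Let W' := replW W u v w.
Let Sy : forall i j, W' i j = W' j i := replW_sym W u v w Hs.
Let Iy : forall i, W' i i = 0 := replW_irr W u v w Huv Hi.

(** The two edge weightings differ only between [u] and [v], where [z] vanishes, so the coefficients
    of the pair form do not depend on [w]. *)
Lemma zero_replW k i : z k * W' i k = z k * W i k.
Proof.
  unfold z, W'. destruct (Nat.eq_dec k u) as [->|Hk]; [rewrite replw_l by auto; ring|].
  destruct (Nat.eq_dec k v) as [->|Hk']; [rewrite replw_r by auto; ring|].
  now rewrite replW_other.
Qed.

Lemma zero_codeg i j : codeg n W' z i j = codeg n W z i j.
Proof.
  unfold codeg. apply sum_ext. intros k _.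
  transitivity ((z k * W' i k) * W' j k); [ring|]. rewrite zero_replW.
  transitivity ((z k * W' j k) * W i k); [ring|]. rewrite zero_replW. ring.
Qed.

Lemma zero_tri_at i : tri_at n W' z i = tri_at n W z i.
Proof.
  unfold tri_at. apply sum_ext. intros j _. rewrite zero_codeg.
  transitivity ((z j * W' i j) * codeg n W z i j); [ring|]. rewrite zero_replW. ring.
Qed.

Lemma x'_split k : x' k = z k + a * unit_at u k + b * unit_at v k.
Proof.
  unfold x', z, replw. ring.
Qed.

Lemma sum_x' f : sum n (fun i => x' i * f i) = sum n (fun i => z i * f i) + a * f u + b * f v.
Proof.
  rewrite (sum_ext n _ (fun i => z i * f i + a * (unit_at u i * f i) + b * (unit_at v i * f i)))
    by (intros; rewrite x'_split; ring).
  now rewrite !sum_plus, !sum_scal, !sum_unit_at.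
Qed.

Lemma pair_paths_eq :
  paths n W' x' = pair_paths (pair_form n W x u v) a b (W u v + w).
Proof.
  assert (HD : forall i, deg n W' x' i = deg n W z i + a * W' i u + b * W' i v).
  { intros i. unfold deg. rewrite (sum_x' (W' i)). f_equal. f_equal.
    apply sum_ext. intros. apply zero_replW. }
  unfold paths at 1. rewrite (sum_x' (fun i => deg n W' x' i ^ 2)).
  rewrite !HD, !Iy, (Sy v u). unfold W' at 2 3. rewrite replW_same by assumption.
  unfold pair_paths, pair_form. fold z. cbn.
  rewrite (sum_ext n _ (fun i => z i * deg n W z i ^ 2 + 2 * a * (z i * (deg n W z i * W u i))
    + 2 * b * (z i * (deg n W z i * W v i)) + a ^ 2 * (z i * W u i ^ 2) + b ^ 2 * (z i * W v i ^ 2)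
    + 2 * a * b * (z i * (W u i * W v i)))).
  2:{ intros i _. rewrite HD, (Sy i u), (Sy i v).
      assert (Eu := zero_replW i u). assert (Ev := zero_replW i v).
      assert (Eu2 : z i * (W' u i * W' u i) = z i * (W u i * W u i)).
      { transitivity ((z i * W' u i) * W' u i); [ring|]. rewrite Eu.
        transitivity ((z i * W' u i) * W u i); [ring|]. rewrite Eu. ring. }
      assert (Ev2 : z i * (W' v i * W' v i) = z i * (W v i * W v i)).
      { transitivity ((z i * W' v i) * W' v i); [ring|]. rewrite Ev.
        transitivity ((z i * W' v i) * W v i); [ring|]. rewrite Ev. ring. }
      assert (Euv : z i * (W' u i * W' v i) = z i * (W u i * W v i)).
      { transitivity ((z i * W' u i) * W' v i); [ring|]. rewrite Eu.
        transitivity ((z i * W' v i) * W u i); [ring|]. rewrite Ev. ring. }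
      transitivity (z i * deg n W z i ^ 2 + 2 * a * deg n W z i * (z i * W' u i)
        + 2 * b * deg n W z i * (z i * W' v i) + a ^ 2 * (z i * (W' u i * W' u i))
        + b ^ 2 * (z i * (W' v i * W' v i)) + 2 * a * b * (z i * (W' u i * W' v i))); [ring|].
      rewrite Eu, Ev, Eu2, Ev2, Euv. ring. }
  rewrite !sum_plus, !sum_scal. unfold codeg, paths. cbn. ring.
Qed.

Lemma pair_tris_eq :
  tris n W' x' = pair_tris (pair_form n W x u v) a b (W u v + w).
Proof.
  assert (Hx : tris n W' x' = tris n W' (fun k => (fun k => z k + a * unit_at u k) k + b * unit_at v k)).
  { assert (He : forall k, x' k = z k + a * unit_at u k + b * unit_at v k) by apply x'_split.
    unfold tris, tri_at, codeg. apply sum_ext. intros i _. rewrite He. f_equal.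
    apply sum_ext. intros j _. rewrite He. do 2 f_equal.
    apply sum_ext. intros k _. now rewrite He. }
  rewrite Hx, !tris_expand by apply Sy.
  rewrite (tri3_lin2 n W' _ z _ a _ Sy), !(tri3_lin3 n W' _ _ z _ a Sy).
  assert (Uc : forall t p q, (p < n)%nat -> (q < n)%nat -> tri3 n W' (unit_at p) (unit_at q) t = W' p q * codeg n W' t p q).
  { intros t p q Hp Hq. unfold tri3. rewrite sum_unit_at, sum_unit_at by assumption. reflexivity. }
  assert (Ua : forall p, (p < n)%nat -> tri3 n W' (unit_at p) z z = tri_at n W z p).
  { intros p Hp. unfold tri3. rewrite sum_unit_at by assumption. rewrite <- zero_tri_at. reflexivity. }
  rewrite (tri3_swap23 n W' (unit_at v) z (unit_at u) Sy).
  rewrite !Uc, !Ua, !Iy by assumption.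
  rewrite !zero_codeg, (Sy v u), (codeg_sym n W z v u).
  (* A triangle using [u] twice would need a loop, so [tris] has no term in [a ^ 2 * b]. *)
  assert (Hcu : codeg n W' (unit_at u) v u = 0).
  { unfold codeg. rewrite sum_unit_at by assumption. rewrite Iy. ring. }
  assert (HW : W' u v = W u v + w) by now apply replW_same.
  rewrite Hcu, HW.
  unfold pair_tris, pair_form. fold z. cbn.
  replace (tris n W' z) with (tris n W z).
  2:{ unfold tris. apply sum_ext. intros. now rewrite zero_tri_at. }
  ring.
Qed.
End PairForm.

(* On complete multipartite weights [1 - 2 paths + tris] and [1 - 3 paths + 2 tris] are
   [sum x_i^2] and [sum x_i^3]. *)
Definition excess M n W x :=
  1 - 3 * paths n W x + 2 * tris n W x - phi M (1 - 2 * paths n W x + tris n W x).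

Fixpoint nsupp (n : nat) (x : nat -> R) : nat :=
  match n with
  | O => O
  | S k => (nsupp k x + if Rlt_dec 0 (x k) then 1 else 0)%nat
  end.

Lemma nsupp_le_of m (y y' : nat -> R) :
  (forall i, (i < m)%nat -> 0 < y i -> 0 < y' i) -> (nsupp m y <= nsupp m y')%nat.
Proof.
  induction m as [|m IH]; simpl; intros H; [lia|].
  assert (nsupp m y <= nsupp m y')%nat by (apply IH; intros; apply H; [lia|assumption]).
  destruct (Rlt_dec 0 (y m)), (Rlt_dec 0 (y' m)); try lia.
  exfalso. specialize (H m ltac:(lia)). tauto.
Qed.

Lemma nsupp_lt_of m (y y' : nat -> R) i : (i < m)%nat ->
  (forall k, (k < m)%nat -> 0 < y k -> 0 < y' k) -> ~ 0 < y i -> 0 < y' i ->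
  (nsupp m y < nsupp m y')%nat.
Proof.
  induction m as [|m IH]; simpl; intros Hlt H Hn Hy; [lia|].
  assert (nsupp m y <= nsupp m y')%nat by (apply nsupp_le_of; intros; apply H; [lia|assumption]).
  destruct (Nat.eq_dec i m) as [->|Hne].
  - destruct (Rlt_dec 0 (y m)), (Rlt_dec 0 (y' m)); try tauto; lia.
  - assert (nsupp m y < nsupp m y')%nat.
    { apply IH; [lia| |assumption|assumption]. intros; apply H; [lia|assumption]. }
    destruct (Rlt_dec 0 (y m)), (Rlt_dec 0 (y' m)); try lia.
    exfalso. specialize (H m ltac:(lia)). tauto.
Qed.

Record optimal M n W x : Prop := {
  op_wg : wgraph n W x;
  op_min : forall W' x', wgraph n W' x' -> excess M n W x <= excess M n W' x';
  op_supp : forall W' x', wgraph n W' x' -> excess M n W' x' <= excess M n W x ->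
            (nsupp n x <= nsupp n x')%nat
}.

Lemma pow_le_self e j : 0 <= e <= 1 -> (1 <= j)%nat -> e ^ j <= e.
Proof.
  intros He Hj. destruct j as [|j]; [lia|]. simpl.
  assert (0 <= e ^ j <= 1).
  { split; [apply pow_le; lra|]. rewrite <- (pow1 j). apply pow_incr. lra. }
  nra.
Qed.

(* The error [|dP|^(3/2)] is negligible against the leading order [e^j] of [dS] and [dT]. *)
Lemma leading_order_le p q A a0 a1 B b0 b1 e0 j (dS dT : R -> R) :
  0 < e0 -> (1 <= j)%nat ->
  (forall e, dS e = e ^ j * (A + e * (a0 + a1 * e))) ->
  (forall e, dT e = e ^ j * (B + e * (b0 + b1 * e))) ->
  (forall e, 0 < e <= e0 ->
     p * dS e - q * dT e <= Rabs (dT e - 2 * dS e) * sqrt (Rabs (dT e - 2 * dS e))) ->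
  p * A - q * B <= 0.
Proof.
  intros He0 Hj HS HT H. apply Rnot_lt_le. intros Hg. set (g := p * A - q * B) in *.
  set (L := Rabs B + Rabs b0 + Rabs b1 + 2 * (Rabs A + Rabs a0 + Rabs a1) + 1).
  set (K := Rabs (p * a0 - q * b0) + Rabs (p * a1 - q * b1) + 1).
  assert (HL : 1 <= L).
  { unfold L. generalize (Rabs_pos B) (Rabs_pos b0) (Rabs_pos b1) (Rabs_pos A)
      (Rabs_pos a0) (Rabs_pos a1). lra. }
  assert (HK : 1 <= K).
  { unfold K. generalize (Rabs_pos (p * a0 - q * b0)) (Rabs_pos (p * a1 - q * b1)). lra. }
  set (s := g / (4 * L)). assert (Hs : 0 < s) by (unfold s; apply Rdiv_lt_0_compat; lra).
  (* Small enough that the higher coefficients, bounded by [K], and the 3/2-power error, bounded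
     through [L] and [s], each cost at most a quarter of the leading term [t * g]. *)
  set (e := Rmin (Rmin e0 1) (Rmin (g / (4 * K)) (s * s / L))).
  assert (He : 0 < e).
  { unfold e. repeat apply Rmin_glb_lt; try lra; apply Rdiv_lt_0_compat; nra. }
  assert (E0 : e <= e0). { unfold e. eapply Rle_trans; [apply Rmin_l|apply Rmin_l]. }
  assert (E1 : e <= 1). { unfold e. eapply Rle_trans; [apply Rmin_l|apply Rmin_r]. }
  assert (E2 : e * K <= g / 4).
  { assert (e <= g / (4 * K)) by (unfold e; eapply Rle_trans; [apply Rmin_r|apply Rmin_l]).
    replace (g / 4) with (g / (4 * K) * K) by (field; lra).
    apply Rmult_le_compat_r; lra. }
  assert (E3 : e * L <= s * s).
  { assert (e <= s * s / L) by (unfold e; eapply Rle_trans; [apply Rmin_r|apply Rmin_r]).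
    replace (s * s) with (s * s / L * L) by (field; lra).
    apply Rmult_le_compat_r; lra. }
  assert (E4 : L * s = g / 4) by (unfold s; field; lra).
  set (t := e ^ j). assert (Ht : 0 < t) by now apply pow_lt.
  assert (Hte : t <= e) by (apply pow_le_self; [lra|assumption]).
  specialize (H e (conj He E0)). rewrite HS, HT in H. fold t in H.
  set (X := Rabs (t * (B + e * (b0 + b1 * e)) - 2 * (t * (A + e * (a0 + a1 * e))))) in *.
  assert (Habs : forall c d, Rabs (c * e + d * e * e) <= Rabs c + Rabs d).
  { intros c d. eapply Rle_trans; [apply Rabs_triang|]. rewrite !Rabs_mult.
    rewrite (Rabs_right e) by lra. generalize (Rabs_pos c) (Rabs_pos d). intros.
    assert (0 <= Rabs c * (1 - e)) by (apply Rmult_le_pos; lra).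
    assert (0 <= Rabs d * (1 - e * e)) by (apply Rmult_le_pos; nra). lra. }
  assert (HX : X <= t * L).
  { unfold X. replace (t * (B + e * (b0 + b1 * e)) - 2 * (t * (A + e * (a0 + a1 * e))))
      with (t * ((B + (b0 * e + b1 * e * e)) + - (2 * (A + (a0 * e + a1 * e * e))))) by ring.
    rewrite Rabs_mult, (Rabs_right t) by lra. apply Rmult_le_compat_l; [lra|].
    eapply Rle_trans; [apply Rabs_triang|].
    rewrite Rabs_Ropp, (Rabs_mult 2), (Rabs_right 2) by lra.
    assert (U1 := Rabs_triang B (b0 * e + b1 * e * e)).
    assert (U2 := Rabs_triang A (a0 * e + a1 * e * e)).
    generalize (Habs b0 b1) (Habs a0 a1). unfold L. lra. }
  assert (HX0 : 0 <= X) by apply Rabs_pos.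
  assert (Hsq : sqrt X <= s).
  { rewrite <- (sqrt_square s) by lra. apply sqrt_le_1; try nra. }
  assert (HXs : X * sqrt X <= t * (g / 4)).
  { rewrite <- E4. rewrite <- Rmult_assoc. apply Rmult_le_compat; auto. apply sqrt_pos. }
  assert (Hlow : t * g - t * (g / 4) <= p * (t * (A + e * (a0 + a1 * e))) - q * (t * (B + e * (b0 + b1 * e)))).
  { replace (p * (t * (A + e * (a0 + a1 * e))) - q * (t * (B + e * (b0 + b1 * e))))
      with (t * g + t * ((p * a0 - q * b0) * e + (p * a1 - q * b1) * e * e)) by (unfold g; ring).
    assert (- ((p * a0 - q * b0) * e + (p * a1 - q * b1) * e * e) <= g / 4); [|nra].
    eapply Rle_trans; [|exact E2].
    set (c := p * a0 - q * b0) in *. set (d := p * a1 - q * b1) in *.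
    assert (- c <= Rabs c) by (rewrite <- Rabs_Ropp; apply Rle_abs).
    assert (- d <= Rabs d) by (rewrite <- Rabs_Ropp; apply Rle_abs).
    assert (Pd := Rabs_pos d).
    assert (- c * e <= Rabs c * e) by (apply Rmult_le_compat_r; lra).
    assert (- d * (e * e) <= Rabs d * (e * e)) by (apply Rmult_le_compat_r; nra).
    assert (Rabs d * (e * e) <= Rabs d * e) by (apply Rmult_le_compat_l; nra).
    unfold K. nra. }
  nra.
Qed.

(** * First- and second-order conditions at an optimum *)

Section Optimum.
Variables (M : R) (n : nat) (W : nat -> nat -> R) (x : nat -> R).
Hypothesis HM : 3 <= M.
Hypothesis Hopt : optimal M n W x.

Let wg := op_wg _ _ _ _ Hopt.
Let Hs := wg_sym _ _ _ wg.
Let Hi := wg_irr _ _ _ wg.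
Let om := omega M (1 - 2 * paths n W x + tris n W x).
Let p := 3 - 2 * om.
Let q := 2 - om.
Let d := deg n W x.
Let c := codeg n W x.
Let t := tri_at n W x.
(* Up to a positive factor, the first derivative of [p * paths - q * tris] in [W u v]. *)
Let theta u v := p * (d u + d v) - 3 * q * c u v.
(** Vanishes for twins. When [W u v = 0] it is the coefficient of [e ^ 2] in [paths] along the shift
    of weight from [v] to [u]. *)
Let delta u v := sum n (fun k => x k * (W u k - W v k) ^ 2).

Lemma om_le_1 : om <= 1.
Proof. now apply omega_le_1. Qed.

Lemma supp_lt u : 0 < x u -> (u < n)%nat.
Proof.
  intros H. destruct (le_lt_dec n u) as [L|L]; [|assumption].
  rewrite (wg_out _ _ _ wg) in H by assumption. lra.
Qed.

(** Origin of [p] and [q]: with [dP2 = dT - 2 dS] and [dP3 = 2 dT - 3 dS], the linearised decrease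
    [om * dP2 - dP3] of [excess] is [p * dS - q * dT]. *)
Lemma local_opt W' x' : wgraph n W' x' ->
  let dS := paths n W' x' - paths n W x in
  let dT := tris n W' x' - tris n W x in
  p * dS - q * dT <= Rabs (dT - 2 * dS) * sqrt (Rabs (dT - 2 * dS)).
Proof.
  intros H dS dT. assert (H1 := op_min _ _ _ _ Hopt _ _ H). unfold excess in H1.
  assert (H2 := phi_support M (1 - 2 * paths n W' x' + tris n W' x')
    (1 - 2 * paths n W x + tris n W x) HM).
  replace (1 - 2 * paths n W' x' + tris n W' x' - (1 - 2 * paths n W x + tris n W x))
    with (dT - 2 * dS) in H2 by (unfold dS, dT; ring).
  fold om in H2. set (X := Rabs (dT - 2 * dS) * sqrt (Rabs (dT - 2 * dS))) in *.
  unfold p, q, dS, dT in *. lra.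
Qed.

(** ** Varying the weights along a direction *)

(** Zero weights are frozen, so [y] and [- y] are both feasible and first-order conditions become
    equalities. *)
Definition direction (y : nat -> R) := sum n y = 0 /\ forall i, x i = 0 -> y i = 0.

Lemma feasible y : (forall i, x i = 0 -> y i = 0) ->
  exists e0, 0 < e0 /\ forall e i, 0 <= e <= e0 -> 0 <= x i + e * y i.
Proof.
  intros Hy.
  assert (Hm : forall m, exists e0, 0 < e0 /\
            forall e i, (i < m)%nat -> 0 <= e <= e0 -> 0 <= x i + e * y i).
  { induction m as [|m [e1 [P1 H1]]].
    - exists 1. split; [lra|]. intros; lia.
    - assert (Hx := wg_nonneg _ _ _ wg m).
      destruct (Req_dec (x m) 0) as [E|E].
      + exists e1. split; [assumption|]. intros e i Hlt He.
        destruct (Nat.eq_dec i m) as [->|]; [rewrite E, Hy by assumption; lra|].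
        apply H1; [lia|assumption].
      + set (e2 := x m / (Rabs (y m) + 1)).
        assert (Hp := Rabs_pos (y m)).
        assert (0 < e2) by (unfold e2; apply Rdiv_lt_0_compat; lra).
        exists (Rmin e1 e2). split; [now apply Rmin_glb_lt|].
        intros e i Hlt He. assert (e <= e1) by (eapply Rle_trans; [apply He|apply Rmin_l]).
        assert (e <= e2) by (eapply Rle_trans; [apply He|apply Rmin_r]).
        destruct (Nat.eq_dec i m) as [->|]; [|apply H1; [lia|lra]].
        assert (e2 * (Rabs (y m) + 1) = x m) by (unfold e2; field; lra).
        assert (- y m <= Rabs (y m)) by (rewrite <- Rabs_Ropp; apply Rle_abs).
        nra. }
  destruct (Hm n) as [e0 [P0 H0]]. exists e0. split; [assumption|].
  intros e i He. destruct (le_lt_dec n i) as [L|L]; [|now apply H0].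
  assert (x i = 0) by now apply (wg_out _ _ _ wg). rewrite Hy by assumption. lra.
Qed.

Lemma wgraph_move y e : direction y -> (forall i, 0 <= x i + e * y i) ->
  wgraph n W (fun k => x k + e * y k).
Proof.
  intros [Hsum Hy] Hpos. destruct wg as [w1 w2 w3 w4 w5 w6]. split; auto.
  - intros i L. rewrite (w2 i L), Hy by (now apply w2). ring.
  - rewrite sum_plus, sum_scal, w3, Hsum. ring.
Qed.

Lemma first_order_le y : direction y ->
  p * path1 n W x y - q * (3 * tri3 n W y x x) <= 0.
Proof.
  intros Hy. destruct (feasible y (proj2 Hy)) as [e0 [P0 H0]].
  apply (leading_order_le p q (path1 n W x y) (path2 n W x y)
    (sum n (fun i => y i * deg n W y i ^ 2)) (3 * tri3 n W y x x) (3 * tri3 n W y y x)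
    (tri3 n W y y y) e0 1
    (fun e => paths n W (fun k => x k + e * y k) - paths n W x)
    (fun e => tris n W (fun k => x k + e * y k) - tris n W x)); auto.
  - intros e. rewrite paths_expand by assumption. ring.
  - intros e. rewrite tris_expand by assumption. ring.
  - intros e He. apply local_opt, wgraph_move; [assumption|]. intros. apply H0. lra.
Qed.

Definition T1 (y : nat -> R) := sum n (fun i => y i * t i).

Lemma T1_tri3 y : tri3 n W y x x = T1 y.
Proof. reflexivity. Qed.

Lemma direction_scal a y : direction y -> direction (fun i => a * y i).
Proof.
  intros [H1 H2]. split; [rewrite sum_scal, H1; ring|]. intros i E. rewrite H2 by assumption. ring.
Qed.

Lemma direction_plus y z : direction y -> direction z -> direction (fun i => y i + z i).
Proof.
  intros [H1 H2] [H3 H4]. split; [rewrite sum_plus, H1, H3; ring|].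
  intros i E. rewrite H2, H4 by assumption. ring.
Qed.

Lemma stationary y : direction y -> p * path1 n W x y = 3 * q * T1 y.
Proof.
  intros Hy. assert (H1 := first_order_le y Hy).
  assert (H2 := first_order_le _ (direction_scal (-1) y Hy)).
  rewrite T1_tri3 in H1, H2. unfold T1 in *.
  assert (E1 : path1 n W x (fun i => -1 * y i) = - path1 n W x y).
  { replace (- path1 n W x y) with (-1 * path1 n W x y) by ring.
    unfold path1. rewrite <- sum_scal. apply sum_ext. intros. ring. }
  assert (E2 : sum n (fun i => -1 * y i * t i) = - sum n (fun i => y i * t i)).
  { replace (- sum n (fun i => y i * t i)) with (-1 * sum n (fun i => y i * t i)) by ring.
    rewrite <- sum_scal. apply sum_ext. intros. ring. }
  rewrite E1, E2 in H2. lra.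
Qed.

(** Kernel of the [e ^ 2] coefficient of [p * paths - q * tris] along a direction. On a non-edge
    only the codegree term survives. *)
Definition hess i j := p * c i j + W i j * theta i j.
Definition bil (y z : nat -> R) := sum n (fun i => y i * sum n (fun j => z j * hess i j)).

(** [T1 y = 0] also kills [path1], by stationarity and [p > 0]. Both densities then change at order
    [e ^ 2], the 3/2-power error is of order [e ^ 3], and the quadratic form decides. *)
Lemma second_order_le y : direction y -> T1 y = 0 -> bil y y <= 0.
Proof.
  intros Hy HT. destruct (feasible y (proj2 Hy)) as [e0 [P0 H0]].
  assert (Hp1 : path1 n W x y = 0).
  { assert (H := stationary y Hy). rewrite HT in H. assert (O := om_le_1).
    apply Rmult_eq_reg_l with p; [lra|]. unfold p. lra. }
  replace (bil y y) with (p * path2 n W x y - q * (3 * tri3 n W y y x)).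
  2:{ unfold bil, path2, tri3. rewrite <- !sum_scal, <- sum_minus. apply sum_ext. intros i _.
      set (f := fun j => y j * (codeg n W x i j + W i j * (deg n W x i + deg n W x j))).
      set (g := fun j => y j * (W i j * codeg n W x i j)).
      replace (p * (y i * sum n f) - q * (3 * (y i * sum n g)))
        with (y i * (p * sum n f - 3 * q * sum n g)) by ring.
      f_equal. rewrite <- !sum_scal, <- sum_minus. apply sum_ext. intros j _.
      unfold hess, theta, f, g, c, d. ring. }
  apply (leading_order_le p q (path2 n W x y)
    (sum n (fun i => y i * deg n W y i ^ 2)) 0 (3 * tri3 n W y y x)
    (tri3 n W y y y) 0 e0 2
    (fun e => paths n W (fun k => x k + e * y k) - paths n W x)
    (fun e => tris n W (fun k => x k + e * y k) - tris n W x)); auto.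
  - intros e. rewrite paths_expand, Hp1 by assumption. ring.
  - intros e. rewrite tris_expand, T1_tri3, HT by assumption. ring.
  - intros e He. apply local_opt, wgraph_move; [assumption|]. intros. apply H0. lra.
Qed.

Lemma T1_comb a y b z : T1 (fun i => a * y i + b * z i) = a * T1 y + b * T1 z.
Proof. unfold T1. rewrite <- !sum_scal, <- sum_plus. apply sum_ext. intros. ring. Qed.

Lemma hess_sym i j : hess i j = hess j i.
Proof. unfold hess, theta, c. rewrite (Hs j i), (codeg_sym n W x j i). ring. Qed.

Lemma bil_sym y z : bil y z = bil z y.
Proof.
  unfold bil.
  rewrite (sum_ext n _ (fun i => sum n (fun j => y i * (z j * hess i j)))).
  2:{ intros. now rewrite sum_scal. }
  rewrite sum_swap. apply sum_ext. intros i _. rewrite <- sum_scal.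
  apply sum_ext. intros j _. rewrite (hess_sym j i). ring.
Qed.

Lemma bil_comb_l a y b z w : bil (fun i => a * y i + b * z i) w = a * bil y w + b * bil z w.
Proof. unfold bil. rewrite <- !sum_scal, <- sum_plus. apply sum_ext. intros. ring. Qed.

Lemma bil_comb a y b z :
  bil (fun i => a * y i + b * z i) (fun i => a * y i + b * z i) =
  a ^ 2 * bil y y + 2 * a * b * bil y z + b ^ 2 * bil z z.
Proof.
  rewrite bil_comb_l, (bil_sym y), (bil_sym z), !bil_comb_l, (bil_sym z y). ring.
Qed.

Lemma comb_le a y b z : direction y -> direction z -> a * T1 y + b * T1 z = 0 ->
  a ^ 2 * bil y y + 2 * a * b * bil y z + b ^ 2 * bil z z <= 0.
Proof.
  intros Hy Hz HT. rewrite <- bil_comb. apply second_order_le.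
  - apply direction_plus; now apply direction_scal.
  - now rewrite T1_comb.
Qed.

(** The combination [T1 z * y - T1 y * z] has [T1 = 0], so the form is nonpositive there; completing
    the square contradicts definiteness. If [T1 y = 0], then [y] itself is the contradiction. *)
Lemma no_definite_plane y z : direction y -> direction z ->
  0 < bil y y -> bil y z ^ 2 < bil y y * bil z z -> False.
Proof.
  intros Hy Hz H1 H2.
  assert (H := comb_le (T1 z) y (- T1 y) z Hy Hz ltac:(ring)).
  destruct (Req_dec (T1 y) 0) as [E|E].
  - assert (H' := comb_le 1 y 0 z Hy Hz ltac:(rewrite E; ring)). lra.
  - assert (0 < T1 y ^ 2) by nra.
    assert (0 <= (T1 z * bil y y - T1 y * bil y z) ^ 2) by apply pow2_ge_0.
    nra.
Qed.

(** Otherwise [|T1 z| y + |T1 y| z] has [T1 = 0], while the three terms of its form are nonnegative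
    and one is positive; if [T1 y = 0], already [y] contradicts the second-order condition. *)
Lemma same_sign y z : direction y -> direction z ->
  0 < bil y y -> 0 < bil z z -> 0 <= bil y z -> 0 < T1 y * T1 z.
Proof.
  intros Hy Hz H1 H2 H3. apply Rnot_le_lt. intros H.
  set (a := Rabs (T1 z)). set (b := Rabs (T1 y)).
  assert (Ha : 0 <= a) by apply Rabs_pos. assert (Hb : 0 <= b) by apply Rabs_pos.
  destruct (Req_dec (T1 y) 0) as [E|E].
  - assert (H' := comb_le 1 y 0 z Hy Hz ltac:(rewrite E; ring)). lra.
  - assert (0 < b) by now apply Rabs_pos_lt.
    assert (Hab : a * T1 y + b * T1 z = 0).
    { unfold a, b. destruct (Rle_dec 0 (T1 y)) as [L|L].
      - assert (T1 z <= 0) by nra. rewrite (Rabs_left1 (T1 z)), (Rabs_right (T1 y)) by lra. ring.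
      - assert (0 <= T1 z) by nra. rewrite (Rabs_right (T1 z)), (Rabs_left1 (T1 y)) by lra. ring. }
    assert (H' := comb_le a y b z Hy Hz Hab).
    assert (0 < b ^ 2 * bil z z) by (apply Rmult_lt_0_compat; [nra|assumption]).
    assert (0 <= a ^ 2 * bil y y) by (apply Rmult_le_pos; nra).
    assert (0 <= 2 * a * b * bil y z) by (apply Rmult_le_pos; nra). lra.
Qed.

Lemma direction_diff u v : 0 < x u -> 0 < x v -> direction (diff_at u v).
Proof.
  intros Hu Hv. split.
  - rewrite (sum_ext n _ (fun i => diff_at u v i * 1)) by (intros; ring).
    rewrite sum_diff_at by now apply supp_lt. ring.
  - intros i E. unfold diff_at.
    rewrite !unit_at_other; [ring| |]; intros ->; lra.
Qed.

Lemma T1_diff u v : 0 < x u -> 0 < x v -> T1 (diff_at u v) = t u - t v.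
Proof. intros Hu Hv. unfold T1. now rewrite sum_diff_at by now apply supp_lt. Qed.

Lemma bil_diff u v w z : 0 < x u -> 0 < x v -> 0 < x w -> 0 < x z ->
  bil (diff_at u v) (diff_at w z) = hess u w - hess u z - hess v w + hess v z.
Proof.
  intros Hu Hv Hw Hz. unfold bil.
  rewrite sum_diff_at by now apply supp_lt.
  rewrite !sum_diff_at by now apply supp_lt. ring.
Qed.


(** ** Varying one pair *)

Lemma wgraph_repl u v a b w : u <> v -> (u < n)%nat -> (v < n)%nat ->
  0 <= a -> 0 <= b -> a + b = x u + x v -> 0 <= W u v + w <= 1 ->
  wgraph n (replW W u v w) (replw x u v a b).
Proof.
  intros Huv Hu Hv Ha Hb Hab Hw. destruct wg as [w1 w2 w3 w4 w5 w6]. split.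
  - intros i. destruct (Nat.eq_dec i u) as [->|]; [now rewrite replw_l|].
    destruct (Nat.eq_dec i v) as [->|]; [now rewrite replw_r|]. now rewrite replw_other.
  - intros i L. rewrite replw_other by lia. auto.
  - rewrite (sum_ext n _ (fun i => replw x u v a b i * 1)) by (intros; ring).
    rewrite sum_replw by assumption.
    rewrite (sum_ext n _ x) by (intros; ring). rewrite w3. lra.
  - intros i j.
    unfold replW, unit_at.
    destruct (Nat.eqb_spec i u), (Nat.eqb_spec j v), (Nat.eqb_spec i v), (Nat.eqb_spec j u);
      subst; try lia; assert (H1 := w4 u v); assert (H2 := w4 v u); rewrite ?(w5 v u) in *;
      try (match goal with |- 0 <= W ?i ?j + _ <= 1 => assert (H3 := w4 i j) end); lra.
  - intros i j. apply replW_sym; auto.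
  - intros i. apply replW_irr; auto.
Qed.

Section Pair.
Variables u v : nat.
Hypothesis Huv : u <> v.
Hypothesis Hxu : 0 < x u.
Hypothesis Hxv : 0 < x v.

Let Hu := supp_lt u Hxu.
Let Hv := supp_lt v Hxv.
Let f := pair_form n W x u v.
Let z := replw x u v 0 0.

Lemma pair_current : paths n W x = pair_paths f (x u) (x v) (W u v) /\
                     tris n W x = pair_tris f (x u) (x v) (W u v).
Proof.
  assert (H1 := pair_paths_eq n W x u v Hu Hv Huv Hs Hi (x u) (x v) 0).
  assert (H2 := pair_tris_eq n W x u v Hu Hv Huv Hs Hi (x u) (x v) 0).
  replace (replw x u v (x u) (x v)) with x in H1, H2
    by (apply functional_extensionality; intros k; unfold replw; ring).
  replace (replW W u v 0) with W in H1, H2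
    by (do 2 (apply functional_extensionality; intros ?); unfold replW; ring).
  rewrite Rplus_0_r in H1, H2. now split.
Qed.

Lemma x_as_repl g :
  sum n (fun i => x i * g i) = sum n (fun i => z i * g i) + x u * g u + x v * g v.
Proof. unfold z. rewrite sum_replw by assumption. ring. Qed.

Lemma pair_deg_u : d u = pf_du f + x v * W u v.
Proof. unfold d, deg. rewrite x_as_repl, Hi. unfold f, pair_form, deg. cbn. fold z. ring. Qed.
Lemma pair_deg_v : d v = pf_dv f + x u * W u v.
Proof. unfold d, deg. rewrite x_as_repl, Hi, (Hs v u). unfold f, pair_form, deg. cbn. fold z. ring. Qed.
Lemma pair_codeg : c u v = pf_c f.
Proof.
  unfold c, codeg. rewrite (x_as_repl (fun k => W u k * W v k)), !Hi.
  unfold f, pair_form, codeg. cbn. fold z. ring.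
Qed.
Lemma pair_delta : delta u v = pf_qu f + pf_qv f - 2 * pf_c f + (x u + x v) * W u v ^ 2.
Proof.
  unfold delta. rewrite (x_as_repl (fun k => (W u k - W v k) ^ 2)), !Hi, (Hs v u).
  unfold f, pair_form, codeg. cbn. fold z.
  rewrite (sum_ext n _ (fun k => z k * (W u k * (W u k * 1)) + z k * (W v k * (W v k * 1))
    - 2 * (z k * (W u k * W v k)))) by (intros; ring).
  rewrite sum_minus, sum_plus, sum_scal. ring.
Qed.

Lemma local_pair a b w : 0 <= a -> 0 <= b -> a + b = x u + x v -> 0 <= W u v + w <= 1 ->
  let dS := pair_paths f a b (W u v + w) - pair_paths f (x u) (x v) (W u v) in
  let dT := pair_tris f a b (W u v + w) - pair_tris f (x u) (x v) (W u v) in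
  p * dS - q * dT <= Rabs (dT - 2 * dS) * sqrt (Rabs (dT - 2 * dS)).
Proof.
  intros Ha Hb Hab Hw. assert (H := local_opt _ _ (wgraph_repl u v a b w Huv Hu Hv Ha Hb Hab Hw)).
  cbv zeta in *.
  rewrite (pair_paths_eq n W x u v), (pair_tris_eq n W x u v) in H by auto.
  destruct pair_current as [E1 E2]. rewrite E1, E2 in H. exact H.
Qed.

Lemma theta_pair : theta u v =
  p * (pf_du f + pf_dv f + (x u + x v) * W u v) - 3 * q * pf_c f.
Proof. unfold theta. rewrite pair_deg_u, pair_deg_v, pair_codeg. ring. Qed.

Lemma vary_weight_le s e0 : 0 < e0 -> (forall e, 0 < e <= e0 -> 0 <= W u v + s * e <= 1) ->
  s * theta u v <= 0.
Proof.
  intros P0 H0. set (A := x u). set (B := x v). set (w0 := W u v).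
  assert (H : p * (s * (2 * A * B * (pf_du f + pf_dv f + (A + B) * w0)))
              - q * (s * (6 * A * B * pf_c f)) <= 0).
  { apply (leading_order_le p q _ (s ^ 2 * (A * B * (A + B))) 0 _ 0 0 e0 1
      (fun e => pair_paths f A B (w0 + s * e) - pair_paths f A B w0)
      (fun e => pair_tris f A B (w0 + s * e) - pair_tris f A B w0)); auto.
    - intros e. unfold pair_paths. ring.
    - intros e. unfold pair_tris. ring.
    - intros e He. apply local_pair; auto; unfold A, B; lra. }
  rewrite theta_pair. fold A B w0.
  assert (0 < A * B) by (apply Rmult_lt_0_compat; assumption).
  apply Rmult_le_reg_l with (2 * (A * B)); [lra|].
  rewrite Rmult_0_r. lra.
Qed.

Lemma theta_nonpos : W u v < 1 -> theta u v <= 0.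
Proof.
  intros H. rewrite <- (Rmult_1_l (theta u v)). apply vary_weight_le with (1 - W u v); [lra|].
  intros e He. assert (Hr := wg_range _ _ _ wg u v). lra.
Qed.

Lemma theta_nonneg : 0 < W u v -> 0 <= theta u v.
Proof.
  intros H. assert (H1 : -1 * theta u v <= 0); [|lra].
  apply vary_weight_le with (W u v); [lra|].
  intros e He. assert (Hr := wg_range _ _ _ wg u v). lra.
Qed.

(** Derivative of [paths], and in [Y1] of [tris], when weight moves from [v] to [u] with [W u v]
    fixed. *)
Let X1 := 2 * (pf_su f - pf_sv f) + 2 * (x u * pf_qu f - x v * pf_qv f)
  + 2 * pf_c f * (x v - x u) + (pf_du f ^ 2 - pf_dv f ^ 2)
  + 2 * (pf_du f + pf_dv f) * ((x v - x u) * W u v)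
  + (x u + x v) * ((x v - x u) * W u v ^ 2).
Let Y1 := 3 * (pf_bu f - pf_bv f) + 6 * pf_c f * ((x v - x u) * W u v).

Lemma shift_le s : s ^ 2 = 1 -> p * (s * X1) - q * (s * Y1) <= 0.
Proof.
  intros Hs2. assert (Hs' : s = 1 \/ s = -1).
  { assert (E : (s - 1) * (s + 1) = 0) by lra. apply Rmult_integral in E. lra. }
  apply (leading_order_le p q _ (pf_qu f + pf_qv f - 2 * pf_c f
      - 2 * (pf_du f + pf_dv f) * W u v - (x u + x v) * W u v ^ 2) 0 _
      (- 6 * pf_c f * W u v) 0 (Rmin (x u) (x v)) 1
      (fun e => pair_paths f (x u + s * e) (x v - s * e) (W u v + 0) - pair_paths f (x u) (x v) (W u v))
      (fun e => pair_tris f (x u + s * e) (x v - s * e) (W u v + 0) - pair_tris f (x u) (x v) (W u v))).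
  - now apply Rmin_glb_lt.
  - lia.
  - intros e. unfold pair_paths, X1. destruct Hs' as [-> | ->]; ring.
  - intros e. unfold pair_tris, Y1. destruct Hs' as [-> | ->]; ring.
  - intros e He.
    assert (e <= x u) by (eapply Rle_trans; [apply He|apply Rmin_l]).
    assert (e <= x v) by (eapply Rle_trans; [apply He|apply Rmin_r]).
    apply local_pair; try (destruct Hs' as [-> | ->]; lra).
    rewrite Rplus_0_r. apply (wg_range _ _ _ wg).
Qed.

Lemma shift_stationary : p * X1 = q * Y1.
Proof.
  assert (H1 := shift_le 1 ltac:(ring)). assert (H2 := shift_le (-1) ltac:(ring)). lra.
Qed.

(* When [theta u v = 0] the mixed second derivative in the weight shift and in [W u v]
   vanishes, and both pure ones are positive. *)
Lemma theta_zero_impossible : W u v < 1 -> theta u v = 0 -> 0 < delta u v -> False.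
Proof.
  intros Hw Hth Hde. rewrite theta_pair in Hth. rewrite pair_delta in Hde.
  assert (Hsh := shift_stationary). assert (Hr := wg_range _ _ _ wg u v).
  set (A := x u) in *. set (B := x v) in *. set (w0 := W u v) in *.
  set (D := pf_du f + pf_dv f) in *. set (s := A + B) in *.
  assert (Hp : 0 < p) by (assert (O := om_le_1); unfold p; lra).
  set (Tw := 6 * A * B * pf_c f).
  (* Rates of a combined move: [be] shifts weight from [v] to [u] and [al] raises [W u v], with
     [al >= 0] because [W u v] may be 0. As [Tw] is the derivative of [tris] in the edge weight, its
     first-order change cancels. *)
  assert (Hex : exists al be, 0 <= al /\ be * Y1 + al * Tw = 0 /\ (al <> 0 \/ be <> 0)).
  { destruct (Rtotal_order Y1 0) as [L|[E|L]].
    - exists (- Y1), Tw. split; [lra|]. split; [ring|]. left; lra.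
    - exists 0, 1. split; [lra|]. split; [rewrite E; ring|]. right; lra.
    - exists Y1, (- Tw). split; [lra|]. split; [ring|]. left; lra. }
  destruct Hex as [al [be [Hal [Hlin Hne]]]].
  (* [(A + be e) (B - be e) = A B + g1 e + g2 e ^ 2]. *)
  set (g1 := be * (B - A)). set (g2 := - be ^ 2).
  (* Shift stationarity and [theta u v = 0] make both partial derivatives of [paths] the multiple
     [q / p] of those of [tris], so [paths] is stationary along the move as well. *)
  assert (HlinS : be * X1 + al * (2 * A * B * (D + s * w0)) = 0).
  { apply Rmult_eq_reg_l with p; [|lra].
    transitivity (be * (p * X1) + al * (2 * (A * B) * (p * (D + s * w0)))); [ring|].
    rewrite Hsh. replace (p * (D + s * w0)) with (3 * q * pf_c f) by lra.
    transitivity (q * (be * Y1 + al * Tw)); [unfold Tw; ring|]. rewrite Hlin. ring. }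
  assert (Hbd : exists e0, 0 < e0 /\ forall e, 0 < e <= e0 ->
     0 <= A + be * e /\ 0 <= B - be * e /\ w0 + al * e <= 1).
  { exists (Rmin (1 - w0) (Rmin A B) / (1 + Rabs be + al)).
    assert (Q := Rabs_pos be). set (m := Rmin (1 - w0) (Rmin A B)).
    assert (0 < m) by (unfold m; repeat apply Rmin_glb_lt; lra).
    split; [apply Rdiv_lt_0_compat; lra|]. intros e He.
    assert (m <= 1 - w0) by apply Rmin_l.
    assert (m <= A) by (eapply Rle_trans; [apply Rmin_r|apply Rmin_l]).
    assert (m <= B) by (eapply Rle_trans; [apply Rmin_r|apply Rmin_r]).
    assert (e * (1 + Rabs be + al) <= m).
    { replace m with (m / (1 + Rabs be + al) * (1 + Rabs be + al)) by (field; lra).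
      apply Rmult_le_compat_r; lra. }
    assert (be <= Rabs be) by apply Rle_abs.
    assert (- be <= Rabs be) by (rewrite <- Rabs_Ropp; apply Rle_abs).
    repeat split; nra. }
  destruct Hbd as [e0 [P0 H0]].
  assert (H : p * (be ^ 2 * (pf_qu f + pf_qv f) + 2 * pf_c f * g2
                   + 2 * D * (g1 * al + g2 * w0)
                   + s * (A * B * al ^ 2 + 2 * g1 * w0 * al + g2 * w0 ^ 2))
            - q * (6 * pf_c f * (g1 * al + g2 * w0)) <= 0).
  { apply (leading_order_le p q _
      (2 * D * (g2 * al) + s * (g1 * al ^ 2 + 2 * g2 * w0 * al)) (s * (g2 * al ^ 2)) _
      (6 * pf_c f * (g2 * al)) 0 e0 2
      (fun e => pair_paths f (A + be * e) (B - be * e) (w0 + al * e) - pair_paths f A B w0)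
      (fun e => pair_tris f (A + be * e) (B - be * e) (w0 + al * e) - pair_tris f A B w0)); auto.
    - intros e.
      transitivity (e * (be * X1 + al * (2 * A * B * (D + s * w0))) + e ^ 2 * ((be ^ 2 * (pf_qu f + pf_qv f) + 2 * pf_c f * g2
                   + 2 * D * (g1 * al + g2 * w0)
                   + s * (A * B * al ^ 2 + 2 * g1 * w0 * al + g2 * w0 ^ 2)) + e * ((2 * D * (g2 * al) + s * (g1 * al ^ 2 + 2 * g2 * w0 * al)) + (s * (g2 * al ^ 2)) * e))).
      + unfold pair_paths, X1, D, s, g1, g2, A, B, w0. ring.
      + rewrite HlinS. ring.
    - intros e.
      transitivity (e * (be * Y1 + al * Tw) + e ^ 2 * (6 * pf_c f * (g1 * al + g2 * w0) + e * (6 * pf_c f * (g2 * al) + 0 * e))).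
      + unfold pair_tris, Y1, Tw, g1, g2, A, B, w0. ring.
      + rewrite Hlin. ring.
    - intros e He. destruct (H0 e He) as [K1 [K2 K3]].
      apply local_pair; auto; [unfold A, B; ring|]. fold w0. split; [|assumption].
      assert (0 <= al * e) by (apply Rmult_le_pos; lra). lra. }
  (* The cross terms collect into a multiple of [theta u v], leaving [p] times
     [be ^ 2 * delta u v + al ^ 2 * s * A * B], which is positive. *)
  assert (E : p * (be ^ 2 * (pf_qu f + pf_qv f) + 2 * pf_c f * g2
                   + 2 * D * (g1 * al + g2 * w0)
                   + s * (A * B * al ^ 2 + 2 * g1 * w0 * al + g2 * w0 ^ 2))
            - q * (6 * pf_c f * (g1 * al + g2 * w0)) =
     p * (be ^ 2 * (pf_qu f + pf_qv f - 2 * pf_c f + s * w0 ^ 2) + al ^ 2 * (s * (A * B)))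
     + 2 * (al * g1 + w0 * g2) * (p * (D + s * w0) - 3 * q * pf_c f)).
  { unfold g2. ring. }
  rewrite E, Hth in H.
  assert (0 < s * (A * B)) by (apply Rmult_lt_0_compat; [unfold s; lra|now apply Rmult_lt_0_compat]).
  assert (0 <= be ^ 2 * (pf_qu f + pf_qv f - 2 * pf_c f + s * w0 ^ 2)) by (apply Rmult_le_pos; [apply pow2_ge_0|lra]).
  assert (0 <= al ^ 2 * (s * (A * B))) by (apply Rmult_le_pos; [apply pow2_ge_0|lra]).
  destruct Hne as [N|N].
  - assert (0 < al ^ 2 * (s * (A * B))) by (apply Rmult_lt_0_compat; [nra|lra]). nra.
  - assert (0 < be ^ 2 * (pf_qu f + pf_qv f - 2 * pf_c f + s * w0 ^ 2)) by (apply Rmult_lt_0_compat; [nra|lra]). nra.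
Qed.

(* Twins can be merged, contradicting the minimality of the support. *)
Lemma delta_pos : W u v = 0 -> 0 < delta u v.
Proof.
  intros HW. apply Rnot_le_lt. intros Hle.
  assert (Hz0 : forall k, 0 <= z k).
  { intros k. unfold z. destruct (Nat.eq_dec k u) as [->|]; [rewrite replw_l; auto; lra|].
    destruct (Nat.eq_dec k v) as [->|]; [rewrite replw_r; auto; lra|].
    rewrite replw_other by auto. apply (wg_nonneg _ _ _ wg). }
  assert (Hk : forall k, (k < n)%nat -> z k * W u k = z k * W v k).
  { intros k Hlt. assert (E : delta u v = sum n (fun k => z k * (W u k - W v k) ^ 2)).
    { unfold delta. rewrite (x_as_repl (fun k => (W u k - W v k) ^ 2)), !Hi, (Hs v u), HW. ring. }
    assert (G := sum_ge_term n (fun k => z k * (W u k - W v k) ^ 2) k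
      ltac:(intros; apply Rmult_le_pos; [apply Hz0|apply pow2_ge_0]) Hlt).
    cbv beta in G. rewrite <- E in G.
    destruct (Req_dec (z k) 0) as [Z|Z]; [rewrite Z; ring|].
    assert (0 < z k) by (specialize (Hz0 k); lra).
    assert (H2 : (W u k - W v k) ^ 2 <= 0).
    { apply Rmult_le_reg_l with (z k); [assumption|]. lra. }
    assert (W u k - W v k = 0) by (apply Rsqr_0_uniq; unfold Rsqr; assert (H3 := pow2_ge_0 (W u k - W v k)); simpl in *; lra).
    f_equal. lra. }
  assert (Edu : pf_du f = pf_dv f).
  { unfold f, pair_form, deg. cbn. fold z. apply sum_ext. apply Hk. }
  assert (Esu : pf_su f = pf_sv f).
  { unfold f, pair_form. cbn. fold z. apply sum_ext. intros k L.
    transitivity (deg n W z k * (z k * W u k)); [ring|]. rewrite Hk by assumption. ring. }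
  assert (Equ : pf_qu f = pf_c f).
  { unfold f, pair_form, codeg. cbn. fold z. apply sum_ext. intros k L.
    transitivity (W u k * (z k * W u k)); [ring|]. rewrite Hk by assumption. ring. }
  assert (Eqv : pf_qv f = pf_c f).
  { unfold f, pair_form, codeg. cbn. fold z. apply sum_ext. intros k L.
    transitivity (W v k * (z k * W v k)); [ring|]. rewrite <- Hk by assumption. ring. }
  assert (Ebu : pf_bu f = pf_bv f).
  { unfold f, pair_form, tri_at. cbn. fold z. apply sum_ext. intros k L.
    assert (Ec : codeg n W z u k = codeg n W z v k).
    { unfold codeg. apply sum_ext. intros l Ll.
      transitivity (W k l * (z l * W u l)); [ring|]. rewrite Hk by assumption. ring. }
    rewrite Ec. transitivity (codeg n W z v k * (z k * W u k)); [ring|].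
    rewrite Hk by assumption. ring. }
  assert (Hwg : wgraph n (replW W u v 0) (replw x u v (x u + x v) 0)).
  { apply wgraph_repl; auto; lra. }
  assert (Hex : excess M n (replW W u v 0) (replw x u v (x u + x v) 0) = excess M n W x).
  { unfold excess. rewrite (pair_paths_eq n W x u v), (pair_tris_eq n W x u v) by auto.
    destruct pair_current as [E1 E2]. rewrite E1, E2. fold f.
    assert (P1 : pair_paths f (x u + x v) 0 (W u v + 0) = pair_paths f (x u) (x v) (W u v)).
    { unfold pair_paths. rewrite HW, Esu, Equ, Eqv, Edu. ring. }
    assert (P2 : pair_tris f (x u + x v) 0 (W u v + 0) = pair_tris f (x u) (x v) (W u v)).
    { unfold pair_tris. rewrite HW, Ebu. ring. }
    now rewrite P1, P2. }
  assert (Hsu := op_supp _ _ _ _ Hopt _ _ Hwg ltac:(lra)).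
  assert (nsupp n (replw x u v (x u + x v) 0) < nsupp n x)%nat; [|lia].
  apply nsupp_lt_of with v; auto.
  - intros k _. destruct (Nat.eq_dec k u) as [->|]; [auto|].
    destruct (Nat.eq_dec k v) as [->|]; [auto|]. now rewrite replw_other.
  - rewrite replw_r by assumption. lra.
Qed.

(** A fractional weight forces [theta u v = 0], and as there are no loops [delta u v] is at least
    [(x u + x v) * W u v ^ 2]; these two are incompatible. *)
Lemma weight_01 : W u v = 0 \/ W u v = 1.
Proof.
  assert (Hr := wg_range _ _ _ wg u v).
  destruct (Req_dec (W u v) 0) as [|N0]; [now left|].
  destruct (Req_dec (W u v) 1) as [|N1]; [now right|]. exfalso.
  apply theta_zero_impossible; [lra| |].
  - apply Rle_antisym; [apply theta_nonpos|apply theta_nonneg]; lra.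
  - rewrite pair_delta.
    assert (0 <= pf_qu f + pf_qv f - 2 * pf_c f).
    { unfold f, pair_form, codeg. cbn. fold z.
      rewrite <- sum_scal, <- sum_plus, <- sum_minus. apply sum_nonneg. intros k _.
      assert (0 <= z k).
      { unfold z. destruct (Nat.eq_dec k u) as [->|]; [rewrite replw_l; auto; lra|].
        destruct (Nat.eq_dec k v) as [->|]; [rewrite replw_r; auto; lra|].
        rewrite replw_other by auto. apply (wg_nonneg _ _ _ wg). }
      assert (0 <= z k * (W u k - W v k) ^ 2) by (apply Rmult_le_pos; [assumption|apply pow2_ge_0]). lra. }
    assert (0 < (x u + x v) * W u v ^ 2) by (apply Rmult_lt_0_compat; [lra|apply pow_lt; lra]). lra.
Qed.

Lemma theta_neg : W u v = 0 -> theta u v < 0.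
Proof.
  intros H. assert (H1 := theta_nonpos ltac:(lra)).
  destruct (Req_dec (theta u v) 0) as [E|]; [|lra]. exfalso.
  apply theta_zero_impossible; auto; [lra|]. now apply delta_pos.
Qed.

End Pair.

(** ** Non-edges of an optimal graph *)

Definition nonadj u v := 0 < x u /\ 0 < x v /\ u <> v /\ W u v = 0.

Lemma nonadj_sym u v : nonadj u v -> nonadj v u.
Proof. intros [H1 [H2 [H3 H4]]]. repeat split; auto. now rewrite Hs. Qed.

Lemma W01 u v : 0 < x u -> 0 < x v -> W u v = 0 \/ W u v = 1.
Proof.
  intros H1 H2. destruct (Nat.eq_dec u v) as [->|]; [left; apply Hi|]. now apply weight_01.
Qed.

Lemma W0_cases u v : 0 < x u -> 0 < x v -> W u v = 0 -> u = v \/ nonadj u v.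
Proof. intros. destruct (Nat.eq_dec u v); [now left|right]. repeat split; auto. Qed.

Lemma p_pos : 1 <= p.
Proof. assert (O := om_le_1). unfold p. lra. Qed.

Lemma codeg_self u : 0 < x u -> c u u = d u.
Proof.
  intros H. unfold c, d, codeg, deg. apply sum_ext. intros k _.
  destruct (Rle_lt_dec (x k) 0) as [L|L].
  - assert (P := wg_nonneg _ _ _ wg k). replace (x k) with 0 by lra. ring.
  - destruct (W01 u k H L) as [-> | ->]; ring.
Qed.

Lemma codeg_cross u v w z : c u w - c u z - c v w + c v z =
  sum n (fun k => x k * ((W u k - W v k) * (W w k - W z k))).
Proof.
  unfold c, codeg. rewrite <- !sum_minus, <- sum_plus. apply sum_ext. intros. ring.
Qed.

Lemma sum_support_nonneg g : (forall k, 0 < x k -> 0 <= g k) -> 0 <= sum n (fun k => x k * g k).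
Proof.
  intros H. apply sum_nonneg. intros k _. assert (P := wg_nonneg _ _ _ wg k).
  destruct (Req_dec (x k) 0) as [->|]; [lra|]. apply Rmult_le_pos; [lra|]. apply H. lra.
Qed.

Lemma hess_self u : 0 < x u -> hess u u = p * d u.
Proof. intros H. unfold hess. rewrite Hi, codeg_self by assumption. ring. Qed.

Lemma hess_nonadj u v : nonadj u v -> hess u v = p * c u v.
Proof. intros [_ [_ [_ E]]]. unfold hess. rewrite E. ring. Qed.

Lemma hess_adj u v : W u v = 1 -> hess u v = p * (d u + d v) - (3 * q - p) * c u v.
Proof. intros E. unfold hess, theta. rewrite E. ring. Qed.

Lemma delta_codeg u v : 0 < x u -> 0 < x v -> delta u v = d u + d v - 2 * c u v.
Proof.
  intros H1 H2. rewrite <- (codeg_self u H1), <- (codeg_self v H2).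
  assert (E := codeg_cross u v u v). unfold delta.
  rewrite (sum_ext n _ (fun k => x k * ((W u k - W v k) * (W u k - W v k)))) by (intros; ring).
  rewrite <- E. unfold c. rewrite (codeg_sym n W x v u). ring.
Qed.

Lemma bil_nonadj u v : nonadj u v -> bil (diff_at u v) (diff_at u v) = p * delta u v.
Proof.
  intros H. assert (H' := nonadj_sym _ _ H). assert (G := H). destruct G as [Hu [Hv _]].
  rewrite bil_diff, !hess_self, !hess_nonadj, delta_codeg by auto.
  unfold c. rewrite (codeg_sym n W x v u). ring.
Qed.

Lemma bil_nonadj_pos u v : nonadj u v -> 0 < bil (diff_at u v) (diff_at u v).
Proof.
  intros H. rewrite bil_nonadj by assumption. destruct H as [H1 [H2 [H3 H4]]].
  assert (P := p_pos). assert (0 < delta u v) by now apply delta_pos. nra.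
Qed.

(** The codegree part is a weighted sum of [(W u k - W v k) (W w k - W v k)], nonnegative termwise
    for 0/1 weights; what remains is [W u w * theta u w], nonnegative on edges and zero on
    non-edges. *)
Lemma bil_path u v w : nonadj u v -> nonadj w v -> u <> w ->
  0 <= bil (diff_at u v) (diff_at w v).
Proof.
  intros Huv Hwv Huw. assert (P := p_pos).
  assert (G := Huv). destruct G as [Hu [Hv _]]. assert (G := Hwv). destruct G as [Hw _].
  rewrite bil_diff by assumption.
  rewrite (hess_nonadj u v), (hess_nonadj v w), (hess_self v) by (auto using nonadj_sym).
  rewrite <- (codeg_self v Hv). unfold hess.
  assert (0 <= W u w * theta u w).
  { destruct (W01 u w Hu Hw) as [E|E]; rewrite E; [lra|].
    assert (0 <= theta u w) by (apply theta_nonneg; auto; lra). lra. }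
  assert (0 <= c u w - c u v - c v w + c v v).
  { rewrite codeg_cross. apply sum_support_nonneg. intros k Hk.
    destruct (W01 u k Hu Hk) as [-> | ->], (W01 v k Hv Hk) as [-> | ->],
      (W01 w k Hw Hk) as [-> | ->]; lra. }
  nra.
Qed.

(* So [t] alternately rises and falls along a path of non-edges. *)
Lemma path_extremal u v w : nonadj u v -> nonadj v w -> u <> w ->
  0 < (t u - t v) * (t w - t v).
Proof.
  intros Huv Hvw Huw. apply nonadj_sym in Hvw.
  assert (G := Huv). destruct G as [Hu [Hv _]]. assert (G := Hvw). destruct G as [Hw _].
  rewrite <- !T1_diff by assumption.
  apply same_sign; auto using direction_diff, bil_nonadj_pos, bil_path.
Qed.

Lemma nonadj_ne u v : nonadj u v -> u <> v.
Proof. intros [_ [_ [H _]]]. exact H. Qed.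

(** Each of the three vertices would have to be strictly extremal for [t] among them, which a median
    one is not. *)
Lemma no_triangle u v w : nonadj u v -> nonadj v w -> nonadj u w -> False.
Proof.
  intros H1 H2 H3.
  assert (E1 := path_extremal u v w H1 H2 (nonadj_ne _ _ H3)).
  assert (E2 := path_extremal v w u H2 (nonadj_sym _ _ H3) (not_eq_sym (nonadj_ne _ _ H1))).
  assert (E3 := path_extremal v u w (nonadj_sym _ _ H1) H3 (nonadj_ne _ _ H2)).
  set (a := t u - t v) in *. set (b := t v - t w) in *.
  replace (t w - t v) with (- b) in E1 by (unfold b; ring).
  replace (t u - t w) with (a + b) in E2 by (unfold a, b; ring).
  replace (t v - t u) with (- a) in E3 by (unfold a; ring).
  replace (t w - t u) with (- (a + b)) in E3 by (unfold a, b; ring).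
  nra.
Qed.

Lemma adj_of_path u v w : nonadj u v -> nonadj v w -> u <> w -> W u w = 1.
Proof.
  intros H1 H2 H3. assert (G := H1). destruct G as [Hu [Hv _]]. assert (G := H2). destruct G as [_ [Hw _]].
  destruct (W01 u w Hu Hw) as [E|]; [|assumption]. exfalso.
  apply (no_triangle u v w); auto. repeat split; auto.
Qed.

(** Along the path [t] alternates, so the shifts [u - v] and [z - w] change [T1] oppositely. The
    signs of [theta] make their inner product nonnegative, against [same_sign]. *)
Lemma no_path4 u v w z : nonadj u v -> nonadj v w -> nonadj w z ->
  u <> w -> v <> z -> u <> z -> False.
Proof.
  intros Huv Hvw Hwz Nuw Nvz Nuz. assert (P := p_pos). assert (O := om_le_1).
  assert (Ev := path_extremal u v w Huv Hvw Nuw).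
  assert (Ew := path_extremal v w z Hvw Hwz Nvz).
  assert (Wuw := adj_of_path u v w Huv Hvw Nuw).
  assert (Wvz := adj_of_path v w z Hvw Hwz Nvz).
  assert (Hpos : 0 < (t u - t v) * (t w - t z)).
  { set (a := t u - t v) in *. set (b := t w - t v) in *.
    replace (t v - t w) with (- b) in Ew by (unfold b; ring).
    set (e := t w - t z) in *. replace (t z - t w) with (- e) in Ew by (unfold e; ring).
    assert (0 < b * e) by lra. destruct (Rle_lt_dec b 0); nra. }
  assert (G := Huv). destruct G as [Hu [Hv [_ Wuv]]].
  assert (G := Hwz). destruct G as [Hw [Hz [_ Wwz]]].
  assert (G := Hvw). destruct G as [_ [_ [Nvw Wvw]]].
  assert (Hcross : 0 <= c u w - c u z - c v w + c v z).
  { rewrite codeg_cross. apply sum_support_nonneg. intros k Hk.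
    destruct (W01 u k Hu Hk) as [Euk|Euk], (W01 v k Hv Hk) as [Evk|Evk],
      (W01 w k Hw Hk) as [Ewk|Ewk], (W01 z k Hz Hk) as [Ezk|Ezk];
      rewrite Euk, Evk, Ewk, Ezk; try lra; exfalso.
    (* Here [k] misses [u] and [z] only and would close the path to a five-cycle of non-edges,
       around which [t] cannot alternate. *)
    - destruct (W0_cases u k Hu Hk Euk) as [->|Nuk]; [rewrite Hs in Evk; lra|].
      destruct (W0_cases z k Hz Hk Ezk) as [->|Nzk]; [lra|].
      assert (Nvk : v <> k) by (intros ->; rewrite Hi in Evk; lra).
      assert (Nwk : w <> k) by (intros ->; rewrite Hi in Ewk; lra).
      assert (E1 := path_extremal u k z Nuk (nonadj_sym _ _ Nzk) Nuz).
      assert (E2 := path_extremal v u k (nonadj_sym _ _ Huv) Nuk Nvk).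
      assert (E3 := path_extremal w z k Hwz Nzk Nwk).
      assert (E4 : 0 < (t u - t v) * (t u - t k)) by lra.
      assert (E5 : 0 < (t w - t z) * - (t z - t k)) by lra.
      set (a := t u - t v) in *. set (b := t u - t k) in *. set (e := t w - t z) in *.
      set (g := t z - t k) in *.
      destruct (Rle_lt_dec a 0); [assert (e < 0) by nra; assert (b < 0) by nra; nra|].
      assert (0 < e) by nra. assert (0 < b) by nra. nra.
    (* Here [v], [w], [k] would be mutually non-adjacent. *)
    - destruct (W0_cases v k Hv Hk Evk) as [->|Nvk]; [lra|].
      destruct (W0_cases w k Hw Hk Ewk) as [->|Nwk]; [rewrite Hs in Ezk; lra|].
      apply (no_triangle v w k); auto. }
  assert (Hth : theta v w <= 0) by (apply theta_nonpos; auto; lra). unfold theta in Hth.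
  (* [theta v w <= 0] bounds the degrees of [v] and [w] by a codegree. Those of [u] and [z] are
     bounded likewise by [theta u z <= 0] if this pair is a non-edge, and cancel if it is an edge.
     At most [- (3 q - p)] times the cross sum remains. *)
  assert (Hneg : bil (diff_at u v) (diff_at w z) <= 0).
  { rewrite bil_diff, (hess_adj u w), (hess_adj v z), (hess_nonadj v w) by assumption.
    assert (Hc : 0 <= (3 * q - p) * (c u w - c u z - c v w + c v z)).
    { apply Rmult_le_pos; [unfold p, q; lra|assumption]. }
    destruct (W01 u z Hu Hz) as [E|E].
    - assert (theta u z <= 0) as Hth2 by (apply theta_nonpos; auto; lra). unfold theta in Hth2.
      rewrite hess_nonadj by (repeat split; auto). nra.
    - rewrite hess_adj by assumption. nra. }
  assert (Hneg2 : 0 <= bil (diff_at u v) (diff_at z w)).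
  { rewrite bil_diff in * by assumption. lra. }
  assert (Hss := same_sign (diff_at u v) (diff_at z w) (direction_diff u v Hu Hv) (direction_diff z w Hz Hw)
    (bil_nonadj_pos _ _ Huv) (bil_nonadj_pos _ _ (nonadj_sym _ _ Hwz)) Hneg2).
  rewrite !T1_diff in Hss by assumption. nra.
Qed.

(* By [no_path4] the vertices [u] and [w] miss only themselves and [v], so all entries of
   the form on [u - v] and [w - v] are explicit and it is positive definite there. *)
Lemma no_path3 u v w : nonadj u v -> nonadj v w -> u <> w -> False.
Proof.
  intros Huv Hvw Nuw. assert (P := p_pos). assert (O := om_le_1).
  assert (Wuw := adj_of_path u v w Huv Hvw Nuw).
  assert (G := Huv). destruct G as [Hu [Hv [Nuv Wuv]]].
  assert (G := Hvw). destruct G as [_ [Hw [Nvw Wvw]]].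
  assert (Hrow : forall a b k, nonadj a v -> nonadj v b -> a <> b -> 0 < x k ->
             W a k = 0 -> k = a \/ k = v).
  { intros a b k Ha Hb Nab Hk E. assert (G := Ha). destruct G as [Pa _].
    assert (Wab := adj_of_path a v b Ha Hb Nab).
    destruct (W0_cases a k Pa Hk E) as [->|Nak]; [now left|].
    destruct (Nat.eq_dec k v) as [->|Nkv]; [now right|]. exfalso.
    apply (no_path4 k a v b); auto using nonadj_sym. intros ->. lra. }
  assert (Hru : forall k, 0 < x k -> k <> u -> k <> v -> W u k = 1).
  { intros k Hk M1 M2. destruct (W01 u k Hu Hk) as [E|]; [|assumption].
    destruct (Hrow u w k Huv Hvw Nuw Hk E); contradiction. }
  assert (Hrw : forall k, 0 < x k -> k <> w -> k <> v -> W w k = 1).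
  { intros k Hk M1 M2. destruct (W01 w k Hw Hk) as [E|]; [|assumption].
    destruct (Hrow w u k (nonadj_sym _ _ Hvw) (nonadj_sym _ _ Huv) (not_eq_sym Nuw) Hk E); contradiction. }
  assert (Hsum : forall (cu cv cw : R) g, (forall k, 0 < x k -> g k = 1 - cu * unit_at u k - cv * unit_at v k - cw * unit_at w k) ->
     sum n (fun k => x k * g k) = 1 - cu * x u - cv * x v - cw * x w).
  { intros cu cv cw g Hg.
    rewrite (sum_ext n _ (fun k => x k - cu * (unit_at u k * x k) - cv * (unit_at v k * x k) - cw * (unit_at w k * x k))).
    - rewrite !sum_minus, !sum_scal, !sum_unit_at by (now apply supp_lt). now rewrite (wg_sum _ _ _ wg).
    - intros k _. destruct (Req_dec (x k) 0) as [->|]; [ring|].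
      rewrite Hg by (assert (Q := wg_nonneg _ _ _ wg k); lra). ring. }
  assert (Hun : forall a k, unit_at a k = if Nat.eq_dec k a then 1 else 0).
  { intros a k. destruct (Nat.eq_dec k a) as [->|]; [apply unit_at_same|now apply unit_at_other]. }
  assert (Du : d u = 1 - x u - x v).
  { unfold d, deg. rewrite (Hsum 1 1 0); [ring|]. intros k Hk. rewrite !Hun.
    destruct (Nat.eq_dec k u) as [->|]; [destruct (Nat.eq_dec u v); [lia|]; rewrite Hi; ring|].
    destruct (Nat.eq_dec k v) as [->|]; [rewrite Wuv; ring|]. rewrite Hru by assumption. ring. }
  assert (Dw : d w = 1 - x w - x v).
  { unfold d, deg. rewrite (Hsum 0 1 1); [ring|]. intros k Hk. rewrite !Hun.
    destruct (Nat.eq_dec k w) as [->|]; [destruct (Nat.eq_dec w v); [lia|]; rewrite Hi; ring|].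
    destruct (Nat.eq_dec k v) as [->|]; [rewrite (Hs w v), Wvw; ring|]. rewrite Hrw by assumption. ring. }
  assert (Cuw : c u w = 1 - x u - x v - x w).
  { unfold c, codeg. rewrite (Hsum 1 1 1); [ring|]. intros k Hk. rewrite !Hun.
    destruct (Nat.eq_dec k u) as [->|].
    { destruct (Nat.eq_dec u v), (Nat.eq_dec u w); try lia. rewrite Hi. ring. }
    destruct (Nat.eq_dec k v) as [->|].
    { destruct (Nat.eq_dec v w); try lia. rewrite Wuv. ring. }
    destruct (Nat.eq_dec k w) as [->|]; [rewrite Hi; ring|].
    rewrite Hru, Hrw by assumption. ring. }
  (* Since [a] misses only itself and [v], every neighbour of [v] is a neighbour of [a]. *)
  assert (Cv : forall a, 0 < x a -> (forall k, 0 < x k -> k <> a -> k <> v -> W a k = 1) -> W v a = 0 -> c a v = d v).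
  { intros a Ha Hr E. unfold c, codeg, d, deg. apply sum_ext. intros k _.
    destruct (Req_dec (x k) 0) as [->|]; [ring|].
    assert (Hk : 0 < x k) by (assert (Q := wg_nonneg _ _ _ wg k); lra).
    destruct (Nat.eq_dec k a) as [->|]; [rewrite E; ring|].
    destruct (Nat.eq_dec k v) as [->|]; [rewrite (Hi v); ring|].
    rewrite Hr by assumption. ring. }
  assert (Cuv : c u v = d v) by (apply Cv; auto; now rewrite Hs).
  assert (Cvw : c w v = d v) by (apply Cv; auto).
  assert (Dv0 : 0 <= d v).
  { unfold d, deg. apply sum_support_nonneg. intros. apply (wg_range _ _ _ wg). }
  assert (Dv1 : d v <= 1 - x u - x v - x w).
  { rewrite <- Cuw, <- (codeg_self v Hv).
    assert (Q : 0 <= sum n (fun k => x k * (W u k * W w k - W v k * W v k))).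
    { apply sum_support_nonneg. intros k Hk.
      destruct (Nat.eq_dec k u) as [->|]; [rewrite (Hs v u), Wuv, Hi; lra|].
      destruct (Nat.eq_dec k v) as [->|]; [rewrite (Hi v), Wuv; lra|].
      destruct (Nat.eq_dec k w) as [->|]; [rewrite Wvw, (Hi w); lra|].
      rewrite Hru, Hrw by assumption. assert (Q := wg_range _ _ _ wg v k). nra. }
    rewrite (sum_ext n _ (fun k => x k * (W u k * W w k) - x k * (W v k * W v k))) in Q by (intros; ring).
    rewrite sum_minus in Q. unfold c, codeg. lra. }
  assert (T1' : theta u v < 0) by (apply theta_neg; auto).
  assert (T2' : theta w v < 0) by (apply theta_neg; auto; now rewrite Hs).
  assert (T3' : 0 <= theta u w) by (apply theta_nonneg; auto; lra).
  unfold theta in T1', T2', T3'. rewrite Cuv in T1'. rewrite Cvw in T2'.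
  assert (Q11 := bil_nonadj u v Huv). rewrite delta_codeg, Cuv in Q11 by assumption.
  assert (Q22 := bil_nonadj w v (nonadj_sym _ _ Hvw)). rewrite delta_codeg, Cvw in Q22 by assumption.
  assert (Q12 : bil (diff_at u v) (diff_at w v) = p * (d u + d w) - (3 * q - p) * c u w - p * d v).
  { rewrite bil_diff, hess_adj, (hess_nonadj u v), (hess_nonadj v w), hess_self by assumption.
    unfold c in *. rewrite (codeg_sym n W x v w), Cuv, Cvw. ring. }
  apply (no_definite_plane (diff_at u v) (diff_at w v)); auto using direction_diff, bil_nonadj_pos.
  rewrite Q11, Q22, Q12. rewrite Du, Dw, Cuw in *.
  (* [r] is the weight that [v] misses outside [u], [v], [w]. The diagonal entries are [p (r + x w)]
     and [p (r + x u)], while the signs of [theta] give [p r <= Y < p min (x u, x w)] for the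
     off-diagonal entry [Y]. *)
  set (r := 1 - x u - x v - x w - d v). assert (Hr : 0 <= r) by (unfold r; lra).
  assert (Eq : 3 * q = om + 2 * p) by (unfold p, q; ring).
  rewrite Eq in *.
  (* Otherwise [theta u v = p (d u - d v) - om * d v] would be nonnegative, as [d v <= d u]. *)
  assert (Hom : 0 < om).
  { apply Rnot_le_lt. intros L.
    assert (om * d v <= 0) by nra.
    assert (0 <= p * (1 - x u - x v - d v)) by (apply Rmult_le_pos; lra). nra. }
  assert (B1 : p * r <= p * (1 - x u - x v + (1 - x w - x v)) - (om + 2 * p - p) * (1 - x u - x v - x w) - p * d v).
  { unfold r. lra. }
  assert (B2 : p * (1 - x u - x v + (1 - x w - x v)) - (om + 2 * p - p) * (1 - x u - x v - x w) - p * d v < p * x u).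
  { assert (0 <= om * r) by nra. unfold r in *. nra. }
  assert (B3 : p * (1 - x u - x v + (1 - x w - x v)) - (om + 2 * p - p) * (1 - x u - x v - x w) - p * d v < p * x w).
  { assert (0 <= om * r) by nra. unfold r in *. nra. }
  set (Y := p * (1 - x u - x v + (1 - x w - x v)) - (om + 2 * p - p) * (1 - x u - x v - x w) - p * d v) in *.
  assert (Y0 : 0 <= Y) by (assert (0 <= p * r) by nra; lra).
  assert (Y ^ 2 < (p * x w) * (p * x u)).
  { simpl. rewrite Rmult_1_r. apply Rmult_le_0_lt_compat; assumption. }
  eapply Rlt_le_trans; [eassumption|].
  apply Rmult_le_compat; try nra; apply Rmult_le_compat_l; unfold r in *; lra.
Qed.

Theorem optimal_complete u v : 0 < x u -> 0 < x v -> u <> v -> W u v = 1.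
Proof.
  intros Hu Hv Nuv. destruct (W01 u v Hu Hv) as [E|]; [|assumption]. exfalso.
  assert (Huv : nonadj u v) by (repeat split; auto).
  assert (Hde : 0 < delta u v) by now apply delta_pos.
  assert (delta u v = 0); [|lra].
  unfold delta. apply sum_0. intros k _.
  destruct (Req_dec (x k) 0) as [->|]; [ring|].
  assert (Hk : 0 < x k) by (assert (Q := wg_nonneg _ _ _ wg k); lra).
  destruct (Nat.eq_dec k u) as [->|]; [rewrite Hi, (Hs v u), E; ring|].
  destruct (Nat.eq_dec k v) as [->|]; [rewrite Hi, E; ring|].
  destruct (W01 u k Hu Hk) as [E1|E1].
  { exfalso. destruct (W0_cases u k Hu Hk E1) as [|Nuk]; [auto|].
    apply (no_path3 k u v); auto using nonadj_sym. }
  destruct (W01 v k Hv Hk) as [E2|E2].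
  { exfalso. destruct (W0_cases v k Hv Hk E2) as [|Nvk]; [auto|].
    apply (no_path3 u v k); auto using nonadj_sym. }
  rewrite E1, E2. ring.
Qed.

End Optimum.

(** * The bound for complete multipartite weights *)

(** The linear part of [phi] is [3 i p - 2 i ^ 2] with [i = 1 / M], and [p ^ 2] exceeds it by
    [(i - p) (2 i - p)]. The value [p ^ 2] is the Cauchy-Schwarz lower bound for the sum of cubes of
    weights with sum 1. *)
Lemma phi_le_of_large M p : 3 <= M -> p <= 1 / M -> phi M p <= p ^ 2.
Proof.
  intros HM Hp. unfold phi. rewrite sqrt_neg_0 by lra.
  set (i := 1 / M) in *. replace (3 / M) with (3 * i) by (unfold i; field; lra).
  replace (1 / M ^ 2) with (i ^ 2) by (unfold i; field; lra).
  assert (0 <= (i - p) * (2 * i - p)).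
  { apply Rmult_le_pos; [lra|]. assert (0 < i) by (apply Rdiv_lt_0_compat; lra). lra. }
  nra.
Qed.

(* With deviations [y = x - 1/M] and [L^2 = (M-1)V/M], the bound is
   [sum (y + L) (y - L/(M-1))^2 >= 0] over the [j] weights [a], the weight [b]
   and [M - j - 1] zero weights. *)
Lemma two_values_bound (m j : nat) a b : (3 <= m)%nat -> 0 < b <= a -> INR j * a + b = 1 ->
  phi (INR m) (INR j * a ^ 2 + b ^ 2) <= INR j * a ^ 3 + b ^ 3.
Proof.
  intros Hm [Hb Hba] Hsum.
  assert (HM : 3 <= INR m) by (replace 3 with (INR 3) by (simpl; ring); now apply le_INR).
  assert (HJ := pos_INR j). set (J := INR j) in *.
  set (P2 := J * a ^ 2 + b ^ 2).
  destruct (le_lt_dec m j) as [L|L].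
  (* With at least [m] copies of [a] the sum of squares is at most [a <= 1 / m], where [phi] is
     linear and Cauchy-Schwarz suffices. *)
  - assert (HMJ : INR m <= J) by now apply le_INR.
    assert (HP : P2 <= 1 / INR m).
    { apply Rle_trans with a.
      - unfold P2. replace a with (a * (J * a + b)) at 2 by (rewrite Hsum; ring). nra.
      - apply Rmult_le_reg_r with (INR m); [lra|]. unfold Rdiv. rewrite Rmult_assoc, Rinv_l by lra. nra. }
    apply Rle_trans with (P2 ^ 2); [now apply phi_le_of_large|].
    assert (E : J * a ^ 3 + b ^ 3 - P2 ^ 2 = J * a * b * (a - b) ^ 2).
    { replace (J * a ^ 3 + b ^ 3) with ((J * a ^ 3 + b ^ 3) * (J * a + b)) by (rewrite Hsum; ring).
      unfold P2. ring. }
    assert (0 <= J * a * b * (a - b) ^ 2) by (repeat apply Rmult_le_pos; try apply pow2_ge_0; lra).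
    lra.
  - assert (HJM : J + 1 <= INR m) by (unfold J; rewrite <- S_INR; apply le_INR; lia).
    assert (HJM' : J + 1 = INR m \/ J + 2 <= INR m).
    { destruct (Nat.eq_dec (S j) m) as [<-|]; [left; unfold J; now rewrite S_INR|right].
      unfold J. replace 2 with (INR 2) by reflexivity. rewrite <- plus_INR. apply le_INR. lia. }
    set (M := INR m) in *. unfold phi. set (V := P2 - 1 / M).
    assert (HMi : M * (1 / M) = 1) by (field; lra).
    set (i := 1 / M) in *.
    assert (Hi0 : 0 < i) by (apply Rdiv_lt_0_compat; lra).
    assert (CS : 1 <= (J + 1) * P2).
    { assert (E : (J + 1) * P2 - (J * a + b) ^ 2 = J * (a - b) ^ 2) by (unfold P2; ring).
      rewrite Hsum in E. assert (0 <= J * (a - b) ^ 2) by (apply Rmult_le_pos; [lra|apply pow2_ge_0]). lra. }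
    assert (HP2 : 0 < P2) by (apply Rnot_le_lt; intros N; nra).
    assert (HV : 0 <= V) by (unfold V; nra).
    set (s := sqrt V). assert (Hs : 0 <= s) by apply sqrt_pos.
    assert (Hss : s * s = V) by now apply sqrt_sqrt.
    unfold kap. set (r := sqrt (M * (M - 1))).
    assert (Hr : 0 < r) by (apply sqrt_lt_R0; nra).
    assert (Hrr : r * r = M * (M - 1)) by (apply sqrt_sqrt; nra).
    (* [l] is [L / (M - 1)] in the notation of the factorisation, and [LL] below is [L]. *)
    set (l := s / r). assert (Hl : 0 <= l) by (unfold l; apply Rmult_le_pos; [lra|left; now apply Rinv_0_lt_compat]).
    assert (Hls : l * r = s) by (unfold l; field; lra).
    assert (Hll : l ^ 2 * (M * (M - 1)) = V) by (rewrite <- Hrr, <- Hss, <- Hls; ring).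
    set (LL := (M - 1) * l).
    assert (HLL0 : 0 <= LL) by (unfold LL; nra).
    assert (HL2 : LL ^ 2 = (M - 1) * V * i).
    { unfold LL. rewrite <- Hll. replace ((M - 1) * (l ^ 2 * (M * (M - 1))) * i) with ((M - 1) * (l ^ 2 * (M - 1)) * (M * i)) by ring.
      rewrite HMi. ring. }
    (* Samuelson's inequality: a deviation among [M] numbers is at least [- L]. It is needed for the
       smallest positive weight and, in [Hz], for the zero weights if there are any. *)
    assert (Hb1 : 0 <= b - i + LL).
    { destruct (Rle_dec i b); [lra|].
      assert (i - b <= LL); [|lra]. apply Rsqr_incr_0_var; [|assumption]. unfold Rsqr.
      assert (E : LL * LL - (i - b) * (i - b) = i * (M - 1) * J * a ^ 2 - i * (1 - b) ^ 2).
      { replace (LL * LL) with (LL ^ 2) by ring. rewrite HL2. unfold V, P2. fold i.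
        replace ((M - 1) * (J * a ^ 2 + b ^ 2 - i) * i - (i - b) * (i - b))
          with (i * (M - 1) * J * a ^ 2 + i * (M * b ^ 2 - b ^ 2) - (M * i) * i + i * i - (i - b) * (i - b)) by ring.
        rewrite HMi. replace (i * (M * b ^ 2 - b ^ 2)) with ((M * i) * b ^ 2 - i * b ^ 2) by ring.
        rewrite HMi. ring. }
      replace (1 - b) with (J * a) in E by lra.
      replace (i * (M - 1) * J * a ^ 2 - i * (J * a) ^ 2) with (i * (J * (M - 1 - J)) * a ^ 2) in E by ring.
      assert (0 <= i * (J * (M - 1 - J)) * a ^ 2).
      { apply Rmult_le_pos; [|apply pow2_ge_0].
        apply Rmult_le_pos; [lra|]. apply Rmult_le_pos; lra. }
      lra. }
    assert (Hz : 0 <= (M - J - 1) * (LL - i)).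
    { destruct HJM' as [E|E]; [replace (M - J - 1) with 0 by lra; lra|].
      apply Rmult_le_pos; [lra|]. assert (i <= LL); [|lra].
      apply Rsqr_incr_0_var; [|assumption]. unfold Rsqr.
      replace (LL * LL) with (LL ^ 2) by ring. rewrite HL2.
      assert (1 <= (M - 1) * P2) by nra.
      assert (G : i <= (M - 1) * V).
      { unfold V. fold i. replace ((M - 1) * (P2 - i)) with ((M - 1) * P2 - M * i + i) by ring. lra. }
      nra. }
    assert (Hfin : 0 <= J * ((a - i + LL) * (a - i - l) ^ 2) + (b - i + LL) * (b - i - l) ^ 2
               + (M - J - 1) * (LL - i) * (i + l) ^ 2).
    { assert (0 <= J * ((a - i + LL) * (a - i - l) ^ 2)).
      { apply Rmult_le_pos; [lra|]. apply Rmult_le_pos; [lra|apply pow2_ge_0]. }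
      assert (0 <= (b - i + LL) * (b - i - l) ^ 2) by (apply Rmult_le_pos; [lra|apply pow2_ge_0]).
      assert (0 <= (M - J - 1) * (LL - i) * (i + l) ^ 2) by (apply Rmult_le_pos; [lra|apply pow2_ge_0]).
      lra. }
    assert (Eq : J * ((a - i + LL) * (a - i - l) ^ 2) + (b - i + LL) * (b - i - l) ^ 2
               + (M - J - 1) * (LL - i) * (i + l) ^ 2
        = J * a ^ 3 + b ^ 3 - (i ^ 2 + 3 * i * V - (M - 2) * l * V)).
    { assert (E0 : J * (a - i) + (b - i) - (M - J - 1) * i = 0).
      { replace (J * (a - i) + (b - i) - (M - J - 1) * i) with (J * a + b - M * i) by ring. lra. }
      assert (E2 : J * (a - i) ^ 2 + (b - i) ^ 2 + (M - J - 1) * i ^ 2 = V).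
      { replace (J * (a - i) ^ 2 + (b - i) ^ 2 + (M - J - 1) * i ^ 2)
          with (P2 - 2 * i * (J * a + b) + (M * i) * i) by (unfold P2; ring).
        rewrite Hsum, HMi. unfold V. ring. }
      assert (E3 : J * (a - i) ^ 3 + (b - i) ^ 3 - (M - J - 1) * i ^ 3 = J * a ^ 3 + b ^ 3 - i ^ 2 - 3 * i * V).
      { replace (J * (a - i) ^ 3 + (b - i) ^ 3 - (M - J - 1) * i ^ 3)
          with (J * a ^ 3 + b ^ 3 - 3 * i * P2 + 3 * i ^ 2 * (J * a + b) - (M * i) * i ^ 2) by (unfold P2; ring).
        rewrite Hsum, HMi. unfold V. ring. }
      transitivity ((J * (a - i) ^ 3 + (b - i) ^ 3 - (M - J - 1) * i ^ 3)
         + (LL - 2 * l) * (J * (a - i) ^ 2 + (b - i) ^ 2 + (M - J - 1) * i ^ 2)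
         + (l ^ 2 - 2 * LL * l) * (J * (a - i) + (b - i) - (M - J - 1) * i)
         + M * LL * l ^ 2); [ring|].
      rewrite E0, E2, E3.
      replace (M * LL * l ^ 2) with (l * (l ^ 2 * (M * (M - 1)))) by (unfold LL; ring).
      rewrite Hll. unfold LL. ring. }
    rewrite Eq in Hfin.
    replace (1 / M ^ 2) with (i ^ 2) by (unfold i; field; lra).
    replace (3 / M) with (3 * i) by (unfold i; field; lra).
    replace ((M - 2) / r * (V * s)) with ((M - 2) * l * V) by (unfold l; field; lra).
    lra.
Qed.

Lemma complete_paths_tris n W x : wgraph n W x ->
  (forall u v, 0 < x u -> 0 < x v -> u <> v -> W u v = 1) ->
  paths n W x = 1 - 2 * sum n (fun i => x i ^ 2) + sum n (fun i => x i ^ 3) /\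
  tris n W x = 1 - 3 * sum n (fun i => x i ^ 2) + 2 * sum n (fun i => x i ^ 3).
Proof.
  intros wg HW. set (p2 := sum n (fun i => x i ^ 2)). set (p3 := sum n (fun i => x i ^ 3)).
  assert (Hpos : forall k, x k <> 0 -> 0 < x k).
  { intros k Hk. assert (P := wg_nonneg _ _ _ wg k). lra. }
  assert (Hlt : forall k, 0 < x k -> (k < n)%nat).
  { intros k Hk. destruct (le_lt_dec n k) as [L|]; [|assumption].
    rewrite (wg_out _ _ _ wg) in Hk by assumption. lra. }
  assert (Hrow : forall u f, 0 < x u -> sum n (fun k => x k * (W u k * f k)) = sum n (fun k => x k * f k) - x u * f u).
  { intros u f Hu.
    rewrite (sum_ext n _ (fun k => x k * f k - unit_at u k * (x k * f k))).
    - rewrite sum_minus, sum_unit_at by now apply Hlt. ring.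
    - intros k _. destruct (Req_dec (x k) 0) as [->|Hk]; [ring|].
      destruct (Nat.eq_dec k u) as [->|Hne].
      + rewrite unit_at_same, (wg_irr _ _ _ wg). ring.
      + rewrite unit_at_other, HW by auto. ring. }
  assert (Hd : forall u, 0 < x u -> deg n W x u = 1 - x u).
  { intros u Hu. unfold deg. rewrite (sum_ext n _ (fun k => x k * (W u k * 1))) by (intros; ring).
    rewrite Hrow by assumption. rewrite (sum_ext n _ x) by (intros; ring).
    rewrite (wg_sum _ _ _ wg). ring. }
  assert (Hc : forall u v, 0 < x u -> 0 < x v -> u <> v -> codeg n W x u v = 1 - x u - x v).
  { intros u v Hu Hv Hne. unfold codeg. rewrite Hrow by assumption. rewrite (wg_sym _ _ _ wg v u), HW by assumption.
    fold (deg n W x v). rewrite Hd by assumption. ring. }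
  assert (Ht : forall u, 0 < x u -> tri_at n W x u = 1 - p2 - 2 * x u + 2 * x u ^ 2).
  { intros u Hu. unfold tri_at.
    rewrite (sum_ext n _ (fun k => x k * (W u k * (1 - x u - x k)))).
    - rewrite Hrow by assumption.
      rewrite (sum_ext n _ (fun k => (1 - x u) * x k - x k ^ 2)) by (intros; ring).
      rewrite sum_minus, sum_scal, (wg_sum _ _ _ wg). fold p2. ring.
    - intros k _. destruct (Req_dec (x k) 0) as [->|Hk]; [ring|].
      destruct (Nat.eq_dec k u) as [->|Hne]; [rewrite (wg_irr _ _ _ wg); ring|].
      rewrite Hc by auto. ring. }
  split.
  - unfold paths. rewrite (sum_ext n _ (fun k => x k - 2 * x k ^ 2 + x k ^ 3)).
    + rewrite sum_plus, sum_minus, sum_scal, (wg_sum _ _ _ wg). reflexivity.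
    + intros k _. destruct (Req_dec (x k) 0) as [E|Hk]; [rewrite E; ring|]. rewrite Hd by auto. ring.
  - unfold tris. rewrite (sum_ext n _ (fun k => (1 - p2) * x k - 2 * x k ^ 2 + 2 * x k ^ 3)).
    + rewrite sum_plus, sum_minus, !sum_scal, (wg_sum _ _ _ wg). fold p2 p3. ring.
    + intros k _. destruct (Req_dec (x k) 0) as [E|Hk]; [rewrite E; ring|]. rewrite Ht by auto. ring.
Qed.

(** The substitution [dS = dP3 - 2 dP2], [dT = 2 dP3 - 3 dP2] turns [p * dS - q * dT] into
    [om * dP2 - dP3] and [dT - 2 dS] into [dP2]. *)
Lemma leading_order_power_sums om A a0 a1 B b0 b1 e0 j (dP3 dP2 : R -> R) :
  0 < e0 -> (1 <= j)%nat ->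
  (forall e, dP3 e = e ^ j * (A + e * (a0 + a1 * e))) ->
  (forall e, dP2 e = e ^ j * (B + e * (b0 + b1 * e))) ->
  (forall e, 0 < e <= e0 -> om * dP2 e - dP3 e <= Rabs (dP2 e) * sqrt (Rabs (dP2 e))) ->
  om * B - A <= 0.
Proof.
  intros He Hj H3 H2 H.
  assert (G : (3 - 2 * om) * (- 2 * B + A) - (2 - om) * (- 3 * B + 2 * A) <= 0); [|lra].
  apply (leading_order_le _ _ _ (- 2 * b0 + a0) (- 2 * b1 + a1) _ (- 3 * b0 + 2 * a0) (- 3 * b1 + 2 * a1) e0 j
    (fun e => - 2 * dP2 e + dP3 e) (fun e => - 3 * dP2 e + 2 * dP3 e)); auto.
  - intros e. rewrite H2, H3. ring.
  - intros e. rewrite H2, H3. ring.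
  - intros e Hr. specialize (H e Hr).
    replace (- 3 * dP2 e + 2 * dP3 e - 2 * (- 2 * dP2 e + dP3 e)) with (dP2 e) by ring. lra.
Qed.

(** * The weights of an optimal complete graph *)

Section CompleteOptimum.
Variables (m n : nat) (W : nat -> nat -> R) (x : nat -> R).
Hypothesis Hm : (3 <= m)%nat.
Hypothesis Hopt : optimal (INR m) n W x.

Let wg := op_wg _ _ _ _ Hopt.
Let HM : 3 <= INR m.
Proof. replace 3 with (INR 3) by (simpl; ring). now apply le_INR. Qed.
Let HW := optimal_complete (INR m) n W x HM Hopt.
Let om := omega (INR m) (1 - 2 * paths n W x + tris n W x).

Lemma power_sums_local y e : sum n y = 0 -> (forall i, x i = 0 -> y i = 0) ->
  (forall i, 0 <= x i + e * y i) ->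
  let dP2 := e * (2 * sum n (fun i => x i * y i)) + e ^ 2 * sum n (fun i => y i ^ 2) in
  let dP3 := e * (3 * sum n (fun i => x i ^ 2 * y i)) + e ^ 2 * (3 * sum n (fun i => x i * y i ^ 2))
             + e ^ 3 * sum n (fun i => y i ^ 3) in
  om * dP2 - dP3 <= Rabs dP2 * sqrt (Rabs dP2).
Proof.
  intros Hy1 Hy2 Hpos dP2 dP3.
  assert (Hwg := wgraph_move (INR m) n W x Hopt y e (conj Hy1 Hy2) Hpos).
  assert (Hl := local_opt (INR m) n W x HM Hopt _ _ Hwg). cbv zeta in Hl. fold om in Hl.
  destruct (complete_paths_tris n W x wg HW) as [S0 T0].
  assert (Hsub : forall i, 0 < x i + e * y i -> 0 < x i).
  { intros i Hp. assert (Q := wg_nonneg _ _ _ wg i).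
    destruct (Req_dec (x i) 0) as [E|]; [|lra]. rewrite E, (Hy2 i E) in Hp. lra. }
  destruct (complete_paths_tris n W (fun k => x k + e * y k) Hwg) as [S1 T1].
  { intros u v Hu Hv. apply HW; auto. }
  assert (E2 : sum n (fun i => (x i + e * y i) ^ 2) = sum n (fun i => x i ^ 2) + dP2).
  { unfold dP2. rewrite (sum_ext n _ (fun i => x i ^ 2 + (e * 2 * (x i * y i) + e ^ 2 * y i ^ 2))) by (intros; ring).
    rewrite !sum_plus, !sum_scal. ring. }
  assert (E3 : sum n (fun i => (x i + e * y i) ^ 3) = sum n (fun i => x i ^ 3) + dP3).
  { unfold dP3. rewrite (sum_ext n _ (fun i => x i ^ 3 + (e * 3 * (x i ^ 2 * y i) + e ^ 2 * 3 * (x i * y i ^ 2) + e ^ 3 * y i ^ 3))) by (intros; ring).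
    rewrite !sum_plus, !sum_scal. ring. }
  rewrite E2, E3 in S1, T1. rewrite S0, S1, T0, T1 in Hl.
  set (X := sum n (fun i => x i ^ 2)) in *. set (Y := sum n (fun i => x i ^ 3)) in *.
  replace (1 - 3 * (X + dP2) + 2 * (Y + dP3) - (1 - 3 * X + 2 * Y)
      - 2 * (1 - 2 * (X + dP2) + (Y + dP3) - (1 - 2 * X + Y))) with dP2 in Hl by ring.
  lra.
Qed.

(** Stationarity factors as [(x u - x v) (2 om - 3 (x u + x v)) = 0]. For equal weights the
    first-order changes of both power sums vanish, so the second-order test applies and gives
    [om <= 3 x u]. *)
Lemma two_weights u v : 0 < x u -> 0 < x v -> u <> v ->
  (x u = x v /\ om <= 3 * x u) \/ (x u <> x v /\ 3 * (x u + x v) = 2 * om).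
Proof.
  intros Hu Hv Huv.
  assert (Lu := supp_lt (INR m) n W x Hopt u Hu). assert (Lv := supp_lt (INR m) n W x Hopt v Hv).
  assert (Hdir : forall s, sum n (fun i => s * diff_at u v i) = 0 /\ forall i, x i = 0 -> s * diff_at u v i = 0).
  { intros s. apply direction_scal with (x := x). now apply (direction_diff (INR m) n W x Hopt). }
  assert (Hs1 : forall s g, sum n (fun i => g i * (s * diff_at u v i)) = s * (g u - g v)).
  { intros s g. rewrite <- (sum_diff_at n u v g Lu Lv), <- sum_scal. apply sum_ext. intros; ring. }
  assert (Hs2 : forall s g, sum n (fun i => g i * (s * diff_at u v i) ^ 2) = s ^ 2 * (g u + g v)).
  { intros s g. rewrite <- (sum_unit_at n u g Lu), <- (sum_unit_at n v g Lv), <- sum_plus, <- sum_scal.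
    apply sum_ext. intros i _. unfold diff_at, unit_at.
    destruct (Nat.eqb_spec i u), (Nat.eqb_spec i v); subst; try (now elim Huv); ring. }
  assert (Hord : forall s, om * (2 * (s * (x u - x v))) - 3 * (s * (x u ^ 2 - x v ^ 2)) <= 0).
  { intros s. destruct (Hdir s) as [D1 D2].
    destruct (feasible (INR m) n W x Hopt _ D2) as [e0 [P0 H0]].
    apply (leading_order_power_sums om _ (3 * (s ^ 2 * (x u + x v))) (sum n (fun i => (s * diff_at u v i) ^ 3))
      _ (s ^ 2 * 2) 0 e0 1
      (fun e => e * (3 * (s * (x u ^ 2 - x v ^ 2))) + e ^ 2 * (3 * (s ^ 2 * (x u + x v))) + e ^ 3 * sum n (fun i => (s * diff_at u v i) ^ 3))
      (fun e => e * (2 * (s * (x u - x v))) + e ^ 2 * (s ^ 2 * 2))); auto; try (intros; ring).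
    intros e He. assert (G := power_sums_local _ e D1 D2 (fun i => H0 e i ltac:(lra))).
    cbv beta zeta in G. rewrite (Hs1 s x), (Hs1 s (fun i => x i ^ 2)), (Hs2 s x) in G.
    rewrite (sum_ext n (fun i => (s * diff_at u v i) ^ 2) (fun i => 1 * (s * diff_at u v i) ^ 2)) in G by (intros; ring).
    rewrite (Hs2 s (fun _ => 1)) in G. replace (s ^ 2 * (1 + 1)) with (s ^ 2 * 2) in G by ring. exact G. }
  assert (O1 := Hord 1). assert (O2 := Hord (-1)).
  destruct (Req_dec (x u) (x v)) as [E|E].
  - left. split; [assumption|]. destruct (Hdir 1) as [D1 D2].
    destruct (feasible (INR m) n W x Hopt _ D2) as [e0 [P0 H0]].
    assert (G2 : om * 2 - 3 * (x u + x v) <= 0); [|lra].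
    apply (leading_order_power_sums om _ (sum n (fun i => (1 * diff_at u v i) ^ 3)) 0
      _ 0 0 e0 2
      (fun e => e ^ 2 * (3 * (x u + x v)) + e ^ 3 * sum n (fun i => (1 * diff_at u v i) ^ 3))
      (fun e => e ^ 2 * 2)); auto; try (intros; ring).
    intros e He. assert (G := power_sums_local _ e D1 D2 (fun i => H0 e i ltac:(lra))).
    cbv beta zeta in G. rewrite (Hs1 1 x), (Hs1 1 (fun i => x i ^ 2)), (Hs2 1 x) in G.
    rewrite (sum_ext n (fun i => (1 * diff_at u v i) ^ 2) (fun i => 1 * (1 * diff_at u v i) ^ 2)) in G by (intros; ring).
    rewrite (Hs2 1 (fun _ => 1)) in G. rewrite E in *.
    replace (e * (2 * (1 * (x v - x v))) + e ^ 2 * (1 ^ 2 * (1 + 1))) with (e ^ 2 * 2) in G by ring.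
    replace (e * (3 * (1 * (x v ^ 2 - x v ^ 2))) + e ^ 2 * (3 * (1 ^ 2 * (x v + x v)))) with (e ^ 2 * (3 * (x v + x v))) in G by ring.
    exact G.
  - right. split; [assumption|].
    assert (Z : (x u - x v) * (2 * om - 3 * (x u + x v)) = 0) by lra.
    apply Rmult_integral in Z. lra.
Qed.

Lemma min_weight : exists i0, 0 < x i0 /\ forall k, 0 < x k -> x i0 <= x k.
Proof.
  assert (H : forall l, (exists i, (i < l)%nat /\ 0 < x i) ->
     exists i0, 0 < x i0 /\ forall k, (k < l)%nat -> 0 < x k -> x i0 <= x k).
  { induction l as [|l IH]; [intros [i [Hl _]]; lia|]. intros [i [Hl Hx]].
    destruct (classic (exists i, (i < l)%nat /\ 0 < x i)) as [Hex|Hno].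
    - destruct (IH Hex) as [i0 [H1 H2]].
      destruct (Rlt_dec 0 (x l)) as [Hp|Hp].
      + destruct (Rle_dec (x i0) (x l)) as [C|C].
        * exists i0. split; [assumption|]. intros k Hk Hxk.
          destruct (Nat.eq_dec k l) as [->|]; [assumption|]. apply H2; [lia|assumption].
        * exists l. split; [assumption|]. intros k Hk Hxk.
          destruct (Nat.eq_dec k l) as [->|]; [lra|]. assert (x i0 <= x k) by (apply H2; [lia|assumption]). lra.
      + exists i0. split; [assumption|]. intros k Hk Hxk.
        destruct (Nat.eq_dec k l) as [->|]; [contradiction|]. apply H2; [lia|assumption].
    - assert (i = l) by (apply NNPP; intros Hne; apply Hno; exists i; split; [lia|assumption]). subst i.
      exists l. split; [assumption|]. intros k Hk Hxk.
      destruct (Nat.eq_dec k l) as [->|]; [lra|]. exfalso. apply Hno. exists k. split; [lia|assumption]. }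
  destruct (H n) as [i0 [H1 H2]].
  { apply (sum_pos_ex n x). rewrite (wg_sum _ _ _ wg). lra. }
  exists i0. split; [assumption|]. intros k Hk. apply H2; [|assumption].
  now apply (supp_lt (INR m) n W x Hopt).
Qed.

(** Stated for every [g] with [g 0 = 0], so that one multiplicity [j] serves the first three power
    sums. *)
Lemma weights_two_values : exists (j : nat) a b, 0 < b <= a /\
  forall g, g 0 = 0 -> sum n (fun i => g (x i)) = INR j * g a + g b.
Proof.
  destruct min_weight as [i0 [H0 Hmin]].
  assert (Li0 := supp_lt (INR m) n W x Hopt i0 H0).
  assert (Heq : exists a, x i0 <= a /\ forall k, 0 < x k -> k <> i0 -> x k = a).
  { destruct (classic (exists k, 0 < x k /\ k <> i0)) as [[k0 [P0 N0]]|Hno].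
    - exists (x k0). split; [now apply Hmin|]. intros k Pk Nk.
      destruct (Nat.eq_dec k k0) as [->|Nkk]; [reflexivity|].
      (* Unequal weights at [k] and [k0] add up to [2 om / 3]. If both differ from the minimum
         [x i0], both complement it to that sum and hence agree; if one equals it, [om <= 3 x i0]
         makes their sum too large. *)
      destruct (two_weights k k0 Pk P0 Nkk) as [[E _]|[E1 E2]]; [assumption|]. exfalso.
      assert (M1 := Hmin k Pk). assert (M2 := Hmin k0 P0).
      destruct (two_weights k i0 Pk H0 Nk) as [[F1 F2]|[F1 F2]];
      destruct (two_weights k0 i0 P0 H0 N0) as [[G1 G2]|[G1 G2]]; lra.
    - exists (x i0). split; [lra|]. intros k Pk Nk. exfalso. apply Hno. now exists k. }
  destruct Heq as [a [Ha Hk]].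
  assert (Hj : forall l, exists j : nat, forall g, g 0 = 0 ->
     sum l (fun i => g (x i)) = INR j * g a + (if le_lt_dec l i0 then 0 else g (x i0))).
  { induction l as [|l [j IH]].
    - exists O. intros g Hg. simpl. destruct (le_lt_dec 0 i0); [ring|lia].
    - destruct (Nat.eq_dec l i0) as [->|Hne].
      + exists j. intros g Hg. cbn [sum]. rewrite IH by assumption.
        destruct (le_lt_dec i0 i0), (le_lt_dec (S i0) i0); try lia. ring.
      + destruct (Req_dec (x l) 0) as [E|E].
        * exists j. intros g Hg. cbn [sum]. rewrite IH, E, Hg by assumption.
          destruct (le_lt_dec l i0), (le_lt_dec (S l) i0); try lia; ring.
        * exists (S j). intros g Hg. cbn [sum]. rewrite IH, S_INR by assumption.
          assert (Q := wg_nonneg _ _ _ wg l). rewrite (Hk l) by (auto; lra).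
          destruct (le_lt_dec l i0), (le_lt_dec (S l) i0); try lia; ring. }
  destruct (Hj n) as [j Hjn]. exists j, a, (x i0). split; [lra|].
  intros g Hg. rewrite Hjn by assumption. destruct (le_lt_dec n i0); [lia|reflexivity].
Qed.

Lemma optimal_excess_nonneg : 0 <= excess (INR m) n W x.
Proof.
  destruct (complete_paths_tris n W x wg HW) as [S0 T0]. unfold excess. rewrite S0, T0.
  destruct weights_two_values as [j [a [b [Hab Hsum]]]].
  assert (E1 := Hsum (fun s => s) eq_refl). cbv beta in E1.
  assert (E2 := Hsum (fun s => s ^ 2) ltac:(cbv beta; ring)). cbv beta in E2.
  assert (E3 := Hsum (fun s => s ^ 3) ltac:(cbv beta; ring)). cbv beta in E3.
  change (fun i => x i) with x in E1. rewrite (wg_sum _ _ _ wg) in E1.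
  rewrite E2, E3. set (p2 := INR j * a ^ 2 + b ^ 2). set (p3 := INR j * a ^ 3 + b ^ 3).
  replace (1 - 2 * (1 - 2 * p2 + p3) + (1 - 3 * p2 + 2 * p3)) with p2 by ring.
  assert (H := two_values_bound m j a b Hm Hab ltac:(lra)). fold p2 p3 in H. lra.
Qed.

End CompleteOptimum.

(** * Existence of an optimal weighted graph *)

Lemma cv_subseq (u : nat -> R) l s : (forall k, (s k < s (S k))%nat) -> Un_cv u l -> Un_cv (fun k => u (s k)) l.
Proof.
  intros Hs Hu eps He. destruct (Hu eps He) as [N HN]. exists N. intros k Hk. apply HN.
  assert (forall i, (i <= s i)%nat); [|specialize (H k); lia].
  induction i as [|i IH]; [lia|]. specialize (Hs i). lia.
Qed.

Lemma bounded_subseq (u : nat -> R) : (forall k, 0 <= u k <= 1) ->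
  exists s l, (forall k, (s k < s (S k))%nat) /\ Un_cv (fun k => u (s k)) l.
Proof.
  intros Hu. destruct (Bolzano_Weierstrass u (fun c => 0 <= c <= 1) (compact_P3 0 1) Hu) as [l Hl].
  assert (Hpick : forall N k : nat, exists q, (N <= q)%nat /\ Rabs (u q - l) < / INR (S k)).
  { intros N k. assert (P : 0 < / INR (S k)) by (apply Rinv_0_lt_compat, lt_0_INR; lia).
    apply (Hl (fun y => Rabs (y - l) < / INR (S k)) N). exists (mkposreal _ P). intros y Hy. exact Hy. }
  set (pick N k := proj1_sig (constructive_indefinite_description _ (Hpick N k))).
  assert (Hp : forall N k, (N <= pick N k)%nat /\ Rabs (u (pick N k) - l) < / INR (S k)).
  { intros N k. unfold pick. now destruct (constructive_indefinite_description _ (Hpick N k)). }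
  set (s := fix s k := match k with O => pick O O | S k' => pick (S (s k')) k end).
  exists s, l. split.
  - intros k. change (s (S k)) with (pick (S (s k)) (S k)). destruct (Hp (S (s k)) (S k)). lia.
  - intros eps He. destruct (archimed_cor1 eps He) as [N [HN PN]]. exists N. intros k Hk.
    assert (Hb : Rabs (u (s k) - l) < / INR (S k)) by (destruct k; apply Hp).
    unfold Rdist. eapply Rlt_trans; [exact Hb|]. eapply Rle_lt_trans; [|exact HN].
    apply Rinv_le_contravar; [now apply lt_0_INR|]. apply le_INR. lia.
Qed.

Lemma bounded_family_subseq K (u : nat -> nat -> R) : (forall i k, 0 <= u i k <= 1) ->
  exists s, (forall k, (s k < s (S k))%nat) /\
    forall i, (i < K)%nat -> exists l, Un_cv (fun k => u i (s k)) l.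
Proof.
  intros Hu. induction K as [|K [s [Hs IH]]].
  - exists (fun k => k). split; intros; lia.
  - destruct (bounded_subseq (fun k => u K (s k)) (fun k => Hu _ _)) as [r [l [Hr Hl]]].
    exists (fun k => s (r k)). split.
    + assert (Hmono : forall a b, (a < b)%nat -> (s a < s b)%nat).
      { intros a b H. induction H; [apply Hs|]. specialize (Hs m). lia. }
      intros k. apply Hmono, Hr.
    + intros i Hi. destruct (Nat.eq_dec i K) as [->|Hne]; [now exists l|].
      destruct (IH i ltac:(lia)) as [l' Hl']. exists l'.
      now apply (cv_subseq (fun k => u i (s k))).
Qed.

Lemma cv_const c : Un_cv (fun _ => c) c.
Proof. intros eps He. exists O. intros. unfold Rdist. rewrite Rminus_diag, Rabs_R0. exact He. Qed.

Lemma cv_scal c u l : Un_cv u l -> Un_cv (fun k => c * u k) (c * l).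
Proof. intros H. apply (CV_mult (fun _ => c)); [apply cv_const|exact H]. Qed.

Lemma cv_sum n (u : nat -> nat -> R) (l : nat -> R) : (forall i, (i < n)%nat -> Un_cv (u i) (l i)) ->
  Un_cv (fun k => sum n (fun i => u i k)) (sum n l).
Proof.
  induction n as [|n IH]; intros H; simpl.
  - apply cv_const.
  - apply (CV_plus (fun k => sum n (fun i => u i k)) (u n)); [apply IH|]; intros; apply H; lia.
Qed.

Lemma cv_le u l c : Un_cv u l -> (forall k, u k <= c) -> l <= c.
Proof.
  intros H Hc. apply Rnot_lt_le. intros L. destruct (H (l - c) ltac:(lra)) as [N HN].
  specialize (HN N (le_n N)). unfold Rdist in HN. apply Rabs_def2 in HN. specialize (Hc N). lra.
Qed.

Lemma cv_ge u l c : Un_cv u l -> (forall k, c <= u k) -> c <= l.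
Proof.
  intros H Hc. apply Rnot_lt_le. intros L. destruct (H (c - l) ltac:(lra)) as [N HN].
  specialize (HN N (le_n N)). unfold Rdist in HN. apply Rabs_def2 in HN. specialize (Hc N). lra.
Qed.

Section LimitGraph.
Variables (n : nat) (Wk : nat -> nat -> nat -> R) (xk : nat -> nat -> R).
Variables (W : nat -> nat -> R) (x : nat -> R).
Hypothesis HW : forall i j, (i < n)%nat -> (j < n)%nat -> Un_cv (fun k => Wk k i j) (W i j).
Hypothesis Hx : forall i, (i < n)%nat -> Un_cv (fun k => xk k i) (x i).

Lemma cv_paths : Un_cv (fun k => paths n (Wk k) (xk k)) (paths n W x).
Proof.
  unfold paths, deg. apply (cv_sum n (fun i k => xk k i * sum n (fun l => xk k l * Wk k i l) ^ 2)).
  intros i Hi.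
  assert (HD : Un_cv (fun k => sum n (fun l => xk k l * Wk k i l)) (sum n (fun l => x l * W i l))).
  { apply (cv_sum n (fun l k => xk k l * Wk k i l)). intros l Hl.
    apply (CV_mult (fun k => xk k l)); auto. }
  apply (CV_mult (fun k => xk k i)); auto. simpl.
  apply (CV_mult _ (fun k => sum n (fun l => xk k l * Wk k i l) * 1) _ _ HD).
  apply (CV_mult _ (fun _ => 1)); [exact HD|apply cv_const].
Qed.

Lemma cv_tris : Un_cv (fun k => tris n (Wk k) (xk k)) (tris n W x).
Proof.
  unfold tris, tri_at, codeg.
  apply (cv_sum n (fun i k => xk k i * sum n (fun j => xk k j * (Wk k i j * sum n (fun l => xk k l * (Wk k i l * Wk k j l)))))).
  intros i Hi. apply (CV_mult (fun k => xk k i)); auto.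
  apply (cv_sum n (fun j k => xk k j * (Wk k i j * sum n (fun l => xk k l * (Wk k i l * Wk k j l))))).
  intros j Hj. apply (CV_mult (fun k => xk k j)); auto. apply (CV_mult (fun k => Wk k i j)); auto.
  apply (cv_sum n (fun l k => xk k l * (Wk k i l * Wk k j l))).
  intros l Hl. apply (CV_mult (fun k => xk k l)); auto. apply (CV_mult (fun k => Wk k i l)); auto.
Qed.
End LimitGraph.

Lemma continuity_pt_phi M p : continuity_pt (phi M) p.
Proof.
  assert (Hsq : forall y, continuity_pt sqrt y).
  { intros y. apply Hierarchy.continuity_pt_filterlim, ElemFct.continuous_sqrt. }
  unfold phi. set (g := fun p => p - 1 / M).
  assert (Hg : continuity_pt g p) by (unfold g; reg).
  apply (continuity_pt_minus (fun p => 1 / M ^ 2 + 3 / M * g p) (fun p => kap M * (g p * sqrt (g p)))).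
  - apply (continuity_pt_plus (fun _ => 1 / M ^ 2) (fun p => 3 / M * g p)); [reg|].
    now apply (continuity_pt_scal g).
  - apply (continuity_pt_scal (fun p => g p * sqrt (g p))).
    apply (continuity_pt_mult g (fun p => sqrt (g p))); [assumption|].
    now apply (continuity_pt_comp g sqrt).
Qed.

Lemma cv_phi M u l : Un_cv u l -> Un_cv (fun k => phi M (u k)) (phi M l).
Proof. apply continuity_seq, continuity_pt_phi. Qed.

Lemma wgraph_bounds n W x : wgraph n W x -> 0 <= paths n W x <= 1 /\ 0 <= tris n W x <= 1.
Proof.
  intros [w1 w2 w3 w4 w5 w6].
  assert (Hs : forall g, (forall i, 0 <= g i <= 1) -> 0 <= sum n (fun i => x i * g i) <= 1).
  { intros g Hg. split.
    - apply sum_nonneg. intros i _. apply Rmult_le_pos; [apply w1|apply Hg].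
    - rewrite <- w3. apply sum_le. intros i _. specialize (w1 i). specialize (Hg i). nra. }
  split.
  - apply Hs. intros i. assert (0 <= deg n W x i <= 1) by (apply Hs; intros; apply w4). nra.
  - apply Hs. intros i. apply Hs. intros j.
    assert (0 <= codeg n W x i j <= 1).
    { apply Hs. intros k. generalize (w4 i k) (w4 j k). intros. nra. }
    generalize (w4 i j). intros. nra.
Qed.

(** Any finite bound serves; it makes the infimum over weighted graphs exist. *)
Lemma excess_lower n W x M : 3 <= M -> wgraph n W x -> -10 <= excess M n W x.
Proof.
  intros HM Hw. destruct (wgraph_bounds n W x Hw) as [Hp Ht]. unfold excess.
  set (P := 1 - 2 * paths n W x + tris n W x). assert (-1 <= P <= 2) by (unfold P; lra).
  assert (phi M P <= 4); [|lra].
  unfold phi. assert (K := kap_bounds M HM).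
  assert (Hi : 0 < 1 / M <= 1 / 3).
  { split; [apply Rdiv_lt_0_compat; lra|]. unfold Rdiv. rewrite !Rmult_1_l. apply Rinv_le_contravar; lra. }
  set (i := 1 / M) in *. replace (3 / M) with (3 * i) by (unfold i; field; lra).
  replace (1 / M ^ 2) with (i ^ 2) by (unfold i; field; lra).
  assert (0 <= kap M * ((P - i) * sqrt (P - i))).
  { apply Rmult_le_pos; [lra|]. destruct (Rle_dec 0 (P - i)).
    - apply Rmult_le_pos; [lra|apply sqrt_pos].
    - rewrite sqrt_neg_0 by lra. lra. }
  nra.
Qed.

Lemma minimizer_exists n W0 x0 M : 3 <= M -> wgraph n W0 x0 ->
  exists W x, wgraph n W x /\ forall W' x', wgraph n W' x' -> excess M n W x <= excess M n W' x'.
Proof.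
  intros HM H0.
  (* The sign turns the supremum provided by [completeness] into an infimum: [- I] is the infimum of
     [excess]. *)
  set (E := fun r => exists W x, wgraph n W x /\ r = - excess M n W x).
  destruct (completeness E) as [I [HI1 HI2]].
  - exists 10. intros r [W [x [Hw ->]]]. assert (B := excess_lower n W x M HM Hw). lra.
  - exists (- excess M n W0 x0). now exists W0, x0.
  - assert (Hseq : forall k : nat, exists z : (nat -> nat -> R) * (nat -> R),
        wgraph n (fst z) (snd z) /\ excess M n (fst z) (snd z) < - I + / INR (S k)).
    { intros k. assert (P : 0 < / INR (S k)) by (apply Rinv_0_lt_compat, lt_0_INR; lia).
      apply NNPP. intros C. assert (B : I <= I - / INR (S k)); [|lra]. apply HI2.
      intros r [W [x [Hw ->]]]. apply Rnot_lt_le. intros L. apply C. exists (W, x). split; [exact Hw|cbn [fst snd]; lra]. }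
    set (z k := proj1_sig (constructive_indefinite_description _ (Hseq k))).
    assert (Hz : forall k, wgraph n (fst (z k)) (snd (z k)) /\ excess M n (fst (z k)) (snd (z k)) < - I + / INR (S k)).
    { intros k. unfold z. now destruct (constructive_indefinite_description _ (Hseq k)). }
    assert (Hx01 : forall k i, 0 <= snd (z k) i <= 1).
    { intros k i. destruct (Hz k) as [[w1 w2 w3 _ _ _] _]. split; [apply w1|].
      destruct (le_lt_dec n i) as [L|L]; [rewrite w2 by assumption; lra|].
      rewrite <- w3. apply sum_ge_term; auto. }
    destruct (bounded_family_subseq n (fun i k => snd (z k) i) (fun i k => Hx01 k i)) as [s [Hs Hsx]].
    (* The edge weights are listed by [m = i * n + j]. Limits exist only for indices below [n]; all
       other entries of the limit graph are set to 0. *)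
    destruct (bounded_family_subseq (n * n) (fun m k => fst (z (s k)) (m / n)%nat (m mod n)%nat)) as [r [Hr Hrw]].
    { intros m k. destruct (Hz (s k)) as [Hw _]. apply (wg_range _ _ _ Hw). }
    set (y k := z (s (r k))).
    assert (Hylim : forall i, exists l, ((i < n)%nat -> Un_cv (fun k => snd (y k) i) l) /\ ((n <= i)%nat -> l = 0)).
    { intros i. destruct (le_lt_dec n i) as [L|L].
      - exists 0. split; [lia|auto].
      - destruct (Hsx i L) as [l Hl]. exists l. split; [|lia]. intros _.
        now apply (cv_subseq (fun k => snd (z (s k)) i)). }
    assert (HWlim : forall i j, exists l, ((i < n)%nat -> (j < n)%nat -> Un_cv (fun k => fst (y k) i j) l) /\
                     (~ ((i < n)%nat /\ (j < n)%nat) -> l = 0)).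
    { intros i j. destruct (classic ((i < n)%nat /\ (j < n)%nat)) as [[Li Lj]|L].
      - destruct (Hrw (i * n + j)%nat ltac:(nia)) as [l Hl]. exists l. split; [|tauto]. intros _ _.
        replace ((i * n + j) / n)%nat with i in Hl by (rewrite Nat.div_add_l by lia; rewrite Nat.div_small; lia).
        replace ((i * n + j) mod n)%nat with j in Hl by (rewrite Nat.add_comm, Nat.Div0.mod_add, Nat.mod_small; lia).
        exact Hl.
      - exists 0. split; [tauto|auto]. }
    set (x i := proj1_sig (constructive_indefinite_description _ (Hylim i))).
    set (W i j := proj1_sig (constructive_indefinite_description _ (HWlim i j))).
    assert (Hx : forall i, ((i < n)%nat -> Un_cv (fun k => snd (y k) i) (x i)) /\ ((n <= i)%nat -> x i = 0)).
    { intros i. unfold x. now destruct (constructive_indefinite_description _ (Hylim i)). }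
    assert (HW : forall i j, ((i < n)%nat -> (j < n)%nat -> Un_cv (fun k => fst (y k) i j) (W i j)) /\
                     (~ ((i < n)%nat /\ (j < n)%nat) -> W i j = 0)).
    { intros i j. unfold W. now destruct (constructive_indefinite_description _ (HWlim i j)). }
    assert (Hwy : forall k, wgraph n (fst (y k)) (snd (y k))) by (intros; apply Hz).
    exists W, x. split; [split|].
    + intros i. destruct (le_lt_dec n i) as [L|L]; [rewrite (proj2 (Hx i)) by assumption; lra|].
      apply (cv_ge _ _ _ (proj1 (Hx i) L)). intros k. apply (wg_nonneg _ _ _ (Hwy k)).
    + intros i. apply Hx.
    + apply (UL_sequence (fun k => sum n (fun i => snd (y k) i))).
      * apply (cv_sum n (fun i k => snd (y k) i)). intros i L. now apply Hx.
      * apply (Un_cv_ext (fun _ => 1)); [|apply cv_const].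
        intros k. symmetry. apply (wg_sum _ _ _ (Hwy k)).
    + intros i j. destruct (classic ((i < n)%nat /\ (j < n)%nat)) as [[Li Lj]|L].
      * split; [apply (cv_ge _ _ _ (proj1 (HW i j) Li Lj))|apply (cv_le _ _ _ (proj1 (HW i j) Li Lj))];
          intros k; apply (wg_range _ _ _ (Hwy k)).
      * rewrite (proj2 (HW i j) L). lra.
    + intros i j. destruct (classic ((i < n)%nat /\ (j < n)%nat)) as [[Li Lj]|L].
      * apply (UL_sequence (fun k => fst (y k) i j)); [now apply HW|].
        apply (Un_cv_ext (fun k => fst (y k) j i)); [|now apply HW].
        intros k. apply (wg_sym _ _ _ (Hwy k)).
      * rewrite (proj2 (HW i j) L). symmetry. apply HW. tauto.
    + intros i. destruct (le_lt_dec n i) as [L|L]; [apply HW; lia|].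
      apply (UL_sequence (fun k => fst (y k) i i)); [now apply HW|].
      apply (Un_cv_ext (fun _ => 0)); [|apply cv_const].
      intros k. symmetry. apply (wg_irr _ _ _ (Hwy k)).
    + intros W' x' Hw'.
      assert (B : - I <= excess M n W' x') by (assert (- excess M n W' x' <= I) by (apply HI1; now exists W', x'); lra).
      eapply Rle_trans; [|exact B].
      assert (Cp : Un_cv (fun k => paths n (fst (y k)) (snd (y k))) (paths n W x)).
      { apply cv_paths; intros; [now apply HW|now apply Hx]. }
      assert (Ct : Un_cv (fun k => tris n (fst (y k)) (snd (y k))) (tris n W x)).
      { apply cv_tris; intros; [now apply HW|now apply Hx]. }
      set (pk k := paths n (fst (y k)) (snd (y k))) in *. set (tk k := tris n (fst (y k)) (snd (y k))) in *.
      assert (CP : Un_cv (fun k => 1 - 2 * pk k + tk k) (1 - 2 * paths n W x + tris n W x)).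
      { apply (CV_plus (fun k => 1 - 2 * pk k) tk); [|assumption].
        apply (CV_minus (fun _ => 1) (fun k => 2 * pk k)); [apply cv_const|now apply cv_scal]. }
      assert (CE : Un_cv (fun k => excess M n (fst (y k)) (snd (y k))) (excess M n W x)).
      { unfold excess. fold pk tk.
        apply (CV_minus (fun k => 1 - 3 * pk k + 2 * tk k) (fun k => phi M (1 - 2 * pk k + tk k)));
          [|now apply cv_phi].
        apply (CV_plus (fun k => 1 - 3 * pk k) (fun k => 2 * tk k)); [|now apply cv_scal].
        apply (CV_minus (fun _ => 1) (fun k => 3 * pk k)); [apply cv_const|now apply cv_scal]. }
      apply Rnot_lt_le. intros L.
      destruct (CE ((excess M n W x + I) / 2) ltac:(lra)) as [N1 HN1].
      destruct (archimed_cor1 ((excess M n W x + I) / 2) ltac:(lra)) as [N2 [HN2 PN2]].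
      set (k := max N1 N2). specialize (HN1 k ltac:(unfold k; lia)). unfold Rdist in HN1. apply Rabs_def2 in HN1.
      destruct (Hz (s (r k))) as [_ Hk]. fold (y k) in Hk.
      assert (Hge : (N2 <= s (r k))%nat).
      { assert (Hid : forall q : nat -> nat, (forall k, (q k < q (S k))%nat) -> forall k, (k <= q k)%nat).
        { intros q Hq. induction k0 as [|k0 IH]; [lia|]. specialize (Hq k0). lia. }
        assert (A1 := Hid r Hr k). assert (A2 := Hid s Hs (r k)). unfold k in *. lia. }
      assert (/ INR (S (s (r k))) <= / INR N2).
      { apply Rinv_le_contravar; [now apply lt_0_INR|]. apply le_INR. lia. }
      lra.
Qed.

Lemma least_nat (P : nat -> Prop) k : P k -> exists k0, P k0 /\ forall j, P j -> (k0 <= j)%nat.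
Proof.
  induction k as [k IH] using (well_founded_induction lt_wf). intros Pk.
  destruct (classic (exists j, (j < k)%nat /\ P j)) as [[j [L Pj]]|C].
  - now apply (IH j).
  - exists k. split; [assumption|]. intros j Pj. destruct (le_lt_dec k j); [assumption|].
    exfalso. apply C. now exists j.
Qed.

Lemma optimal_exists n W0 x0 M : 3 <= M -> wgraph n W0 x0 -> exists W x, optimal M n W x.
Proof.
  intros HM H0. destruct (minimizer_exists n W0 x0 M HM H0) as [W1 [x1 [Hw1 Hm1]]].
  set (P := fun k => exists W x, wgraph n W x /\ excess M n W x <= excess M n W1 x1 /\ nsupp n x = k).
  destruct (least_nat P (nsupp n x1)) as [k0 [[W [x [Hw [He Hn]]]] Hk0]].
  { exists W1, x1. split; [assumption|]. split; [lra|reflexivity]. }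
  exists W, x. split; [assumption| |].
  - intros W' x' Hw'. specialize (Hm1 W' x' Hw'). lra.
  - intros W' x' Hw' He'. rewrite Hn. apply Hk0. exists W', x'. split; [assumption|]. split; [lra|reflexivity].
Qed.

Theorem phi_bound m n W x : (3 <= m)%nat -> wgraph n W x ->
  phi (INR m) (1 - 2 * paths n W x + tris n W x) <= 1 - 3 * paths n W x + 2 * tris n W x.
Proof.
  intros Hm Hw.
  assert (HM : 3 <= INR m) by (replace 3 with (INR 3) by (simpl; ring); now apply le_INR).
  destruct (optimal_exists n W x (INR m) HM Hw) as [W1 [x1 Hopt]].
  assert (H1 := optimal_excess_nonneg m n W1 x1 Hm Hopt).
  assert (H2 := op_min _ _ _ _ Hopt W x Hw). unfold excess in *. lra.
Qed.

(** * Razborov's curve *)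

(* Edge and triangle densities of the complete [k]-partite graph with one part of size [z]
   and the others equal; the matching function is [phi k]. *)
Definition curve_d (k : nat) (z : R) : R :=
  (1 - z) * (INR k * z + INR k - 2) / (INR k - 1).
Definition curve_t (k : nat) (z : R) : R :=
  (1 - z) ^ 2 * (INR k - 2) * (2 * z * INR k + INR k - 3) / (INR k - 1) ^ 2.

Lemma INR_ge_3 k : (3 <= k)%nat -> 3 <= INR k.
Proof. intros H. replace 3 with (INR 3) by (simpl; ring). now apply le_INR. Qed.

(** The sum of squared deviations of the part sizes from [1 / k] is an exact square in [z] up to a
    constant. Upper bound, injectivity and inversion of [curve_d] and the square root in [phi] all
    come from this. *)
Lemma curve_d_gap k z : (3 <= k)%nat ->
  1 - 1 / INR k - curve_d k z = (INR k * z - 1) ^ 2 / (INR k * (INR k - 1)).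
Proof. intros Hk. apply INR_ge_3 in Hk. unfold curve_d. field. lra. Qed.

Lemma curve_d_le k z : (3 <= k)%nat -> curve_d k z <= 1 - 1 / INR k.
Proof.
  intros Hk. assert (H := curve_d_gap k z Hk). apply INR_ge_3 in Hk.
  assert (0 <= (INR k * z - 1) ^ 2 / (INR k * (INR k - 1))).
  { apply Rmult_le_pos; [apply pow2_ge_0|]. left. apply Rinv_0_lt_compat. nra. }
  lra.
Qed.

Lemma curve_d_gt k z : (3 <= k)%nat -> 0 < z <= 1 / INR k -> 1 - 1 / (INR k - 1) < curve_d k z.
Proof.
  intros Hk [Hz0 Hz1]. apply INR_ge_3 in Hk.
  assert (Hz2 : INR k * z <= 1).
  { replace 1 with (INR k * (1 / INR k)) by (field; lra). apply Rmult_le_compat_l; lra. }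
  assert (E : curve_d k z - (1 - 1 / (INR k - 1)) = z * (2 - INR k * z) / (INR k - 1)) by (unfold curve_d; field; lra).
  assert (0 < z * (2 - INR k * z) / (INR k - 1)).
  { apply Rdiv_lt_0_compat; [nra|lra]. }
  lra.
Qed.

Lemma gR_k_eq k d : (3 <= k)%nat -> 1 - 1 / (INR k - 1) < d <= 1 - 1 / INR k -> gR_k d = k.
Proof.
  intros Hk [Hd1 Hd2]. assert (HK := INR_ge_3 k Hk).
  assert (Hlow : forall j : nat, (1 <= j)%nat -> d <= 1 - 1 / INR j -> (k <= j)%nat).
  { intros j Hj Hdj. destruct (le_lt_dec k j) as [L|L]; [assumption|]. exfalso.
    assert (0 < INR j) by (apply lt_0_INR; lia).
    assert (INR j <= INR k - 1) by (replace (INR k - 1) with (INR (k - 1)) by (rewrite minus_INR by lia; reflexivity); apply le_INR; lia).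
    assert (1 / (INR k - 1) <= 1 / INR j).
    { unfold Rdiv. rewrite !Rmult_1_l. apply Rinv_le_contravar; lra. }
    lra. }
  unfold gR_k.
  match goal with |- epsilon ?i ?P = _ => assert (HP := epsilon_spec i P) end.
  destruct HP as [G1 [G2 G3]].
  - exists k. split; [lia|]. split; [assumption|exact Hlow].
  - apply Nat.le_antisymm; [apply G3; [lia|assumption]|now apply Hlow].
Qed.

Lemma curve_d_inj k z z' : (3 <= k)%nat -> z <= 1 / INR k -> z' <= 1 / INR k ->
  curve_d k z = curve_d k z' -> z = z'.
Proof.
  intros Hk Hz Hz' E.
  assert (H1 := curve_d_gap k z Hk). assert (H2 := curve_d_gap k z' Hk).
  assert (HK := INR_ge_3 k Hk).
  assert (P : forall y, y <= 1 / INR k -> INR k * y <= 1).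
  { intros y Hy. replace 1 with (INR k * (1 / INR k)) by (field; lra). apply Rmult_le_compat_l; lra. }
  assert (A := P z Hz). assert (B := P z' Hz').
  assert (Q : (INR k * z - 1) ^ 2 = (INR k * z' - 1) ^ 2).
  { replace ((INR k * z - 1) ^ 2) with ((INR k * z - 1) ^ 2 / (INR k * (INR k - 1)) * (INR k * (INR k - 1))) by (field; lra).
    rewrite <- H1, E, H2. field. lra. }
  assert (Z : (INR k * z - INR k * z') * (2 - INR k * z - INR k * z') = 0) by nra.
  apply Rmult_integral in Z. destruct Z as [Z|Z].
  - apply Rmult_eq_reg_l with (INR k); lra.
  - apply Rmult_eq_reg_l with (INR k); lra.
Qed.

(** Both [epsilon] choices in [gR] are pinned down by uniqueness: of [k] because an arc stays within
    its half-open interval, of [z] because [z <= 1 / k] selects one root. *)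
Lemma gR_curve k z : (3 <= k)%nat -> 0 < z <= 1 / INR k -> gR (curve_d k z) = curve_t k z.
Proof.
  intros Hk Hz. assert (HK := INR_ge_3 k Hk).
  assert (Hd1 := curve_d_gt k z Hk Hz). assert (Hd2 := curve_d_le k z Hk).
  assert (Ek := gR_k_eq k _ Hk (conj Hd1 Hd2)).
  assert (Hi : 0 < 1 / INR k) by (apply Rdiv_lt_0_compat; lra).
  assert (Hhalf : 1 / (INR k - 1) <= 1 / 2).
  { unfold Rdiv. rewrite !Rmult_1_l. apply Rinv_le_contravar; lra. }
  assert (Ez : gR_z (curve_d k z) = z).
  { unfold gR_z. rewrite Ek.
    match goal with |- epsilon ?i ?P = _ => assert (HP := epsilon_spec i P) end.
    destruct HP as [[G1 G2] G3].
    - exists z. split; [assumption|reflexivity].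
    - apply (curve_d_inj k); [assumption|assumption|apply Hz|]. symmetry. exact G3. }
  unfold gR. destruct (Rle_dec (curve_d k z) (1 / 2)); [lra|].
  destruct (Req_EM_T (curve_d k z) 1); [lra|].
  rewrite Ek, Ez. reflexivity.
Qed.

Lemma curve_d_surj d : 1 / 2 < d < 1 ->
  exists k z, (3 <= k)%nat /\ 0 < z <= 1 / INR k /\ d = curve_d k z.
Proof.
  intros Hd.
  destruct (archimed_cor1 (1 - d) ltac:(lra)) as [N [HN PN]].
  destruct (least_nat (fun k => (1 <= k)%nat /\ d <= 1 - 1 / INR k) N) as [k [[K1 K2] Kmin]].
  { split; [lia|]. unfold Rdiv. rewrite Rmult_1_l. lra. }
  assert (Hk : (3 <= k)%nat).
  { destruct (Nat.eq_dec k 1) as [->|]; [simpl in K2; lra|].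
    destruct (Nat.eq_dec k 2) as [->|]; [simpl in K2; lra|]. lia. }
  assert (HK := INR_ge_3 k Hk).
  assert (Hd1 : 1 - 1 / (INR k - 1) < d).
  { apply Rnot_le_lt. intros L. assert (k <= k - 1)%nat; [|lia]. apply Kmin. split; [lia|].
    rewrite minus_INR by lia. exact L. }
  (* [q] is [1 - INR k * z] for the root sought; [q < 1] expresses that [d] lies beyond the
     preceding arc. *)
  set (q := sqrt (INR k * (INR k - 1) * (1 - 1 / INR k - d))).
  assert (Hq0 : 0 <= q) by apply sqrt_pos.
  assert (Hqq : q * q = INR k * (INR k - 1) * (1 - 1 / INR k - d)).
  { apply sqrt_sqrt. apply Rmult_le_pos; [nra|lra]. }
  assert (Hq1 : q < 1).
  { apply Rnot_le_lt. intros L. assert (1 <= q * q) by nra. rewrite Hqq in *.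
    assert (INR k * (INR k - 1) * (1 - 1 / INR k - d) < INR k * (INR k - 1) * (1 / (INR k - 1) - 1 / INR k)).
    { apply Rmult_lt_compat_l; [nra|lra]. }
    replace (INR k * (INR k - 1) * (1 / (INR k - 1) - 1 / INR k)) with 1 in * by (field; lra). lra. }
  exists k, ((1 - q) / INR k). split; [assumption|]. split.
  - split; [apply Rdiv_lt_0_compat; lra|]. apply Rmult_le_compat_r; [left; apply Rinv_0_lt_compat; lra|lra].
  - assert (G := curve_d_gap k ((1 - q) / INR k) Hk).
    replace (INR k * ((1 - q) / INR k) - 1) with (- q) in G by (field; lra).
    replace ((- q) ^ 2) with (q * q) in G by ring. rewrite Hqq in G.
    replace (INR k * (INR k - 1) * (1 - 1 / INR k - d) / (INR k * (INR k - 1))) with (1 - 1 / INR k - d) in G by (field; lra).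
    lra.
Qed.

Lemma ivt_affine_sign (f : R -> R) a b : continuity f -> a <= b -> f a <= 0 -> 0 <= f b ->
  exists c, a <= c <= b /\ f c = 0.
Proof.
  intros Hf Hab Ha Hb. destruct (IVT_cor f a b Hf Hab) as [c Hc]; [nra|]. now exists c.
Qed.

(** The arcs join up: [k] equal parts are [k + 1] parts of which one is empty. *)
Lemma curve_t_end k : (3 <= k)%nat -> curve_t k (1 / INR k) = curve_t (S k) 0.
Proof.
  intros Hk. assert (HK := INR_ge_3 k Hk). unfold curve_t. rewrite S_INR. field. lra.
Qed.

Lemma curve_d_end k : (3 <= k)%nat -> curve_d k (1 / INR k) = curve_d (S k) 0.
Proof.
  intros Hk. assert (HK := INR_ge_3 k Hk). unfold curve_d. rewrite S_INR. field. lra.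
Qed.

Lemma continuity_curve_t k : continuity (curve_t k).
Proof. unfold curve_t, Rdiv. reg. Qed.

Lemma continuity_curve_d k : continuity (curve_d k).
Proof. unfold curve_d, Rdiv. reg. Qed.

Lemma curve_t_end_ge k : (3 <= k)%nat -> 1 - 3 / INR k <= curve_t k (1 / INR k).
Proof.
  intros Hk. assert (HK := INR_ge_3 k Hk).
  assert (E : curve_t k (1 / INR k) = 1 - 3 / INR k + 2 / (INR k) ^ 2) by (unfold curve_t; field; lra).
  assert (0 < 2 / INR k ^ 2) by (apply Rdiv_lt_0_compat; [lra|apply pow_lt; lra]). lra.
Qed.

(** Existence behind the [epsilon] of [gR_inv]. The least arc whose right end reaches [y] starts
    below [y], since arcs are joined end to end and the first starts at 0, and the intermediate
    value theorem applies on it. *)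
Lemma gR_surj y : 0 <= y <= 1 -> exists d, 1 / 2 <= d <= 1 /\ gR d = y.
Proof.
  intros Hy. destruct (Req_dec y 0) as [->|N0].
  { exists (1 / 2). split; [lra|]. unfold gR. destruct (Rle_dec (1 / 2) (1 / 2)); [reflexivity|lra]. }
  destruct (Req_dec y 1) as [->|N1].
  { exists 1. split; [lra|]. unfold gR. destruct (Rle_dec 1 (1 / 2)); [lra|].
    destruct (Req_EM_T 1 1); [reflexivity|lra]. }
  destruct (archimed_cor1 ((1 - y) / 3) ltac:(lra)) as [N [HN PN]].
  destruct (least_nat (fun k => (3 <= k)%nat /\ y <= curve_t k (1 / INR k)) (N + 3)) as [k [[Hk Hyk] Hmin]].
  { split; [lia|]. assert (H := curve_t_end_ge (N + 3) ltac:(lia)).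
    assert (/ INR (N + 3) <= / INR N) by (apply Rinv_le_contravar; [now apply lt_0_INR|apply le_INR; lia]).
    unfold Rdiv in *. lra. }
  assert (HK := INR_ge_3 k Hk).
  assert (H0 : curve_t k 0 < y).
  { destruct (Nat.eq_dec k 3) as [->|N3].
    - unfold curve_t. simpl INR. lra.
    - apply Rnot_le_lt. intros L. assert (k <= k - 1)%nat; [|lia]. apply Hmin. split; [lia|].
      rewrite curve_t_end by lia. replace (S (k - 1)) with k by lia. exact L. }
  destruct (ivt_affine_sign (fun z => curve_t k z - y) 0 (1 / INR k)) as [z [Hz Ez]].
  - apply (continuity_minus (curve_t k) (fun _ => y)); [apply continuity_curve_t|]. apply continuity_const. now intros ? ?.
  - left. apply Rdiv_lt_0_compat; lra.
  - lra.
  - lra.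
  - assert (Hz0 : 0 < z).
    { destruct (Req_dec z 0) as [->|]; [lra|lra]. }
    exists (curve_d k z). split.
    + assert (A := curve_d_gt k z Hk (conj Hz0 (proj2 Hz))). assert (B := curve_d_le k z Hk).
      assert (0 < 1 / INR k) by (apply Rdiv_lt_0_compat; lra).
      assert (1 / (INR k - 1) <= 1 / 2).
      { unfold Rdiv. rewrite !Rmult_1_l. apply Rinv_le_contravar; lra. }
      lra.
    + rewrite gR_curve by (auto; lra). lra.
Qed.

Lemma gR_inv_cases y : 0 <= y <= 1 ->
  (gR_inv y = 1 /\ y = 1) \/
  exists k z, (3 <= k)%nat /\ 0 <= z <= 1 / INR k /\ gR_inv y = curve_d k z /\ y = curve_t k z.
Proof.
  intros Hy. destruct (gR_surj y Hy) as [d0 Hd0].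
  unfold gR_inv. match goal with |- context [epsilon ?i ?P] => assert (HP := epsilon_spec i P) end.
  destruct HP as [Hd Hg]; [now exists d0|].
  match type of Hg with gR ?e = _ => set (d := e) in * end. clearbody d.
  destruct (Req_dec d 1) as [->|N1].
  - left. split; [reflexivity|]. rewrite <- Hg. unfold gR.
    destruct (Rle_dec 1 (1 / 2)); [lra|]. destruct (Req_EM_T 1 1); [reflexivity|lra].
  - right. destruct (Req_dec d (1 / 2)) as [->|N2].
    + exists 3%nat, 0. split; [lia|]. split; [simpl; lra|]. split; [unfold curve_d; simpl; lra|].
      rewrite <- Hg. unfold gR. destruct (Rle_dec (1 / 2) (1 / 2)); [|lra]. unfold curve_t. simpl. lra.
    + destruct (curve_d_surj d ltac:(lra)) as [k [z [Hk [Hz ->]]]].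
      exists k, z. split; [assumption|]. split; [lra|]. split; [reflexivity|].
      rewrite <- Hg. now apply gR_curve.
Qed.

(** The scallop is sharp on its own arc: the right-hand side is [P3] expressed through the triangle
    density [curve_t k z] and [P2 = 1 - curve_d k z]. *)
Lemma phi_curve k z : (3 <= k)%nat -> z <= 1 / INR k ->
  phi (INR k) (1 - curve_d k z) = (curve_t k z - 1 + 3 * (1 - curve_d k z)) / 2.
Proof.
  intros Hk Hz. assert (HK := INR_ge_3 k Hk). unfold phi.
  assert (EV : 1 - curve_d k z - 1 / INR k = (INR k * z - 1) ^ 2 / (INR k * (INR k - 1))).
  { rewrite <- curve_d_gap by assumption. ring. }
  set (r := sqrt (INR k * (INR k - 1))).
  assert (Hr : 0 < r) by (apply sqrt_lt_R0; nra).
  assert (Hrr : r * r = INR k * (INR k - 1)) by (apply sqrt_sqrt; nra).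
  assert (Hz2 : INR k * z <= 1).
  { replace 1 with (INR k * (1 / INR k)) by (field; lra). apply Rmult_le_compat_l; lra. }
  assert (Es : sqrt (1 - curve_d k z - 1 / INR k) = (1 - INR k * z) / r).
  { rewrite EV, <- Hrr. replace ((INR k * z - 1) ^ 2 / (r * r)) with (((1 - INR k * z) / r) * ((1 - INR k * z) / r)) by (field; lra).
    apply sqrt_square. apply Rmult_le_pos; [lra|left; now apply Rinv_0_lt_compat]. }
  rewrite Es, EV. unfold kap. fold r.
  replace ((INR k - 2) / r * ((INR k * z - 1) ^ 2 / (INR k * (INR k - 1)) * ((1 - INR k * z) / r)))
    with ((INR k - 2) * (INR k * z - 1) ^ 2 * (1 - INR k * z) / (INR k * (INR k - 1) * (r * r))) by (field; lra).
  rewrite Hrr. unfold curve_d, curve_t. field. lra.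
Qed.

(** To be compared with the slope 3/2 of [P3] as a function of [P2] at fixed triangle density. *)
Lemma phi_slope M p p' : 3 <= M -> p <= p' -> phi M p' - phi M p <= p' - p.
Proof.
  intros HM Hp. unfold phi. destruct (kap_bounds M HM) as [K0 K1].
  assert (Hmono : (p - 1 / M) * sqrt (p - 1 / M) <= (p' - 1 / M) * sqrt (p' - 1 / M)).
  { destruct (Rle_dec (p - 1 / M) 0) as [L|L].
    - rewrite (sqrt_neg_0 _ L). rewrite Rmult_0_r. destruct (Rle_dec (p' - 1 / M) 0) as [L'|L'].
      + rewrite (sqrt_neg_0 _ L'). lra.
      + apply Rmult_le_pos; [lra|apply sqrt_pos].
    - apply Rmult_le_compat; try lra; [apply sqrt_pos|]. apply sqrt_le_1; lra. }
  set (g := (p - 1 / M) * sqrt (p - 1 / M)) in *. set (g' := (p' - 1 / M) * sqrt (p' - 1 / M)) in *.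
  assert (kap M * g <= kap M * g') by (apply Rmult_le_compat_l; lra).
  assert (3 / M * (p' - p) <= 1 * (p' - p)).
  { apply Rmult_le_compat_r; [lra|]. apply Rmult_le_reg_r with M; [lra|].
    unfold Rdiv. rewrite Rmult_assoc, Rinv_l; lra. }
  lra.
Qed.

(** Only the arc through [gR_inv y] is used: the two sides agree at [D = gR_inv y], and for larger
    [D] the right-hand side falls faster than [phi]. *)
Lemma le_gR_inv y D : 0 <= y <= 1 -> D <= 1 ->
  (forall m, (3 <= m)%nat -> phi (INR m) (1 - D) <= (y - 1 + 3 * (1 - D)) / 2) ->
  D <= gR_inv y.
Proof.
  intros Hy HD Hphi. destruct (gR_inv_cases y Hy) as [[-> _]|[k [z [Hk [Hz [-> Ey]]]]]]; [assumption|].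
  apply Rnot_lt_le. intros L.
  assert (E := phi_curve k z Hk (proj2 Hz)). assert (G := Hphi k Hk).
  assert (S := phi_slope (INR k) (1 - D) (1 - curve_d k z) (INR_ge_3 k Hk) ltac:(lra)).
  rewrite <- Ey in E. lra.
Qed.

(** * Triple counts *)

Definition trisum (n : nat) (g : nat -> nat -> nat -> R) : R :=
  sum n (fun k => sum k (fun j => sum j (fun i => g i j k))).

Lemma sum_count_map {A} (q : A -> bool) (g : nat -> A) n :
  INR (length (filter q (map g (seq 0 n)))) = sum n (fun i => if q (g i) then 1 else 0).
Proof.
  induction n as [|n IH]; [reflexivity|].
  rewrite seq_S, map_app, filter_app, length_app, plus_INR, IH. cbn [sum map].
  rewrite Nat.add_0_l. simpl. destruct (q (g n)); simpl; ring.
Qed.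

Lemma sum_count_flat_map {A} (q : A -> bool) (F : nat -> list A) n :
  INR (length (filter q (flat_map F (seq 0 n)))) = sum n (fun i => INR (length (filter q (F i)))).
Proof.
  induction n as [|n IH]; [reflexivity|].
  rewrite seq_S, flat_map_app, filter_app, length_app, plus_INR, IH. cbn [sum flat_map].
  rewrite Nat.add_0_l, app_nil_r. reflexivity.
Qed.

Lemma trisum_count (q : nat * nat * nat -> bool) n :
  INR (length (filter q (triples n))) = trisum n (fun i j k => if q (i, j, k) then 1 else 0).
Proof.
  unfold triples, trisum. rewrite sum_count_flat_map. apply sum_ext. intros k _.
  rewrite sum_count_flat_map. apply sum_ext. intros j _. apply (sum_count_map q (fun i => (i, j, k))).
Qed.

Lemma trisum_ext n g h : (forall i j k, (i < j)%nat -> (j < k)%nat -> (k < n)%nat -> g i j k = h i j k) ->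
  trisum n g = trisum n h.
Proof.
  intros H. unfold trisum. apply sum_ext. intros k Hk. apply sum_ext. intros j Hj.
  apply sum_ext. intros i Hi. now apply H.
Qed.

Lemma trisum_plus n g h : trisum n (fun i j k => g i j k + h i j k) = trisum n g + trisum n h.
Proof.
  unfold trisum. rewrite <- sum_plus. apply sum_ext. intros k _.
  rewrite <- sum_plus. apply sum_ext. intros j _. apply sum_plus.
Qed.

Lemma trisum_scal n c g : trisum n (fun i j k => c * g i j k) = c * trisum n g.
Proof.
  unfold trisum. rewrite <- sum_scal. apply sum_ext. intros k _.
  rewrite <- sum_scal. apply sum_ext. intros j _. apply sum_scal.
Qed.

Lemma sum2_split n (h : nat -> nat -> R) :
  sum n (fun i => sum n (fun j => h i j)) =
  sum n (fun j => sum j (fun i => h i j + h j i)) + sum n (fun i => h i i).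
Proof.
  induction n as [|n IH]; cbn [sum]; [ring|].
  rewrite sum_plus, IH, sum_plus. change (sum n (h n)) with (sum n (fun j => h n j)). ring.
Qed.

Definition sym3 (f : nat -> nat -> nat -> R) i j k :=
  f i j k + f i k j + f j i k + f j k i + f k i j + f k j i.
Definition pair3 (f : nat -> nat -> nat -> R) j k :=
  f j j k + f j k j + f k j j + f k k j + f k j k + f j k k.

(** An index triple takes three, two or one distinct values. The induction step collects the terms
    in which the new index occurs once, twice or three times. *)
Lemma sum3_split n (f : nat -> nat -> nat -> R) :
  sum n (fun i => sum n (fun j => sum n (fun k => f i j k))) =
  trisum n (sym3 f) + sum n (fun k => sum k (fun j => pair3 f j k)) + sum n (fun i => f i i i).
Proof.
  induction n as [|n IH]; [unfold trisum; simpl; ring|].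
  assert (E : sum (S n) (fun i => sum (S n) (fun j => sum (S n) (fun k => f i j k))) =
    sum n (fun i => sum n (fun j => sum n (fun k => f i j k)))
    + sum n (fun i => sum n (fun j => f i j n + f i n j + f n i j))
    + sum n (fun i => f i n n + f n i n + f n n i) + f n n n).
  { cbn [sum]. rewrite !sum_plus.
    rewrite (sum_ext n (fun i => sum n (fun j => sum n (fun k => f i j k) + f i j n))
      (fun i => sum n (fun j => sum n (fun k => f i j k)) + sum n (fun j => f i j n)))
      by (intros; apply sum_plus).
    rewrite (sum_ext n (fun i => sum n (fun j => f i j n + f i n j + f n i j))
      (fun i => sum n (fun j => f i j n) + sum n (fun j => f i n j) + sum n (fun j => f n i j)))
      by (intros; rewrite !sum_plus; reflexivity).
    rewrite !sum_plus. change (sum n (f n n)) with (sum n (fun k => f n n k)). ring. }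
  rewrite E, IH, (sum2_split n (fun i j => f i j n + f i n j + f n i j)).
  unfold trisum. cbn [sum].
  rewrite (sum_ext n (fun j => sum j (fun i => f i j n + f i n j + f n i j + (f j i n + f j n i + f n j i)))
    (fun j => sum j (fun i => sym3 f i j n))).
  2:{ intros j _. apply sum_ext. intros i _. unfold sym3. ring. }
  rewrite (sum_ext n (fun j => pair3 f j n) (fun i => (f i i n + f i n i + f n i i) + (f i n n + f n i n + f n n i))).
  2:{ intros i _. unfold pair3. ring. }
  rewrite (sum_plus n (fun i => f i i n + f i n i + f n i i) (fun i => f i n n + f n i n + f n n i)). ring.
Qed.

Section Counts.
Variable G : graph.
Let n := nv G.
Hypothesis Hn : (3 <= n)%nat.

Definition adjR i j : R := if adj G i j then 1 else 0.

Definition hom_path := sum n (fun i => sum n (fun j => sum n (fun k => adjR i j * adjR i k))).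
Definition hom_tri := sum n (fun i => sum n (fun j => sum n (fun k => adjR i j * adjR i k * adjR j k))).
Definition hom_edge := sum n (fun i => sum n (fun j => adjR i j)).

Let cnt m := INR (ind_count G m).
Let N := INR (length (triples n)).

Lemma adjR_sym i j : adjR i j = adjR j i.
Proof. unfold adjR. now rewrite adj_sym. Qed.
Lemma adjR_irr i : adjR i i = 0.
Proof. unfold adjR. now rewrite adj_irr. Qed.
Lemma adjR_01 i j : adjR i j = 0 \/ adjR i j = 1.
Proof. unfold adjR. destruct (adj G i j); auto. Qed.

Lemma cnt_trisum m : cnt m = trisum n (fun i j k => if Nat.eqb (edges3 G i j k) m then 1 else 0).
Proof. unfold cnt, ind_count. apply trisum_count. Qed.

Lemma N_trisum : N = trisum n (fun _ _ _ => 1).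
Proof.
  assert (E := trisum_count (fun _ => true) n). cbv beta iota in E.
  rewrite <- E. unfold N. clear E. do 2 f_equal. generalize (triples n) as l.
  induction l as [|a l IH]; simpl; [reflexivity|]. now f_equal.
Qed.

Lemma edge_pairs : hom_edge = sum n (fun k => sum k (fun j => 2 * adjR j k)).
Proof.
  unfold hom_edge. rewrite sum2_split.
  rewrite (sum_0 n (fun i => adjR i i)) by (intros; apply adjR_irr). rewrite Rplus_0_r.
  apply sum_ext. intros j _. apply sum_ext. intros i _. rewrite (adjR_sym j i). ring.
Qed.

(** Compares both sides on the eight labelled graphs with three vertices. *)
Ltac count_cases := unfold adjR, edges3;
  repeat match goal with |- context [adj G ?a ?b] => destruct (adj G a b) end; simpl; ring.

Lemma hom_tri_eq : hom_tri = 6 * cnt 3.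
Proof.
  unfold hom_tri. rewrite (sum3_split n (fun i j k => adjR i j * adjR i k * adjR j k)).
  rewrite (sum_0 n (fun i => adjR i i * adjR i i * adjR i i)) by (intros; rewrite adjR_irr; ring).
  rewrite (sum_0 n (fun k => sum k _)).
  2:{ intros k _. apply sum_0. intros j _. unfold pair3. rewrite !adjR_irr. ring. }
  rewrite cnt_trisum, <- trisum_scal, !Rplus_0_r. apply trisum_ext. intros i j k _ _ _. unfold sym3.
  rewrite (adjR_sym j i), (adjR_sym k i), (adjR_sym k j). count_cases.
Qed.

(** A cherry carries two maps of the path, a triangle six, and a map identifying the two ends is an
    ordered edge. *)
Lemma hom_path_eq : hom_path = 2 * cnt 2 + 6 * cnt 3 + hom_edge.
Proof.
  unfold hom_path. rewrite (sum3_split n (fun i j k => adjR i j * adjR i k)).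
  rewrite (sum_0 n (fun i => adjR i i * adjR i i)) by (intros; rewrite adjR_irr; ring).
  rewrite edge_pairs, !cnt_trisum, <- !trisum_scal, <- trisum_plus, Rplus_0_r. f_equal.
  - apply trisum_ext. intros i j k _ _ _. unfold sym3.
    rewrite (adjR_sym j i), (adjR_sym k i), (adjR_sym k j). count_cases.
  - apply sum_ext. intros k _. apply sum_ext. intros j _. unfold pair3. rewrite !adjR_irr, (adjR_sym k j).
    destruct (adjR_01 j k) as [-> | ->]; ring.
Qed.

(** Counts an ordered edge together with any vertex, which coincides with an end in exactly two
    cases. *)
Lemma hom_edge_eq : INR n * hom_edge = 2 * (cnt 1 + 2 * cnt 2 + 3 * cnt 3) + 2 * hom_edge.
Proof.
  assert (E : INR n * hom_edge = sum n (fun i => sum n (fun j => sum n (fun k => adjR i j)))).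
  { unfold hom_edge. rewrite <- sum_scal. apply sum_ext. intros i _. rewrite <- sum_scal.
    apply sum_ext. intros j _. now rewrite sum_const. }
  rewrite E, (sum3_split n (fun i j k => adjR i j)).
  rewrite (sum_0 n (fun i => adjR i i)) by (intros; apply adjR_irr).
  rewrite Rplus_0_r. f_equal.
  - rewrite !cnt_trisum, <- !trisum_scal, <- !trisum_plus, <- trisum_scal.
    apply trisum_ext. intros i j k _ _ _. unfold sym3.
    rewrite (adjR_sym j i), (adjR_sym k i), (adjR_sym k j). count_cases.
  - rewrite edge_pairs, <- sum_scal. apply sum_ext. intros k _. rewrite <- sum_scal.
    apply sum_ext. intros j _. unfold pair3. rewrite !adjR_irr, (adjR_sym k j). ring.
Qed.

Lemma cnt_total : cnt 0 + cnt 1 + cnt 2 + cnt 3 = N.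
Proof.
  rewrite !cnt_trisum, <- !trisum_plus, N_trisum. apply trisum_ext. intros i j k _ _ _. count_cases.
Qed.

Lemma N_eq : 6 * N = INR n * (INR n - 1) * (INR n - 2).
Proof.
  assert (E := sum3_split n (fun _ _ _ => 1)). cbv beta in E.
  rewrite (sum_ext n (fun i => sum n (fun j => sum n (fun k => 1))) (fun _ => INR n * INR n)) in E.
  2:{ intros. rewrite (sum_ext n _ (fun _ => INR n)) by (intros; rewrite sum_const; ring). apply sum_const. }
  rewrite !sum_const in E.
  rewrite (trisum_ext n (sym3 (fun _ _ _ => 1)) (fun _ _ _ => 6 * 1)) in E by (intros; unfold sym3; ring).
  rewrite trisum_scal, <- N_trisum in E.
  assert (E2 := sum2_split n (fun _ _ => 1)). cbv beta in E2.
  rewrite (sum_ext n (fun i => sum n (fun j => 1)) (fun _ => INR n)) in E2 by (intros; rewrite sum_const; ring).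
  rewrite !sum_const in E2.
  rewrite (sum_ext n (fun k => sum k (fun j => pair3 (fun _ _ _ => 1) j k)) (fun k => 3 * sum k (fun _ => 1 + 1))) in E.
  2:{ intros k _. rewrite <- sum_scal. apply sum_ext. intros. unfold pair3. ring. }
  rewrite sum_scal in E. nra.
Qed.

Let x3 := INR_ge_3 n Hn.

Lemma N_pos : 0 < N.
Proof. assert (E := N_eq). assert (0 < INR n * (INR n - 1) * (INR n - 2)); [|lra].
  apply Rmult_lt_0_compat; [apply Rmult_lt_0_compat|]; lra. Qed.

Lemma cnt_nonneg m : 0 <= cnt m.
Proof. apply pos_INR. Qed.

Lemma dens_cnt m : dens G m * N = cnt m.
Proof. unfold dens, cnt. fold n N. field. apply Rgt_not_eq, N_pos. Qed.

Lemma dens_nonneg m : 0 <= dens G m.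
Proof.
  apply Rmult_le_reg_r with N; [apply N_pos|]. rewrite dens_cnt, Rmult_0_l. apply cnt_nonneg.
Qed.

Lemma dens_total : dens G 0 + dens G 1 + dens G 2 + dens G 3 = 1.
Proof.
  apply Rmult_eq_reg_r with N; [|apply Rgt_not_eq, N_pos].
  rewrite !Rmult_plus_distr_r, !dens_cnt, cnt_total. ring.
Qed.

(** [6 N / n ^ 3 = 1 - 3 / n + 2 / n ^ 2] is the share of injective maps among all maps of three
    points. *)
Lemma scale_error a v : 0 <= a -> 6 * N / INR n ^ 3 * a = v -> Rabs (v - a) <= 3 * a / INR n.
Proof.
  intros Ha <-. rewrite N_eq.
  replace (INR n * (INR n - 1) * (INR n - 2) / INR n ^ 3 * a - a)
    with (- (a * (3 - 2 / INR n) / INR n)) by (field; lra).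
  rewrite Rabs_Ropp. assert (0 < 2 / INR n) by (apply Rdiv_lt_0_compat; lra).
  assert (2 / INR n <= 1).
  { apply Rmult_le_reg_r with (INR n); [lra|]. unfold Rdiv. rewrite Rmult_assoc, Rinv_l; lra. }
  assert (Hi : 0 < / INR n) by (apply Rinv_0_lt_compat; lra).
  rewrite Rabs_right.
  - unfold Rdiv. apply Rmult_le_compat_r; [lra|]. unfold Rdiv in *. nra.
  - apply Rle_ge. unfold Rdiv. apply Rmult_le_pos; [|lra]. apply Rmult_le_pos; [lra|]. unfold Rdiv in *. lra.
Qed.

Lemma hom_edge_bounds : 0 <= hom_edge <= INR n ^ 2.
Proof.
  split.
  - unfold hom_edge. apply sum_nonneg; intros. apply sum_nonneg; intros.
    destruct (adjR_01 i i0) as [-> | ->]; lra.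
  - replace (INR n ^ 2) with (sum n (fun _ => sum n (fun _ => 1))).
    + apply sum_le; intros. apply sum_le; intros. destruct (adjR_01 i i0) as [-> | ->]; lra.
    + rewrite (sum_ext n _ (fun _ => INR n)) by (intros; rewrite sum_const; ring).
      rewrite sum_const. ring.
Qed.

Let S0 := hom_path / INR n ^ 3.
Let T0 := hom_tri / INR n ^ 3.
Let E0 := hom_edge / INR n ^ 2.

Lemma E0_bounds : 0 <= E0 <= 1.
Proof.
  destruct hom_edge_bounds as [A B]. assert (0 < INR n ^ 2) by (apply pow_lt; lra).
  unfold E0. split.
  - apply Rmult_le_pos; [assumption|]. left. now apply Rinv_0_lt_compat.
  - apply Rmult_le_reg_r with (INR n ^ 2); [assumption|]. unfold Rdiv. rewrite Rmult_assoc, Rinv_l; lra.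
Qed.

Lemma inv_scale c v : 0 <= v <= c -> v / INR n <= c / INR n.
Proof. intros H. apply Rmult_le_compat_r; [left; apply Rinv_0_lt_compat; lra|lra]. Qed.

Lemma dens3_error : Rabs (T0 - dens G 3) <= 3 / INR n.
Proof.
  eapply Rle_trans; [apply scale_error; [apply dens_nonneg|]|].
  - transitivity (6 * (dens G 3 * N) / INR n ^ 3); [field; lra|].
    rewrite dens_cnt. unfold T0. now rewrite hom_tri_eq.
  - apply inv_scale. generalize (dens_nonneg 0) (dens_nonneg 1) (dens_nonneg 2) (dens_nonneg 3) dens_total. lra.
Qed.

(** Besides the scaling, paths with identified ends contribute [3 E0 / n]; each of the two effects
    is at most [3 / n]. *)
Lemma dens2_error : Rabs (3 * (S0 - T0) - dens G 2) <= 6 / INR n.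
Proof.
  assert (H : Rabs ((3 * (S0 - T0) - 3 * E0 / INR n) - dens G 2) <= 3 * dens G 2 / INR n).
  { apply scale_error; [apply dens_nonneg|].
    transitivity (6 * (dens G 2 * N) / INR n ^ 3); [field; lra|].
    rewrite dens_cnt. unfold S0, T0, E0. rewrite hom_path_eq, hom_tri_eq. field. lra. }
  assert (H2 : 3 * dens G 2 / INR n <= 3 / INR n).
  { apply inv_scale. generalize (dens_nonneg 0) (dens_nonneg 1) (dens_nonneg 2) (dens_nonneg 3) dens_total. lra. }
  assert (B := E0_bounds).
  assert (H3 : 0 <= 3 * E0 / INR n <= 3 / INR n).
  { split; [|apply inv_scale; lra]. apply Rmult_le_pos; [lra|left; apply Rinv_0_lt_compat; lra]. }
  replace (6 / INR n) with (3 / INR n + 3 / INR n) by (field; lra).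
  apply Rabs_le.
  assert (H' : - (3 * dens G 2 / INR n) <= 3 * (S0 - T0) - 3 * E0 / INR n - dens G 2 <= 3 * dens G 2 / INR n).
  { unfold Rabs in H. destruct (Rcase_abs (3 * (S0 - T0) - 3 * E0 / INR n - dens G 2)) in H; lra. }
  lra.
Qed.

Lemma dens1_error : Rabs (3 * E0 - (dens G 1 + 2 * dens G 2 + 3 * dens G 3)) <= 15 / INR n.
Proof.
  set (a := dens G 1 + 2 * dens G 2 + 3 * dens G 3).
  assert (Ha : 0 <= a <= 3).
  { unfold a. generalize (dens_nonneg 0) (dens_nonneg 1) (dens_nonneg 2) (dens_nonneg 3) dens_total. lra. }
  assert (H : Rabs ((3 * E0 - 6 * E0 / INR n) - a) <= 3 * a / INR n).
  { apply scale_error; [lra|].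
    transitivity (6 * (dens G 1 * N + 2 * (dens G 2 * N) + 3 * (dens G 3 * N)) / INR n ^ 3);
      [unfold a; field; lra|].
    rewrite !dens_cnt.
    replace (6 * (cnt 1 + 2 * cnt 2 + 3 * cnt 3)) with (3 * (INR n * hom_edge - 2 * hom_edge))
      by (rewrite hom_edge_eq; ring).
    unfold E0. field. lra. }
  assert (H2 : 3 * a / INR n <= 9 / INR n) by (apply inv_scale; lra).
  assert (B := E0_bounds).
  assert (H3 : 0 <= 6 * E0 / INR n <= 6 / INR n).
  { split; [|apply inv_scale; lra]. apply Rmult_le_pos; [lra|left; apply Rinv_0_lt_compat; lra]. }
  replace (15 / INR n) with (9 / INR n + 6 / INR n) by (field; lra).
  apply Rabs_le.
  assert (H' : - (3 * a / INR n) <= 3 * E0 - 6 * E0 / INR n - a <= 3 * a / INR n).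
  { unfold Rabs in H. destruct (Rcase_abs (3 * E0 - 6 * E0 / INR n - a)) in H; lra. }
  lra.
Qed.

Definition uweight (i : nat) : R := if le_lt_dec n i then 0 else / INR n.
Definition uadj (i j : nat) : R := adjR i j.

Lemma uniform_wgraph : wgraph n uadj uweight.
Proof.
  assert (Hi : 0 < / INR n) by (apply Rinv_0_lt_compat; lra).
  split.
  - intros i. unfold uweight. destruct (le_lt_dec n i); lra.
  - intros i L. unfold uweight. destruct (le_lt_dec n i); [reflexivity|lia].
  - rewrite (sum_ext n uweight (fun _ => / INR n)).
    + rewrite sum_const. field. lra.
    + intros i L. unfold uweight. destruct (le_lt_dec n i); [lia|reflexivity].
  - intros i j. unfold uadj. destruct (adjR_01 i j) as [-> | ->]; lra.
  - intros. apply adjR_sym.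
  - intros. apply adjR_irr.
Qed.

Lemma sum_uweight f : sum n (fun i => uweight i * f i) = / INR n * sum n f.
Proof.
  rewrite <- sum_scal. apply sum_ext. intros i L. unfold uweight.
  destruct (le_lt_dec n i); [lia|reflexivity].
Qed.

Lemma uniform_paths : paths n uadj uweight = S0.
Proof.
  unfold paths, deg, S0, hom_path, uadj.
  rewrite (sum_uweight (fun i => sum n (fun k => uweight k * adjR i k) ^ 2)).
  rewrite (sum_ext n _ (fun i => (/ INR n) ^ 2 * sum n (fun j => sum n (fun k => adjR i j * adjR i k)))).
  - rewrite sum_scal. field. lra.
  - intros i _. rewrite sum_uweight.
    rewrite (sum_ext n (fun j => sum n (fun k => adjR i j * adjR i k)) (fun j => adjR i j * sum n (fun k => adjR i k)))
      by (intros; apply sum_scal).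
    rewrite (sum_scal_r n (sum n (fun k => adjR i k)) (fun j => adjR i j)).
    change (fun k => adjR i k) with (adjR i). ring.
Qed.

Lemma uniform_tris : tris n uadj uweight = T0.
Proof.
  unfold tris, tri_at, codeg, T0, hom_tri, uadj.
  rewrite (sum_uweight (fun i => sum n (fun j => uweight j * (adjR i j * sum n (fun k => uweight k * (adjR i k * adjR j k)))))).
  rewrite (sum_ext n _ (fun i => (/ INR n) ^ 2 * sum n (fun j => sum n (fun k => adjR i j * adjR i k * adjR j k)))).
  - rewrite sum_scal. field. lra.
  - intros i _. rewrite (sum_uweight (fun j => adjR i j * sum n (fun k => uweight k * (adjR i k * adjR j k)))).
    rewrite (sum_ext n _ (fun j => / INR n * sum n (fun k => adjR i j * adjR i k * adjR j k))).
    + rewrite sum_scal. ring.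
    + intros j _. rewrite (sum_uweight (fun k => adjR i k * adjR j k)).
      rewrite (sum_ext n (fun k => adjR i j * adjR i k * adjR j k) (fun k => adjR i j * (adjR i k * adjR j k))) by (intros; ring).
      rewrite sum_scal. ring.
Qed.

Lemma graph_phi_bound m : (3 <= m)%nat ->
  phi (INR m) (1 - 2 * S0 + T0) <= 1 - 3 * S0 + 2 * T0.
Proof.
  intros Hm. rewrite <- uniform_paths, <- uniform_tris. apply phi_bound; [assumption|apply uniform_wgraph].
Qed.

End Counts.

(** * Limits of graph densities stay below the curve *)

Lemma cv_of_error (u : nat -> R) l C : (forall k, Rabs (u k - l) <= C / INR (S k)) -> Un_cv u l.
Proof.
  intros H eps He. set (C' := Rmax C 1). assert (HC : 0 < C') by (unfold C'; generalize (Rmax_r C 1); lra).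
  destruct (archimed_cor1 (eps / C') ltac:(now apply Rdiv_lt_0_compat)) as [N [HN PN]].
  exists N. intros k Hk. unfold Rdist. eapply Rle_lt_trans; [apply H|].
  assert (Hp : 0 < / INR (S k)) by (apply Rinv_0_lt_compat, lt_0_INR; lia).
  assert (/ INR (S k) <= / INR N) by (apply Rinv_le_contravar; [now apply lt_0_INR|apply le_INR; lia]).
  apply Rle_lt_trans with (C' * / INR (S k)).
  - apply Rmult_le_compat_r; [lra|apply Rmax_l].
  - apply Rmult_lt_reg_l with (/ C'); [now apply Rinv_0_lt_compat|].
    rewrite <- Rmult_assoc, Rinv_l, Rmult_1_l by lra. unfold Rdiv in HN. lra.
Qed.

(** The inequality is exact for homomorphism densities, which differ from the induced ones by order
    [1 / n]; continuity of [phi] carries it to the limit, and only there is it converted into a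
    bound by [gR_inv]. *)
Lemma in_S23_upper d2 d3 : in_S23 d2 d3 ->
  0 <= d2 /\ 0 <= d3 /\ d3 <= 1 /\ d2 <= 3 / 2 * (gR_inv d3 - d3).
Proof.
  intros [d0 [d1 HS]].
  (* At least three vertices, so that the densities have a nonzero denominator. *)
  assert (Hch : forall k : nat, exists G : graph, (k + 3 <= nv G)%nat /\
     Rabs (dens G 2 - d2) <= / INR (S k) /\ Rabs (dens G 3 - d3) <= / INR (S k)).
  { intros k. destruct (HS (/ INR (S k)) ltac:(apply Rinv_0_lt_compat, lt_0_INR; lia) (k + 3)%nat) as [G HG].
    exists G. tauto. }
  set (G k := proj1_sig (constructive_indefinite_description _ (Hch k))).
  assert (HG : forall k, (k + 3 <= nv (G k))%nat /\
     Rabs (dens (G k) 2 - d2) <= / INR (S k) /\ Rabs (dens (G k) 3 - d3) <= / INR (S k)).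
  { intros k. unfold G. now destruct (constructive_indefinite_description _ (Hch k)). }
  assert (Hn : forall k, (3 <= nv (G k))%nat) by (intros k; destruct (HG k); lia).
  assert (Hinv : forall k c, 0 <= c -> c / INR (nv (G k)) <= c / INR (S k)).
  { intros k c Hc. apply Rmult_le_compat_l; [assumption|]. apply Rinv_le_contravar; [apply lt_0_INR; lia|].
    apply le_INR. destruct (HG k). lia. }
  assert (C2 : Un_cv (fun k => dens (G k) 2) d2).
  { apply (cv_of_error _ _ 1). intros k. destruct (HG k) as [_ [H _]]. unfold Rdiv. now rewrite Rmult_1_l. }
  assert (C3 : Un_cv (fun k => dens (G k) 3) d3).
  { apply (cv_of_error _ _ 1). intros k. destruct (HG k) as [_ [_ H]]. unfold Rdiv. now rewrite Rmult_1_l. }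
  assert (Hsum : forall k, dens (G k) 2 + dens (G k) 3 <= 1).
  { intros k. generalize (dens_total (G k) (Hn k)) (dens_nonneg (G k) (Hn k) 0) (dens_nonneg (G k) (Hn k) 1). lra. }
  assert (P2 : 0 <= d2) by (apply (cv_ge _ _ _ C2); intros; now apply dens_nonneg).
  assert (P3 : 0 <= d3) by (apply (cv_ge _ _ _ C3); intros; now apply dens_nonneg).
  assert (P23 : d2 + d3 <= 1) by (apply (cv_le _ _ _ (CV_plus _ _ _ _ C2 C3)); exact Hsum).
  split; [assumption|]. split; [assumption|]. split; [lra|].
  assert (HD : 2 / 3 * d2 + d3 <= gR_inv d3); [|lra].
  apply le_gR_inv; [lra|lra|]. intros m Hm.
  set (T k := hom_tri (G k) / INR (nv (G k)) ^ 3). set (S k := hom_path (G k) / INR (nv (G k)) ^ 3).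
  assert (CT : Un_cv T d3).
  { replace d3 with (d3 + 0) by ring.
    apply (Un_cv_ext (fun k => dens (G k) 3 + (T k - dens (G k) 3))); [intros; ring|].
    apply (CV_plus (fun k => dens (G k) 3)); [assumption|].
    apply (cv_of_error _ _ 3). intros k. rewrite Rminus_0_r.
    eapply Rle_trans; [apply (dens3_error (G k) (Hn k))|]. apply Hinv. lra. }
  assert (CST : Un_cv (fun k => 3 * (S k - T k)) d2).
  { replace d2 with (d2 + 0) by ring.
    apply (Un_cv_ext (fun k => dens (G k) 2 + (3 * (S k - T k) - dens (G k) 2))); [intros; ring|].
    apply (CV_plus (fun k => dens (G k) 2)); [assumption|].
    apply (cv_of_error _ _ 6). intros k. rewrite Rminus_0_r.
    eapply Rle_trans; [apply (dens2_error (G k) (Hn k))|]. apply Hinv. lra. }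
  assert (CD : Un_cv (fun k => 1 - 2 * S k + T k) (1 - (2 / 3 * d2 + d3))).
  { apply (Un_cv_ext (fun k => 1 - (2 / 3 * (3 * (S k - T k)) + T k))); [intros; field|].
    apply (CV_minus (fun _ => 1)); [apply cv_const|]. apply (CV_plus _ T); [now apply cv_scal|assumption]. }
  assert (Hk : forall k, phi (INR m) (1 - 2 * S k + T k) - (T k - 1 + 3 * (1 - 2 * S k + T k)) / 2 <= 0).
  { intros k. assert (H := graph_phi_bound (G k) (Hn k) m Hm). fold (S k) (T k) in H. lra. }
  assert (CF : Un_cv (fun k => phi (INR m) (1 - 2 * S k + T k) - (T k - 1 + 3 * (1 - 2 * S k + T k)) / 2)
     (phi (INR m) (1 - (2 / 3 * d2 + d3)) - (d3 - 1 + 3 * (1 - (2 / 3 * d2 + d3))) / 2)).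
  { apply (CV_minus (fun k => phi (INR m) (1 - 2 * S k + T k))); [now apply cv_phi|].
    apply (CV_mult _ (fun _ => / 2)); [|apply cv_const].
    apply (CV_plus (fun k => T k - 1)); [|now apply cv_scal].
    apply (CV_minus T); [assumption|apply cv_const]. }
  assert (F := cv_le _ _ _ CF Hk). lra.
Qed.

(** * Multipartite graphs with isolated vertices *)

(** The vertices from [L] on are isolated. *)
Definition mp_adj (L : nat) (part : nat -> nat) (i j : nat) : bool :=
  (i <? L)%nat && (j <? L)%nat && negb (part i =? part j)%nat.

Lemma mp_adj_sym L part i j : mp_adj L part i j = mp_adj L part j i.
Proof. unfold mp_adj. now rewrite (andb_comm (i <? L)%nat), Nat.eqb_sym. Qed.

Lemma mp_adj_irr L part i : mp_adj L part i i = false.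
Proof. unfold mp_adj. rewrite Nat.eqb_refl. apply andb_false_r. Qed.

Definition multipartite (n L : nat) (part : nat -> nat) : graph :=
  Graph n (mp_adj L part) (mp_adj_sym L part) (mp_adj_irr L part).

Definition same (part : nat -> nat) i j : R := if (part i =? part j)%nat then 1 else 0.

Lemma sum_trunc n L f : (L <= n)%nat -> (forall i, (L <= i)%nat -> f i = 0) -> sum n f = sum L f.
Proof.
  intros H Hf. induction H as [|n H IH]; [reflexivity|]. cbn [sum]. rewrite IH, Hf by assumption. ring.
Qed.

Lemma sum_add n m f : sum (n + m) f = sum n f + sum m (fun i => f (n + i)%nat).
Proof.
  induction m as [|m IH]; [rewrite Nat.add_0_r; simpl; ring|].
  rewrite Nat.add_succ_r. cbn [sum]. rewrite IH. ring.
Qed.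

Section Multipartite.
Variables (n L : nat) (part : nat -> nat).
Hypothesis HL : (L <= n)%nat.

Let G := multipartite n L part.
Definition part_size i := sum L (same part i).
(** The sum runs over vertices, so a part of size [s] contributes [s ^ (r + 1)]. *)
Definition part_sum (r : nat) := sum L (fun i => part_size i ^ r).

Lemma mp_in i j : (i < L)%nat -> (j < L)%nat -> adjR G i j = 1 - same part i j.
Proof.
  intros Hi Hj. unfold adjR, G, same. cbn. unfold mp_adj.
  apply Nat.ltb_lt in Hi as ->. apply Nat.ltb_lt in Hj as ->. simpl.
  destruct (part i =? part j)%nat; simpl; ring.
Qed.

Lemma mp_out_l i j : (L <= i)%nat -> adjR G i j = 0.
Proof. intros Hi. unfold adjR, G. cbn. unfold mp_adj. now apply Nat.ltb_ge in Hi as ->. Qed.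

Lemma mp_out_r i j : (L <= j)%nat -> adjR G i j = 0.
Proof. intros Hj. unfold adjR, G. cbn. rewrite mp_adj_sym. unfold mp_adj. now apply Nat.ltb_ge in Hj as ->. Qed.

Lemma mp_row i : (i < L)%nat -> sum n (adjR G i) = INR L - part_size i.
Proof.
  intros Hi. rewrite (sum_trunc n L) by (auto using mp_out_r).
  rewrite (sum_ext L _ (fun j => 1 - same part i j)) by (intros; now apply mp_in).
  rewrite sum_minus, sum_const. unfold part_size. change (fun i0 => same part i i0) with (same part i). ring.
Qed.

Lemma part_sum_1 : sum L part_size = part_sum 1.
Proof. unfold part_sum. apply sum_ext. intros. ring. Qed.

Lemma mp_hom_edge : hom_edge G = INR L ^ 2 - part_sum 1.
Proof.
  unfold hom_edge. change (nv G) with n.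
  rewrite (sum_trunc n L); [|assumption|intros; apply sum_0; intros; now apply mp_out_l].
  rewrite (sum_ext L _ (fun i => INR L - part_size i)) by (intros; now apply mp_row).
  rewrite sum_minus, sum_const, <- part_sum_1. change (fun i => part_size i) with part_size. ring.
Qed.

Lemma mp_hom_path : hom_path G = INR L ^ 3 - 2 * INR L * part_sum 1 + part_sum 2.
Proof.
  unfold hom_path. change (nv G) with n.
  rewrite (sum_trunc n L).
  2: assumption.
  2:{ intros i Hi. apply sum_0; intros. apply sum_0; intros. rewrite mp_out_l by assumption. ring. }
  rewrite (sum_ext L _ (fun i => INR L ^ 2 - 2 * INR L * part_size i + part_size i ^ 2)).
  - rewrite sum_plus, sum_minus, sum_scal, sum_const.
    change (fun i => part_size i) with part_size. rewrite part_sum_1.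
    change (sum L (fun i => part_size i ^ 2)) with (part_sum 2). ring.
  - intros i Hi.
    rewrite (sum_ext n _ (fun j => adjR G i j * sum n (adjR G i))).
    + rewrite (sum_scal_r n _ (fun j => adjR G i j)). change (fun j => adjR G i j) with (adjR G i).
      rewrite mp_row by assumption. ring.
    + intros j _. apply (sum_scal n (adjR G i j) (adjR G i)).
Qed.

Lemma mp_hom_tri : hom_tri G = INR L ^ 3 - 3 * INR L * part_sum 1 + 2 * part_sum 2.
Proof.
  unfold hom_tri. change (nv G) with n.
  rewrite (sum_trunc n L).
  2: assumption.
  2:{ intros i Hi. apply sum_0; intros. apply sum_0; intros. rewrite mp_out_l by assumption. ring. }
  assert (Ssym : forall i j, same part i j = same part j i) by (intros; unfold same; now rewrite Nat.eqb_sym).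
  rewrite (sum_ext L _ (fun i => (INR L ^ 2 - part_sum 1) - 2 * INR L * part_size i + 2 * part_size i ^ 2)).
  - rewrite sum_plus, sum_minus, !sum_scal, sum_const.
    change (fun i => part_size i) with part_size. rewrite part_sum_1.
    change (sum L (fun i => part_size i ^ 2)) with (part_sum 2). ring.
  - intros i Hi. rewrite (sum_trunc n L).
    2: assumption.
    2:{ intros j Hj. apply sum_0; intros. rewrite mp_out_r by assumption. ring. }
    rewrite (sum_ext L _ (fun j => (INR L - part_size i) - INR L * same part i j - part_size j + 2 * (same part i j * part_size i))).
    + rewrite sum_plus, !sum_minus, !sum_scal, !sum_const, sum_scal_r.
      change (fun j => part_size j) with part_size. rewrite part_sum_1.
      change (sum L (same part i)) with (part_size i). ring.
    + intros j Hj. rewrite (sum_trunc n L).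
      2: assumption.
      2:{ intros k Hk. rewrite (mp_out_r i k) by assumption. ring. }
      (* Lying in one part is transitive, so all products of two or three of the indicators
         coincide, and inclusion-exclusion leaves the coefficient [3 - 1 = 2]. *)
      rewrite (sum_ext L _ (fun k => (1 - same part i j) - same part i k - same part j k + 2 * (same part i j * same part i k))).
      * rewrite sum_plus, !sum_minus, !sum_scal, !sum_const.
        change (fun k => same part i k) with (same part i). change (fun k => same part j k) with (same part j).
        fold (part_size i) (part_size j). ring.
      * intros k Hk. rewrite !mp_in by assumption. unfold same.
        destruct (Nat.eqb_spec (part i) (part j)), (Nat.eqb_spec (part i) (part k)), (Nat.eqb_spec (part j) (part k));
          try ring; congruence.
Qed.
End Multipartite.

Lemma cv_pow u l r : Un_cv u l -> Un_cv (fun k => u k ^ r) (l ^ r).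
Proof.
  intros H. induction r as [|r IH]; simpl; [apply cv_const|]. now apply (CV_mult u).
Qed.

Lemma cv_close (u v : nat -> R) l C : Un_cv u l -> (forall k, Rabs (u k - v k) <= C / INR (S k)) -> Un_cv v l.
Proof.
  intros Hu H. apply (Un_cv_ext (fun k => u k - (u k - v k))); [intros; ring|].
  replace l with (l - 0) by ring. apply (CV_minus u); [assumption|].
  apply (cv_of_error _ _ C). intros k. now rewrite Rminus_0_r.
Qed.

(** [q1] is the limiting share of non-isolated vertices, [q2] and [q3] are the limits of the sums of
    squares and of cubes of the relative part sizes. *)
Lemma multipartite_in_S23 (L : nat -> nat) (part : nat -> nat -> nat) q1 q2 q3 :
  (forall k, (L k <= k + 3)%nat) ->
  Un_cv (fun k => INR (L k) / INR (k + 3)) q1 ->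
  Un_cv (fun k => part_sum (L k) (part k) 1 / INR (k + 3) ^ 2) q2 ->
  Un_cv (fun k => part_sum (L k) (part k) 2 / INR (k + 3) ^ 3) q3 ->
  in_S23 (3 * (q1 * q2 - q3)) (q1 ^ 3 - 3 * q1 * q2 + 2 * q3).
Proof.
  intros HL C1 C2 C3.
  set (G k := multipartite (k + 3) (L k) (part k)).
  assert (Hn : forall k, (3 <= nv (G k))%nat) by (intros k; cbn; lia).
  assert (Hpos : forall k, 0 < INR (k + 3)) by (intros; apply lt_0_INR; lia).
  assert (Hinv : forall k c, 0 <= c -> c / INR (nv (G k)) <= c / INR (S k)).
  { intros k c Hc. apply Rmult_le_compat_l; [assumption|]. apply Rinv_le_contravar; [apply lt_0_INR; lia|].
    apply le_INR. cbn [G multipartite nv]. lia. }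
  set (d3 := q1 ^ 3 - 3 * q1 * q2 + 2 * q3). set (d2 := 3 * (q1 * q2 - q3)).
  set (T k := hom_tri (G k) / INR (k + 3) ^ 3). set (P k := hom_path (G k) / INR (k + 3) ^ 3).
  set (E k := hom_edge (G k) / INR (k + 3) ^ 2).
  assert (CT : Un_cv T d3).
  { apply (Un_cv_ext (fun k => (INR (L k) / INR (k + 3)) ^ 3
      - 3 * (INR (L k) / INR (k + 3) * (part_sum (L k) (part k) 1 / INR (k + 3) ^ 2))
      + 2 * (part_sum (L k) (part k) 2 / INR (k + 3) ^ 3))).
    - intros k. unfold T, G. rewrite mp_hom_tri by apply HL. field. apply Rgt_not_eq, Hpos.
    - unfold d3. replace (3 * q1 * q2) with (3 * (q1 * q2)) by ring.
      apply (CV_plus (fun k => (INR (L k) / INR (k + 3)) ^ 3 - 3 * (INR (L k) / INR (k + 3) * (part_sum (L k) (part k) 1 / INR (k + 3) ^ 2)))); [|now apply cv_scal].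
      apply (CV_minus (fun k => (INR (L k) / INR (k + 3)) ^ 3)); [now apply (cv_pow (fun k => INR (L k) / INR (k + 3)))|].
      apply cv_scal. now apply CV_mult. }
  assert (CP : Un_cv P (q1 ^ 3 - 2 * (q1 * q2) + q3)).
  { apply (Un_cv_ext (fun k => (INR (L k) / INR (k + 3)) ^ 3
      - 2 * (INR (L k) / INR (k + 3) * (part_sum (L k) (part k) 1 / INR (k + 3) ^ 2))
      + part_sum (L k) (part k) 2 / INR (k + 3) ^ 3)).
    - intros k. unfold P, G. rewrite mp_hom_path by apply HL. field. apply Rgt_not_eq, Hpos.
    - apply (CV_plus (fun k => (INR (L k) / INR (k + 3)) ^ 3 - 2 * (INR (L k) / INR (k + 3) * (part_sum (L k) (part k) 1 / INR (k + 3) ^ 2)))); [|assumption].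
      apply (CV_minus (fun k => (INR (L k) / INR (k + 3)) ^ 3)); [now apply (cv_pow (fun k => INR (L k) / INR (k + 3)))|].
      apply cv_scal. now apply CV_mult. }
  assert (CE : Un_cv E (q1 ^ 2 - q2)).
  { apply (Un_cv_ext (fun k => (INR (L k) / INR (k + 3)) ^ 2 - part_sum (L k) (part k) 1 / INR (k + 3) ^ 2)).
    - intros k. unfold E, G. rewrite mp_hom_edge by apply HL. field. apply Rgt_not_eq, Hpos.
    - apply (CV_minus (fun k => (INR (L k) / INR (k + 3)) ^ 2)); [|assumption].
      now apply (cv_pow (fun k => INR (L k) / INR (k + 3))). }
  assert (D3 : Un_cv (fun k => dens (G k) 3) d3).
  { apply (cv_close T _ _ 3); [assumption|]. intros k.
    eapply Rle_trans; [apply (dens3_error (G k) (Hn k))|]. apply Hinv. lra. }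
  assert (D2 : Un_cv (fun k => dens (G k) 2) d2).
  { apply (cv_close (fun k => 3 * (P k - T k)) _ _ 6).
    - replace d2 with (3 * (q1 ^ 3 - 2 * (q1 * q2) + q3 - d3)) by (unfold d2, d3; ring).
      apply cv_scal. now apply CV_minus.
    - intros k. eapply Rle_trans; [apply (dens2_error (G k) (Hn k))|]. apply Hinv. lra. }
  (* The limiting edge density [q1 ^ 2 - q2] is a third of [d1 + 2 d2 + 3 d3], which fixes [d1]. *)
  set (d1 := 3 * (q1 ^ 2 - q2) - (2 * d2 + 3 * d3)).
  assert (D1 : Un_cv (fun k => dens (G k) 1) d1).
  { apply (cv_close (fun k => 3 * E k - (2 * dens (G k) 2 + 3 * dens (G k) 3)) _ _ 15).
    - apply (CV_minus (fun k => 3 * E k)); [now apply cv_scal|].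
      apply (CV_plus (fun k => 2 * dens (G k) 2)); now apply cv_scal.
    - intros k. replace (3 * E k - (2 * dens (G k) 2 + 3 * dens (G k) 3) - dens (G k) 1)
        with (3 * E k - (dens (G k) 1 + 2 * dens (G k) 2 + 3 * dens (G k) 3)) by ring.
      eapply Rle_trans; [apply (dens1_error (G k) (Hn k))|]. apply Hinv. lra. }
  set (d0 := 1 - (d1 + d2 + d3)).
  assert (D0 : Un_cv (fun k => dens (G k) 0) d0).
  { apply (Un_cv_ext (fun k => 1 - (dens (G k) 1 + dens (G k) 2 + dens (G k) 3))).
    - intros k. assert (H := dens_total (G k) (Hn k)). lra.
    - apply (CV_minus (fun _ => 1)); [apply cv_const|].
      apply (CV_plus (fun k => dens (G k) 1 + dens (G k) 2)); [|assumption]. now apply CV_plus. }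
  exists d0, d1. intros eps Heps N.
  destruct (D0 eps Heps) as [N0 H0]. destruct (D1 eps Heps) as [N1 H1].
  destruct (D2 eps Heps) as [N2 H2]. destruct (D3 eps Heps) as [N3 H3].
  set (k := (N + N0 + N1 + N2 + N3)%nat). exists (G k).
  assert (R0 := H0 k ltac:(unfold k; lia)). assert (R1 := H1 k ltac:(unfold k; lia)).
  assert (R2 := H2 k ltac:(unfold k; lia)). assert (R3 := H3 k ltac:(unfold k; lia)).
  unfold Rdist in *. split; [cbn; unfold k; lia|]. lra.
Qed.

Lemma nat_floor_ex x : 0 <= x -> exists f : nat, INR f <= x < INR f + 1.
Proof.
  intros Hx. destruct (archimed x) as [A B].
  assert (Hup : (0 < up x)%Z) by (apply lt_IZR; lra).
  exists (Z.to_nat (up x - 1)). rewrite INR_IZR_INZ, Z2Nat.id by lia. rewrite minus_IZR. lra.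
Qed.

Lemma floor_seq x : 0 <= x -> exists f : nat -> nat, (forall k, INR (f k) <= x * INR (k + 3)) /\
  Un_cv (fun k => INR (f k) / INR (k + 3)) x.
Proof.
  intros Hx. assert (Hpos : forall k, 0 < INR (k + 3)) by (intros; apply lt_0_INR; lia).
  assert (H : forall k : nat, exists f : nat, INR f <= x * INR (k + 3) < INR f + 1).
  { intros k. apply nat_floor_ex. apply Rmult_le_pos; [assumption|apply pos_INR]. }
  exists (fun k => proj1_sig (constructive_indefinite_description _ (H k))).
  assert (Hf : forall k, INR (proj1_sig (constructive_indefinite_description _ (H k))) <= x * INR (k + 3)
        < INR (proj1_sig (constructive_indefinite_description _ (H k))) + 1).
  { intros k. now destruct (constructive_indefinite_description _ (H k)). }
  split; [intros; apply Hf|]. apply (cv_of_error _ _ 1). intros k.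
  set (f := proj1_sig (constructive_indefinite_description _ (H k))).
  assert (G := Hf k). fold f in G.
  assert (P := Hpos k). replace (INR f / INR (k + 3) - x) with (- ((x * INR (k + 3) - INR f) / INR (k + 3))) by (field; lra).
  rewrite Rabs_Ropp, Rabs_right.
  - apply Rle_trans with (1 / INR (k + 3)).
    + apply Rmult_le_compat_r; [left; now apply Rinv_0_lt_compat|lra].
    + apply Rmult_le_compat_l; [lra|]. apply Rinv_le_contravar; [apply lt_0_INR; lia|apply le_INR; lia].
  - apply Rle_ge, Rmult_le_pos; [lra|left; now apply Rinv_0_lt_compat].
Qed.

Lemma cv_zero_of_bound (u : nat -> R) : (forall k, 0 <= u k <= / INR (k + 3)) -> Un_cv u 0.
Proof.
  intros H. apply (cv_of_error _ _ 1). intros k. rewrite Rminus_0_r, Rabs_right by (apply Rle_ge, H).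
  eapply Rle_trans; [apply H|]. unfold Rdiv. rewrite Rmult_1_l.
  apply Rinv_le_contravar; [apply lt_0_INR; lia|apply le_INR; lia].
Qed.

(** A clique with isolated vertices: all parts are singletons, so [q2] and [q3] vanish. This covers
    [d2 = 0], including [d3 = 1], which lies on no arc. *)
Lemma clique_in_S23 w : 0 <= w <= 1 -> in_S23 0 (w ^ 3).
Proof.
  intros Hw. destruct (floor_seq w (proj1 Hw)) as [L [HL CL]].
  assert (Hpos : forall k, 1 <= INR (k + 3)).
  { intros. replace 1 with (INR 1) by reflexivity. apply le_INR; lia. }
  assert (HL2 : forall k, INR (L k) <= INR (k + 3)).
  { intros k. specialize (HL k). specialize (Hpos k). nra. }
  assert (Hsz : forall l i, (i < l)%nat -> part_size l (fun i => i) i = 1).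
  { intros l i Hi. unfold part_size. rewrite (sum_ext l _ (fun j => unit_at i j * 1)).
    - now rewrite sum_unit_at.
    - intros j _. unfold same, unit_at. rewrite Nat.eqb_sym. ring. }
  assert (Hps : forall l r, part_sum l (fun i => i) r = INR l).
  { intros l r. unfold part_sum. rewrite (sum_ext l _ (fun _ => 1)) by (intros; rewrite Hsz by assumption; apply pow1).
    rewrite sum_const. ring. }
  replace 0 with (3 * (w * 0 - 0)) by ring. replace (w ^ 3) with (w ^ 3 - 3 * w * 0 + 2 * 0) by ring.
  apply (multipartite_in_S23 L (fun _ i => i)).
  - intros k. apply INR_le. exact (HL2 k).
  - exact CL.
  - apply cv_zero_of_bound. intros k. rewrite Hps. specialize (Hpos k). specialize (HL2 k). assert (P := pos_INR (L k)).
    assert (0 < / INR (k + 3) ^ 2) by (apply Rinv_0_lt_compat, pow_lt; lra). split.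
    + apply Rmult_le_pos; lra.
    + replace (/ INR (k + 3)) with (INR (k + 3) / INR (k + 3) ^ 2) by (field; lra).
      apply Rmult_le_compat_r; lra.
  - apply cv_zero_of_bound. intros k. rewrite Hps. specialize (Hpos k). specialize (HL2 k). assert (P := pos_INR (L k)).
    assert (0 < / INR (k + 3) ^ 3) by (apply Rinv_0_lt_compat, pow_lt; lra). split.
    + apply Rmult_le_pos; lra.
    + replace (/ INR (k + 3)) with (INR (k + 3) ^ 2 / INR (k + 3) ^ 3) by (field; lra).
      apply Rmult_le_compat_r; [lra|]. nra.
Qed.

Definition block_part (m A i : nat) : nat := if (i <? m * A)%nat then (i / A)%nat else m.

Lemma sum_blocks m A g : sum (m * A) (fun i => g (i / A)%nat) = INR A * sum m g.
Proof.
  induction m as [|m IH]; [simpl; ring|].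
  replace (S m * A)%nat with (m * A + A)%nat by lia. rewrite sum_add, IH. cbn [sum].
  rewrite (sum_ext A _ (fun _ => g m)).
  - rewrite sum_const. ring.
  - intros i Hi. rewrite Nat.div_add_l, Nat.div_small by lia. now rewrite Nat.add_0_r.
Qed.

Lemma sum_block_part m A B g :
  sum (m * A + B) (fun i => g (block_part m A i)) = INR A * sum m g + INR B * g m.
Proof.
  rewrite sum_add, <- sum_blocks, <- sum_const. f_equal.
  - apply sum_ext. intros i Hi. unfold block_part. now apply Nat.ltb_lt in Hi as ->.
  - apply sum_ext. intros i _. unfold block_part.
    destruct (Nat.ltb_spec (m * A + i) (m * A)); [lia|reflexivity].
Qed.

Lemma block_part_size m A B i : (i < m * A + B)%nat ->
  part_size (m * A + B) (block_part m A) i = if (block_part m A i =? m)%nat then INR B else INR A.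
Proof.
  intros Hi. unfold part_size, same.
  rewrite (sum_block_part m A B (fun t => if (block_part m A i =? t)%nat then 1 else 0)).
  assert (Hle : (block_part m A i <= m)%nat).
  { unfold block_part. destruct (Nat.ltb_spec i (m * A)); [|lia].
    apply Nat.lt_le_incl, Nat.Div0.div_lt_upper_bound. lia. }
  destruct (Nat.eqb_spec (block_part m A i) m) as [->|Hne].
  - rewrite (sum_0 m); [ring|]. intros t Ht. destruct (Nat.eqb_spec m t); [lia|reflexivity].
  - rewrite (sum_ext m _ (fun t => unit_at (block_part m A i) t * 1)).
    + rewrite sum_unit_at by lia. ring.
    + intros t _. unfold unit_at. rewrite Nat.eqb_sym. ring.
Qed.

Lemma block_part_sum m A B r :
  part_sum (m * A + B) (block_part m A) r = INR m * INR A ^ S r + INR B ^ S r.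
Proof.
  unfold part_sum.
  set (g := fun t => (if (t =? m)%nat then INR B else INR A) ^ r).
  rewrite (sum_ext _ _ (fun i => g (block_part m A i))).
  - rewrite sum_block_part. unfold g. rewrite (sum_ext m _ (fun _ => INR A ^ r)).
    + rewrite sum_const, Nat.eqb_refl. simpl. ring.
    + intros t Ht. destruct (Nat.eqb_spec t m); [lia|reflexivity].
  - intros i Hi. unfold g. now rewrite block_part_size.
Qed.

(** [w] is the share of non-isolated vertices, hence the factor [w ^ 3]. Part sizes are rounded
    down, so that they fit into the vertex set. *)
Lemma blocks_in_S23 (m : nat) a b w : 0 <= a -> 0 <= b -> INR m * a + b = 1 -> 0 <= w <= 1 ->
  let p2 := INR m * a ^ 2 + b ^ 2 in
  let p3 := INR m * a ^ 3 + b ^ 3 in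
  in_S23 (w ^ 3 * (3 * (p2 - p3))) (w ^ 3 * (1 - 3 * p2 + 2 * p3)).
Proof.
  intros Ha Hb Hab Hw p2 p3.
  destruct (floor_seq (w * a) ltac:(nra)) as [A [HA CA]].
  destruct (floor_seq (w * b) ltac:(nra)) as [B [HB CB]].
  assert (Hpos : forall k, 0 < INR (k + 3)) by (intros; apply lt_0_INR; lia).
  assert (Hcv : forall r, Un_cv (fun k => part_sum (m * A k + B k) (block_part m (A k)) r / INR (k + 3) ^ S r)
              (w ^ S r * (INR m * a ^ S r + b ^ S r))).
  { intros r. apply (Un_cv_ext (fun k => INR m * (INR (A k) / INR (k + 3)) ^ S r + (INR (B k) / INR (k + 3)) ^ S r)).
    - intros k. rewrite block_part_sum. unfold Rdiv. rewrite !Rpow_mult_distr, !pow_inv. ring.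
    - replace (w ^ S r * (INR m * a ^ S r + b ^ S r)) with (INR m * (w * a) ^ S r + (w * b) ^ S r) by (rewrite !Rpow_mult_distr; ring).
      apply (CV_plus (fun k => INR m * (INR (A k) / INR (k + 3)) ^ S r)).
      + apply cv_scal. now apply (cv_pow (fun k => INR (A k) / INR (k + 3))).
      + now apply (cv_pow (fun k => INR (B k) / INR (k + 3))). }
  replace (w ^ 3 * (3 * (p2 - p3))) with (3 * (w * (w ^ 2 * p2) - w ^ 3 * p3)) by ring.
  replace (w ^ 3 * (1 - 3 * p2 + 2 * p3)) with (w ^ 3 - 3 * w * (w ^ 2 * p2) + 2 * (w ^ 3 * p3)) by ring.
  apply (multipartite_in_S23 (fun k => m * A k + B k)%nat (fun k => block_part m (A k))).
  - intros k. apply INR_le. rewrite plus_INR, mult_INR.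
    assert (M := pos_INR m).
    assert (INR m * INR (A k) <= INR m * (w * a * INR (k + 3))) by (apply Rmult_le_compat_l; auto).
    assert (E : INR m * (w * a * INR (k + 3)) + w * b * INR (k + 3) = w * INR (k + 3)).
    { transitivity (w * INR (k + 3) * (INR m * a + b)); [ring|]. rewrite Hab. ring. }
    specialize (HB k). specialize (Hpos k). nra.
  - replace w with (INR m * (w * a) + w * b) by (transitivity (w * (INR m * a + b)); [ring|rewrite Hab; ring]).
    apply (Un_cv_ext (fun k => INR m * (INR (A k) / INR (k + 3)) + INR (B k) / INR (k + 3))).
    + intros k. cbv beta. rewrite (plus_INR (m * A k) (B k)), mult_INR. field. apply Rgt_not_eq, Hpos.
    + apply (CV_plus (fun k => INR m * (INR (A k) / INR (k + 3)))); [now apply cv_scal|assumption].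
  - exact (Hcv 1%nat).
  - exact (Hcv 2%nat).
Qed.

(** * Every point below the curve is attained *)

Lemma curve_in_S23 k z w : (3 <= k)%nat -> 0 <= z <= 1 / INR k -> 0 <= w <= 1 ->
  in_S23 (w ^ 3 * (3 / 2 * (curve_d k z - curve_t k z))) (w ^ 3 * curve_t k z).
Proof.
  intros Hk Hz Hw. assert (HK := INR_ge_3 k Hk).
  assert (Hz1 : z <= 1).
  { apply Rle_trans with (1 / INR k); [apply Hz|]. apply Rmult_le_reg_r with (INR k); [lra|].
    unfold Rdiv. rewrite Rmult_assoc, Rinv_l; lra. }
  assert (Em : INR (k - 1) = INR k - 1) by (rewrite minus_INR by lia; reflexivity).
  assert (H := blocks_in_S23 (k - 1) ((1 - z) / (INR k - 1)) z w).
  cbv zeta in H. rewrite Em in H.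
  replace (curve_t k z) with (1 - 3 * ((INR k - 1) * ((1 - z) / (INR k - 1)) ^ 2 + z ^ 2)
     + 2 * ((INR k - 1) * ((1 - z) / (INR k - 1)) ^ 3 + z ^ 3)) by (unfold curve_t; field; lra).
  replace (curve_d k z) with (1 - ((INR k - 1) * ((1 - z) / (INR k - 1)) ^ 2 + z ^ 2)) by (unfold curve_d; field; lra).
  match goal with |- in_S23 (_ * (3 / 2 * (1 - ?p - (1 - 3 * ?p + 2 * ?q)))) _ =>
    replace (3 / 2 * (1 - p - (1 - 3 * p + 2 * q))) with (3 * (p - q)) by (field; lra) end.
  apply H; [|lra| |assumption].
  - apply Rmult_le_pos; [lra|left; apply Rinv_0_lt_compat; lra].
  - field. lra.
Qed.

(* Simpson's rule is exact for the derivative, a multiple of [(1 - s) (1 - k s)]. *)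
Lemma curve_t_mono k z z' : (3 <= k)%nat -> 0 <= z -> z <= z' -> z' <= 1 / INR k ->
  curve_t k z <= curve_t k z'.
Proof.
  intros Hk Hz Hzz Hz'. assert (HK := INR_ge_3 k Hk).
  set (h := fun s => 6 * (1 - s) * (1 - INR k * s)).
  assert (Hh : forall s, s <= 1 / INR k -> 0 <= h s).
  { intros s Hs.
    assert (INR k * s <= 1).
    { replace 1 with (INR k * (1 / INR k)) by (field; lra). apply Rmult_le_compat_l; lra. }
    assert (1 / INR k <= 1).
    { apply Rmult_le_reg_r with (INR k); [lra|]. unfold Rdiv. rewrite Rmult_assoc, Rinv_l; lra. }
    unfold h. apply Rmult_le_pos; lra. }
  assert (E : curve_t k z' - curve_t k z =
     (INR k - 2) / (INR k - 1) ^ 2 * ((z' - z) * ((h z + 4 * h ((z + z') / 2) + h z') / 6))).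
  { unfold curve_t, h. field. lra. }
  assert (0 <= (INR k - 2) / (INR k - 1) ^ 2 * ((z' - z) * ((h z + 4 * h ((z + z') / 2) + h z') / 6))).
  { apply Rmult_le_pos.
    - apply Rmult_le_pos; [lra|left; apply Rinv_0_lt_compat, pow_lt; lra].
    - apply Rmult_le_pos; [lra|].
      assert (H1 := Hh z ltac:(lra)). assert (H2 := Hh z' ltac:(lra)).
      assert (H3 := Hh ((z + z') / 2) ltac:(lra)). lra. }
  lra.
Qed.

Lemma cube_root v : 0 <= v <= 1 -> exists w, 0 <= w <= 1 /\ w ^ 3 = v.
Proof.
  intros Hv. destruct (ivt_affine_sign (fun w => w ^ 3 - v) 0 1) as [w [Hw E]]; [reg|lra|lra|lra|].
  exists w. split; [assumption|lra].
Qed.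

(* Moving along the curve while adding isolated vertices to keep the triangle density
   [d3], the cherry density sweeps all values below the maximum. *)
Lemma curve_ratio_ex d2 d3 k0 z0 : 0 < d2 -> 0 < d3 ->
  (3 <= k0)%nat -> 0 <= z0 <= 1 / INR k0 ->
  d3 <= curve_t k0 z0 -> d2 * curve_t k0 z0 <= 3 / 2 * (curve_d k0 z0 - curve_t k0 z0) * d3 ->
  exists k z, (3 <= k)%nat /\ 0 <= z <= 1 / INR k /\ d3 <= curve_t k z /\
    d2 * curve_t k z = 3 / 2 * (curve_d k z - curve_t k z) * d3.
Proof.
  intros H2 H3 Hk0 Hz0 Ht0 Hg0.
  set (sol := exists k z, (3 <= k)%nat /\ 0 <= z <= 1 / INR k /\ d3 <= curve_t k z /\
    d2 * curve_t k z = 3 / 2 * (curve_d k z - curve_t k z) * d3).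
  (* A zero of [g] is a curve point whose ratio of cherries to triangles is [d2 / d3]; isolated
     vertices preserve that ratio. *)
  set (g k z := d2 * curve_t k z - 3 / 2 * (curve_d k z - curve_t k z) * d3).
  assert (Harc : forall k zs, (3 <= k)%nat -> 0 <= zs <= 1 / INR k -> d3 <= curve_t k zs -> g k zs <= 0 ->
     sol \/ (g k (1 / INR k) < 0 /\ d3 <= curve_t k (1 / INR k))).
  { intros k zs Hk Hzs Ht Hg. destruct (Rlt_dec (g k (1 / INR k)) 0) as [L|L].
    - right. split; [assumption|]. eapply Rle_trans; [exact Ht|]. apply curve_t_mono; auto; lra.
    - left. destruct (ivt_affine_sign (g k) zs (1 / INR k)) as [z [Hz Ez]]; [|lra|assumption|lra|].
      + unfold g. apply continuity_minus; [apply continuity_scal, continuity_curve_t|].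
        apply (continuity_mult (fun z => 3 / 2 * (curve_d k z - curve_t k z)) (fun _ => d3)).
        * apply (continuity_scal (fun z => curve_d k z - curve_t k z)).
          apply (continuity_minus (curve_d k) (curve_t k)); [apply continuity_curve_d|apply continuity_curve_t].
        * apply continuity_const. now intros ? ?.
      + exists k, z. split; [assumption|]. split; [lra|]. split.
        * eapply Rle_trans; [exact Ht|]. apply curve_t_mono; auto; lra.
        * unfold g in Ez. lra. }
  (* Consecutive arcs share an end, so a negative value of [g] is handed on until some arc contains
     a zero. *)
  assert (Hind : forall j, sol \/ (g (k0 + j)%nat (1 / INR (k0 + j)) < 0 /\ d3 <= curve_t (k0 + j) (1 / INR (k0 + j)))).
  { induction j as [|j [IH|[IH1 IH2]]].
    - rewrite Nat.add_0_r. apply (Harc k0 z0); auto. unfold g. lra.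
    - now left.
    - rewrite Nat.add_succ_r. apply (Harc _ 0).
      + lia.
      + split; [lra|]. left. apply Rdiv_lt_0_compat; [lra|apply lt_0_INR; lia].
      + rewrite <- curve_t_end by lia. assumption.
      + unfold g in *. rewrite <- curve_t_end, <- curve_d_end by lia. lra. }
  (* At the end of arc [k], with [i = 1 / k], [curve_t] is at least [1 - 3 i] and
     [curve_d - curve_t] at most [3 i], so [g] is at least [d2 - i (3 d2 + 9/2 d3)], which is
     nonnegative for large [k]. *)
  destruct (archimed_cor1 (d2 / (3 * d2 + 9 / 2 * d3)) ltac:(apply Rdiv_lt_0_compat; lra)) as [N [HN PN]].
  destruct (Hind N) as [|[Hneg _]]; [assumption|]. exfalso.
  set (k := (k0 + N)%nat) in *. assert (Hk : (3 <= k)%nat) by (unfold k; lia).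
  assert (HK := INR_ge_3 k Hk).
  assert (HkN : 1 / INR k <= / INR N).
  { unfold Rdiv. rewrite Rmult_1_l. apply Rinv_le_contravar; [now apply lt_0_INR|apply le_INR; unfold k; lia]. }
  assert (A := curve_t_end_ge k Hk). assert (B := curve_d_le k (1 / INR k) Hk).
  assert (Hi : 0 < 1 / INR k) by (apply Rdiv_lt_0_compat; lra).
  set (i := 1 / INR k) in *. replace (3 / INR k) with (3 * i) in A by (unfold i; field; lra).
  assert (Hsmall : i * (3 * d2 + 9 / 2 * d3) <= d2).
  { apply Rle_trans with (d2 / (3 * d2 + 9 / 2 * d3) * (3 * d2 + 9 / 2 * d3)).
    - apply Rmult_le_compat_r; lra.
    - right. field. lra. }
  unfold g in Hneg.
  assert (d2 * (1 - 3 * i) <= d2 * curve_t k i) by (apply Rmult_le_compat_l; lra).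
  assert (3 / 2 * (curve_d k i - curve_t k i) * d3 <= 3 / 2 * (3 * i) * d3) by (apply Rmult_le_compat_r; lra).
  lra.
Qed.

Lemma in_S23_lower d2 d3 : 0 <= d2 -> 0 <= d3 -> d3 <= 1 -> d2 <= 3 / 2 * (gR_inv d3 - d3) -> in_S23 d2 d3.
Proof.
  intros H2 H3 H3' Hub.
  destruct (Req_dec d2 0) as [->|N2].
  { destruct (cube_root d3 (conj H3 H3')) as [w [Hw <-]]. now apply clique_in_S23. }
  destruct (gR_inv_cases d3 (conj H3 H3')) as [[E1 E2]|[k0 [z0 [Hk0 [Hz0 [Ed Et]]]]]]; [lra|].
  rewrite Ed in Hub.
  destruct (Req_dec d3 0) as [E3|N3].
  (* The extremal point is now triangle-free, so isolated vertices alone lower [d2] and keep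
     [d3 = 0]. *)
  - set (v := d2 / (3 / 2 * curve_d k0 z0)).
    assert (Hd : 0 < 3 / 2 * curve_d k0 z0) by lra.
    destruct (cube_root v) as [w [Hw Ew]].
    { unfold v. split; [apply Rmult_le_pos; [lra|left; now apply Rinv_0_lt_compat]|].
      apply Rmult_le_reg_r with (3 / 2 * curve_d k0 z0); [assumption|].
      unfold Rdiv at 1. rewrite Rmult_assoc, Rinv_l; lra. }
    assert (H := curve_in_S23 k0 z0 w Hk0 Hz0 Hw). rewrite <- Et, E3, Ew in H. rewrite E3.
    replace (v * (3 / 2 * (curve_d k0 z0 - 0))) with d2 in H by (unfold v; field; lra).
    now replace (v * 0) with 0 in H by ring.
  - destruct (curve_ratio_ex d2 d3 k0 z0) as [k [z [Hk [Hz [Ht Hr]]]]]; auto; try lra.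
    { rewrite <- Et. apply Rmult_le_compat_r; lra. }
    destruct (cube_root (d3 / curve_t k z)) as [w [Hw Ew]].
    { split; [apply Rmult_le_pos; [lra|left; apply Rinv_0_lt_compat; lra]|].
      apply Rmult_le_reg_r with (curve_t k z); [lra|]. unfold Rdiv. rewrite Rmult_assoc, Rinv_l; lra. }
    assert (H := curve_in_S23 k z w Hk Hz Hw). rewrite Ew in H.
    replace (d3 / curve_t k z * curve_t k z) with d3 in H by (field; lra).
    replace (d3 / curve_t k z * (3 / 2 * (curve_d k z - curve_t k z))) with d2 in H; [assumption|].
    apply Rmult_eq_reg_r with (curve_t k z); [|lra]. rewrite Hr. field. lra.
Qed.

Theorem theorem14 (d2 d3 : R) :
  in_S23 d2 d3 <->
  (0 <= d2 /\ 0 <= d3 /\ d3 <= 1 /\ d2 <= 3 / 2 * (gR_inv d3 - d3)).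
Proof.
  split.
  - apply in_S23_upper.
  - intros [H2 [H3 [H3' H]]]. now apply in_S23_lower.
Qed.
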